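(* Let $\{x^k\}$ and $\{p_k\}$ be the sequences generated by the algorithm CDP-ESQM (described in the context) applied to the problem $$(\mathrm{P})\qquad \min_{x\in X}\ \varphi_0(x)=g_0(x)-h_0(x)\quad\text{subject to}\quad \varphi_i(x)=g_i(x)-h_i(x)\le 0,\ i\in\mathcal I .$$ If both sequences $\{x^k\}$ and $\{p_k\}$ are bounded, then there is a positive constant $\bar p$ such that $p_k=\bar p$ for all sufficiently large $k$. If furthermore the merit function $E_{\bar p}$ (defined in the context) is a PLK function, then $\{x^k\}$ converges to a stationary point of (P).
   Context: **Standing assumptions.** $\mathcal I$ is a finite index set and $X\subset\mathbb R^n$ is nonempty, closed and convex. For $i\in\{0\}\cup\mathcal I$, $g_i:\mathbb R^n\to\mathbb R$ is continuously differentiable with locally Lipschitz gradient on $X$, and $h_i:\mathbb R^n\to(-\infty,\infty]$ is locally Lipschitz continuous and prox-regular at each point of $X$. Put $\varphi_i:=g_i-h_i$; there is a constant $m_{\varphi_0}$ with $\varphi_0\ge m_{\varphi_0}$ on $X$. **Variational notions.** For a lower semicontinuous (l.s.c.) $f:\mathbb R^n\to(-\infty,\infty]$ and $x$ with $f(x)<\infty$, the regular subdifferential is $\hat\partial f(x)=\{v:\liminf_{u\to x}\frac{f(u)-f(x)-\langle v,u-x\rangle}{\|u-x\|}\ge0\}$, and the limiting subdifferential $\partial f(x)$ is the set of all $v$ for which there are $x_k\to x$ with $f(x_k)\to f(x)$ and $v_k\in\hat\partial f(x_k)$ with $v_k\to v$. $f$ is prox-regular at $\bar x$ if $f(\bar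 x)<\infty$, $f$ is l.s.c. around $\bar x$, and for every $\bar v\in\partial f(\bar x)$ there are $\varepsilon>0$, $r\ge0$ with $f(x')\ge f(x)+\langle v,x'-x\rangle-\frac r2\|x'-x\|^2$ whenever $\|x-\bar x\|\le\varepsilon$, $\|x'-\bar x\|\le\varepsilon$, $f(x)\le f(\bar x)+\varepsilon$, $v\in\partial f(x)$, $\|v-\bar v\|\le\varepsilon$. $\mathcal N_X(x)=\{v:\langle v,x'-x\rangle\le0\ \forall x'\in X\}$ for $x\in X$ and $\mathcal N_X(x)=\emptyset$ otherwise; $\delta_X$ is the indicator function of $X$. **Stationary point.** A feasible point $\bar x$ of (P) (i.e. $\bar x\in X$, $\varphi_i(\bar x)\le0$ for $i\in\mathcal I$) is a stationary point if there are $\lambda_i\ge0$, $i\in\mathcal I$, with $0\in\nabla g_0(\bar x)-\partial h_0(\bar x)+\sum_{i\in\mathcal I}\lambda_i(\nabla g_i(\bar x)-\partial h_i(\bar x))+\mathcal N_X(\bar x)$ and $\lambda_i\varphi_i(\bar x)=0$ for all $i\in\mathcal I$. **Algorithm CDP-ESQM.** For $p>0$ let $\phi_p(x):=\frac1p\varphi_0(x)+\sum_{i\in\mathcal I}\max\{\varphi_i(x),0\}$. Input: $x^0\in X$, $\beta,\sigma\in(0,1)$, $p_0,\varrho_p,c_p>0$. For $k=0,1,\dots$: 1. Choose $v_i^k\in\partial h_i(x^k)$ for $i\in\{0\}\cup\mathcal I$. 2. Choose a symmetric positive definite $G_k\in\mathbb R^{n\times n}$; it is assumed that there are constants $\alpha,M_G>0$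 independent of $k$ with $\alpha\|d\|^2\le\langle G_kd,d\rangle\le M_G\|d\|^2$ for all $d\in\mathbb R^n$, $k\ge0$. 3. With $\tilde\phi_k(x):=\frac1{p_k}\big(\varphi_0(x^k)+\langle\nabla g_0(x^k)-v_0^k,x-x^k\rangle\big)+\sum_{i\in\mathcal I}\max\{\varphi_i(x^k)+\langle\nabla g_i(x^k)-v_i^k,x-x^k\rangle,0\}$, let $d^k$ be the unique minimizer over $d\in\mathbb R^n$ of $\tilde\phi_k(x^k+d)+\frac12\langle G_kd,d\rangle+\delta_X(x^k+d)$. 4. If $d^k=0$ and $\varphi_i(x^k)\le0$ for all $i\in\mathcal I$, stop and return $x^k$. 5. Set $\tau_k:=\beta^{q_k}$, with $q_k$ the smallest nonnegative integer such that $\phi_{p_k}(x^k+\tau_kd^k)\le\tilde\phi_k(x^k+\tau_kd^k)+(1-\sigma)\alpha\tau_k\|d^k\|^2$. 6. $x^{k+1}:=x^k+\tau_kd^k$. 7. $t^k:=\sum_{i\in\mathcal I}\max\{\varphi_i(x^k)+\langle\nabla g_i(x^k)-v_i^k,d^k\rangle,0\}$; set $p_{k+1}:=p_k+\varrho_p$ if $t^k\ge c_p\|d^k\|$, and $p_{k+1}:=p_k$ otherwise. **Merit function.** For bounded $\{x^k\}$, fix a compact convex set $D\subset X$ with $\{x^k\}\subset D$ and a constant $\rho_h>0$ such that $h_i+\frac{\rho_h}2\|\cdot\|^2$ is convex on $D$ for all $i\in\{0\}\cup\mathcal I$ (such $D,\rho_h$ exist). Put $\hat g_i(x):=g_i(x)+\frac{\rho_h}2\|x\|^2$,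 $\hat h_i(x):=h_i(x)+\frac{\rho_h}2\|x\|^2$, $\hat h_i^*(\hat v):=\sup_{x\in D}\{\langle\hat v,x\rangle-\hat h_i(x)\}$. For $p>0$, $x,d\in\mathbb R^n$, $\tau\in\mathbb R$, $G\in\mathbb R^{n\times n}$, $\mathbf w=(w_i)_{i\in\{0\}\cup\mathcal I}$, $\hat{\mathbf v}=(\hat v_i)_{i\in\{0\}\cup\mathcal I}$ with $w_i,\hat v_i\in\mathbb R^n$, $$E_p(x,\tau,d,G,\mathbf w,\hat{\mathbf v}):=\tfrac1p\big(\hat g_0(x)+\langle w_0,\tau d\rangle+\hat h_0^*(\hat v_0)-\langle\hat v_0,x\rangle\big)+\sum_{i\in\mathcal I}\max\{\hat g_i(x)+\langle w_i,\tau d\rangle+\hat h_i^*(\hat v_i)-\langle\hat v_i,x\rangle,0\}+\tau\langle Gd,d\rangle+\delta_X(x+d).$$ **PLK functions.** An l.s.c. function $f$ on a Euclidean space with values in $(-\infty,\infty]$ satisfies the PLK property at $\bar x\in\mathrm{dom}(f)$ if there are $\varepsilon,\eta>0$ and a concave $\psi:[0,\eta)\to[0,\infty)$ with $\psi(0)=0$, $\psi$ continuous at $0$ and $C^1$ on $(0,\eta)$, $\psi'>0$ on $(0,\eta)$, such that $\psi'(f(x)-f(\bar x))\,\mathrm{dist}(0,\partial f(x))\ge1$ for all $x$ with $\|x-\bar x\|<\varepsilon$ and $f(\bar x)<f(x)<f(\bar x)+\eta$. $f$ is a PLK function if this holds at every point of $\mathrm{dom}(f)$. *)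

(* Defs.v *)
From HB Require Import structures.
From mathcomp Require Import all_boot all_order all_algebra.
From mathcomp Require Import all_classical all_reals all_analysis.

Set Implicit Arguments.
Unset Strict Implicit.
Unset Printing Implicit Defensive.

Import Order.TTheory GRing.Theory Num.Theory.
Import numFieldNormedType.Exports.

Local Open Scope classical_set_scope.
Local Open Scope ring_scope.

(* The library norm of a matrix is the sup norm and that of a pair is the max
   norm. They give the right topology, but every inequality below that mentions
   a norm or a distance is about the Euclidean norm [enorm ip] of an explicit
   scalar product [ip]. *)
Definition enorm (R : realType) (V : Type) (ip : V -> V -> R) (x : V) : R :=
  Num.sqrt (ip x x).

Definition mxdot (R : realType) (m n : nat) (A B : 'M[R]_(m, n)) : R :=
  \sum_(i < m) \sum_(j < n) A i j * B i j.

Section Variational.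
Variables (R : realType) (V : normedModType R) (ip : V -> V -> R).
Implicit Types (f : V -> \bar R) (x v : V).
Local Open Scope ereal_scope.

Definition regular_subdiff f x : set V :=
  [set v | f x \is a fin_num /\
     0 <= limf_einf (fun u => (f u - f x - (ip v (u - x)%R)%:E)
                              * ((enorm ip (u - x)%R)^-1)%:E) x^'].

Definition limiting_subdiff f x : set V :=
  [set v | f x \is a fin_num /\
     exists (xs vs : nat -> V),
       [/\ xs @ \oo --> x, f \o xs @ \oo --> f x,
           forall k, regular_subdiff f (xs k) (vs k) & vs @ \oo --> v]].

Definition lsc_at f x : Prop :=
  forall a : R, a%:E < f x -> \forall u \near x, a%:E < f u.

Definition prox_regular f x0 : Prop :=
  [/\ f x0 \is a fin_num,
      \forall x \near x0, lsc_at f x &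
      forall v0, limiting_subdiff f x0 v0 ->
      exists eps r : R, [/\ (0 < eps)%R, (0 <= r)%R &
        forall x x' v,
          (enorm ip (x - x0) <= eps)%R -> (enorm ip (x' - x0) <= eps)%R ->
          f x <= f x0 + eps%:E ->
          limiting_subdiff f x v -> (enorm ip (v - v0) <= eps)%R ->
          f x + (ip v (x' - x)%R - r / 2 * enorm ip (x' - x)%R ^+ 2)%:E
            <= f x']].

Definition dist0 (A : set V) : \bar R :=
  ereal_inf [set (enorm ip v)%:E | v in A].

Definition desingularizing (eta : R) (psi : R -> R) : Prop :=
  [/\ (forall s : R, (0 <= s < eta)%R -> (0 <= psi s)%R),
      convex_function (E := R^o) `[0%R, eta[ (fun s => - psi s)%R,
      psi 0%R = 0%R,
      psi s @[s --> 0%R^'+] --> psi 0%R &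
      forall s : R, (0 < s < eta)%R ->
        [/\ derivable psi s 1, {for s, continuous (derive1 psi)} &
            (0 < derive1 psi s)%R]].

Definition PLK_at f x0 : Prop :=
  exists (eps eta : R) (psi : R -> R),
    [/\ (0 < eps)%R, (0 < eta)%R, desingularizing eta psi &
      forall x, (enorm ip (x - x0) < eps)%R ->
        f x0 < f x -> f x < f x0 + eta%:E ->
        1 <= (derive1 psi (fine (f x) - fine (f x0)))%:E
             * dist0 (limiting_subdiff f x)].

Definition PLK_function f : Prop :=
  [/\ (forall x, f x != -oo), lower_semicontinuous f &
      forall x, f x < +oo -> PLK_at f x].

End Variational.

Section Problem.
Variables (R : realType) (n : nat) (I : finType).
Local Notation V := 'cV[R]_n.
Local Notation dot := (@mxdot R n 1).
Local Notation norm := (enorm dot).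
Local Notation subdiff := (limiting_subdiff dot).

(* [None] is the index 0 of the objective; [Some i] is the constraint i. *)
Variables (X : set V) (g : option I -> V -> R) (h : option I -> V -> \bar R).

Definition grad (f : V -> R) (x : V) : V :=
  \col_i 'd f x (delta_mx i 0 : V).

Definition C1 (f : V -> R) : Prop :=
  (forall x, differentiable f x) /\ continuous (grad f).

Definition loc_lipschitz_grad_on (f : V -> R) (A : set V) : Prop :=
  forall x, A x ->
    exists2 U, nbhs x U & [lipschitz (grad f y) | y in U `&` A].

Definition loc_lipschitz_at (f : V -> \bar R) (x : V) : Prop :=
  exists2 U, nbhs x U &
    (forall y, U y -> f y \is a fin_num) /\
    [lipschitz ((fine (f y)) : R^o) | y in U].

Definition normal_cone (x : V) : set V :=
  [set u | X x /\ forall y, X y -> dot u (y - x) <= 0].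

Definition indicator (x : V) : \bar R :=
  if `[< X x >] then 0%E else +oo%E.

Definition phi (i : option I) (x : V) : \bar R := ((g i x)%:E - h i x)%E.

Record standing_assumptions : Prop := {
  X_neq0 : X !=set0;
  X_closed : closed X;
  X_convex : convex_set X;
  g_C1 : forall i, C1 (g i);
  g_grad_lipschitz : forall i, loc_lipschitz_grad_on (g i) X;
  h_gtNy : forall i x, h i x != -oo%E;
  h_lipschitz : forall i x, X x -> loc_lipschitz_at (h i) x;
  h_prox_regular : forall i x, X x -> prox_regular dot (h i) x;
  phi0_bounded_below : exists m : R, forall x, X x -> (m%:E <= phi None x)%E
}.

Definition feasible (x : V) : Prop :=
  X x /\ forall i : I, (phi (Some i) x <= 0)%E.

Definition stationary (x : V) : Prop :=
  feasible x /\
  exists (lambda : I -> R) (v : option I -> V) (u : V),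
    [/\ forall i, 0 <= lambda i,
        forall i, subdiff (h i) x (v i),
        normal_cone x u,
        0 = (grad (g None) x - v None)
            + \sum_(i : I) lambda i *: (grad (g (Some i)) x - v (Some i)) + u &
        forall i, ((lambda i)%:E * phi (Some i) x = 0)%E].

Definition penalty (p : R) (x : V) : \bar R :=
  ((p^-1)%:E * phi None x + \sum_(i : I) maxe (phi (Some i) x) 0)%E.

(* [linearized xk v i e] is phi_i linearized at [xk] and evaluated at [xk + e];
   [penalty_model] is the function phi-tilde_k. *)
Definition linearized (xk : V) (v : option I -> V) (i : option I) (e : V) :
    \bar R :=
  (phi i xk + (dot (grad (g i) xk - v i) e)%:E)%E.

Definition penalty_model (p : R) (xk : V) (v : option I -> V) (y : V) :
    \bar R :=
  ((p^-1)%:E * linearized xk v None (y - xk)%R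
   + \sum_(i : I) maxe (linearized xk v (Some i) (y - xk)%R) 0)%E.

Definition subproblem_obj (p : R) (xk : V) (v : option I -> V) (G : 'M[R]_n)
    (d : V) : \bar R :=
  (penalty_model p xk v (xk + d) + (2^-1 * dot (G *m d) d)%:E
   + indicator (xk + d))%E.

Definition unique_minimizer (f : V -> \bar R) (d : V) : Prop :=
  (forall e, (f d <= f e)%E) /\
  (forall d', (forall e, (f d' <= f e)%E) -> d' = d).

Definition line_search_test (sigma alpha p tau : R) (xk : V)
    (v : option I -> V) (d : V) : Prop :=
  (penalty p (xk + tau *: d)%R <=
   penalty_model p xk v (xk + tau *: d)%R
   + ((1 - sigma) * alpha * tau * norm d ^+ 2)%:E)%E.

Definition model_infeasibility (xk : V) (v : option I -> V) (d : V) : \bar R :=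
  (\sum_(i : I) maxe (linearized xk v (Some i) d) 0)%E.

(* An infinite run: the stopping test never succeeds. [beta ^+ q k] is the
   step size tau_k. *)
Record CDP_ESQM_run (beta sigma varrho c alpha M_G : R)
    (x : nat -> V) (p : nat -> R) (v : nat -> option I -> V)
    (G : nat -> 'M[R]_n) (d : nat -> V) (q : nat -> nat) : Prop := {
  beta_itv : 0 < beta < 1;
  sigma_itv : 0 < sigma < 1;
  p0_gt0 : 0 < p 0%N;
  varrho_gt0 : 0 < varrho;
  c_gt0 : 0 < c;
  alpha_gt0 : 0 < alpha;
  M_G_gt0 : 0 < M_G;
  x0_in : X (x 0%N);
  v_subdiff : forall k i, subdiff (h i) (x k) (v k i);
  G_sym : forall k, (G k)^T = G k;
  G_posdef : forall k e, e != 0 -> 0 < dot (G k *m e) e;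
  G_bounds : forall k e,
    alpha * norm e ^+ 2 <= dot (G k *m e) e <= M_G * norm e ^+ 2;
  d_minimizer : forall k,
    unique_minimizer (subproblem_obj (p k) (x k) (v k) (G k)) (d k);
  no_stop : forall k,
    ~ (d k = 0 /\ forall i : I, (phi (Some i) (x k) <= 0)%E);
  q_accepted : forall k,
    line_search_test sigma alpha (p k) (beta ^+ q k) (x k) (v k) (d k);
  q_smallest : forall k (m : nat), (m < q k)%N ->
    ~ line_search_test sigma alpha (p k) (beta ^+ m) (x k) (v k) (d k);
  x_update : forall k, x k.+1 = x k + beta ^+ q k *: d k;
  p_update : forall k,
    p k.+1 = if ((c * norm (d k))%:E <= model_infeasibility (x k) (v k) (d k))%E
             then p k + varrho else p k
}.

Section Merit.
Variables (D : set V) (rho : R).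

Definition hat_g (i : option I) (x : V) : R := g i x + rho / 2 * norm x ^+ 2.

Definition hat_h (i : option I) (x : V) : \bar R :=
  (h i x + (rho / 2 * norm x ^+ 2)%:E)%E.

Definition hat_h_conj (i : option I) (u : V) : \bar R :=
  ereal_sup [set ((dot u x)%:E - hat_h i x)%E | x in D].

Definition econvex_on (f : V -> \bar R) : Prop :=
  forall (x y : V) (t : R), D x -> D y -> 0 <= t <= 1 ->
    (f (t *: x + (1 - t) *: y)%R <= t%:E * f x + (1 - t)%:E * f y)%E.

Definition merit_data (x : nat -> V) : Prop :=
  [/\ compact D, convex_set D, D `<=` X & forall k, D (x k)] /\
  (0 < rho /\ forall i, econvex_on (hat_h i)).

(* The space of the variables (x, tau, d, G, w, v-hat). A family of vectors
   indexed by [option I] is stored as the matrix of its columns, so that the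
   whole product is a normed module of the library. *)
Definition vfamily : normedModType R := 'M[R]_(n, #|{: option I}|).

Definition vmember (w : vfamily) (i : option I) : V := col (enum_rank i) w.

Definition merit_space : normedModType R :=
  (V * R^o * V * 'M[R]_n * vfamily * vfamily)%type.

Definition merit_dot (z z' : merit_space) : R :=
  let: (x, tau, d, G, w, u) := z in
  let: (x', tau', d', G', w', u') := z' in
  dot x x' + tau * tau' + dot d d' + mxdot G G' + mxdot w w' + mxdot u u'.

Definition merit_term (i : option I) (x : V) (tau : R) (d : V)
    (w u : vfamily) : \bar R :=
  ((hat_g i x + dot (vmember w i) (tau *: d))%:E
   + hat_h_conj i (vmember u i) - (dot (vmember u i) x)%:E)%E.

Definition merit (p : R) (z : merit_space) : \bar R :=
  let: (x, tau, d, G, w, u) := z in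
  ((p^-1)%:E * merit_term None x tau d w u
   + \sum_(i : I) maxe (merit_term (Some i) x tau d w u) 0
   + (tau * dot (G *m d) d)%:E
   + indicator (x + d)%R)%E.

End Merit.
End Problem.

(* Main.v *)
(** The penalty parameter grows by a fixed amount at each increase, so a bounded
    sequence of parameters is eventually constant. From then on the penalty
    function F decreases along the iterates, with step sizes bounded below
    because prox-regularity and the local Lipschitz condition give a quadratic
    upper model that is uniform along a bounded run. Hence F(x^k) converges to
    some omega and d^k tends to 0.

    By Fenchel's equality the value of E at
    z^k = (x^k, 1, d^k, G_k, (grad g_i - v_i^k)_i, (v_i^k + rho x^k)_i) is the
    model value at d^k plus <G_k d^k, d^k>; it lies below F(x^k) and tends to
    omega. The multipliers of the subproblem give a subgradient of E at z^k of
    norm at most C |d^k|. Combining the PLK inequality for E with the decrease of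
    F yields a telescoping bound on |d^k|, so that the steps are summable and
    x^k converges. The limit of the optimality conditions of the subproblems is
    the stationarity condition. *)

Require Import Defs.
From HB Require Import structures.
From mathcomp Require Import all_boot all_order all_algebra.
From mathcomp Require Import all_classical all_reals all_analysis.
From mathcomp Require Import ring lra.
Set Implicit Arguments.
Unset Strict Implicit.
Unset Printing Implicit Defensive.
Import Order.TTheory GRing.Theory Num.Theory.
Import numFieldNormedType.Exports.
Local Open Scope classical_set_scope.
Local Open Scope ring_scope.

(** * Ultrafilters in place of subsequences *)

(** The run has no preferred cluster point. Each constant furnished by prox-regularity, local
    Lipschitz continuity or the PLK property is valid only near one point, and for prox-regularity
    only near one subgradient. A bound that is uniform along the run is therefore obtained by
    showing that the index sets on which it holds are stable under subsets and finite unions, and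
    that every relevant ultrafilter contains one of them. Along an ultrafilter all bounded data
    converge at once, so no subsequences are extracted.

    A second obstacle is that E is neither smooth nor known to be continuous. Its subgradients are
    found from below: multipliers in place of the positive parts, and the Fenchel-Young inequality
    at the fixed point x^k in place of the conjugates, give a smooth minorant that is exact at z^k.
    Its value at a cluster point of z^k is computed directly, using that the d-component vanishes
    there.

    A third is that E(z^k) may lie well below F(x^k), while only F is monotone along the run. Hence
    the quantity that telescopes combines psi with a square root. *)

Section Ultrafilters.

(** Along an ultrafilter a cluster point is a limit: a neighbourhood whose preimage is not in the
    filter has the preimage of its complement there, and these two sets are disjoint. *)
Lemma ultra_cvg_compact (T : Type) (F : set_system T) (U : topologicalType)
    (f : T -> U) (K : set U) :
  UltraFilter F -> compact K -> F (f @^-1` K) -> exists2 p, K p & f @ F --> p.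
Proof.
move=> FU cK FK.
have [p [Kp clp]] := cK (f @ F) _ FK.
exists p => // A Ap.
have [//|FnA] := in_ultra_setVsetC (f @^-1` A) FU.
have [y [Hy Ay]] := clp (~` A) A FnA Ap.
by have := Hy Ay.
Qed.

(* The complements of the sets in [P] would otherwise generate a proper
   filter, and an ultrafilter above it contradicts the last hypothesis. *)
Lemma ultra_induction (T : Type) (P : set T -> Prop) :
  (forall A B, A `<=` B -> P B -> P A) ->
  (forall A B, P A -> P B -> P (A `|` B)) ->
  P set0 ->
  (forall F : set_system T, UltraFilter F -> (forall A, P A -> F (~` A)) ->
     exists2 A, F A & P A) ->
  P setT.
Proof.
move=> Psub PU P0 Ploc; apply: contrapT => PT.
pose F : set_system T := [set A | P (~` A)].
have FF : ProperFilter F.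
  split; first by rewrite /F /= setC0.
  split; rewrite /F /=; first by rewrite setCT.
  - by move=> A B PA PB; rewrite /= setCI; exact: PU.
  - by move=> A B AB; apply: Psub; exact: subsetC.
have [G [GU FG]] := ultraFilterLemma FF.
have GP A : P A -> G (~` A) by move=> PA; apply: FG; rewrite /F /= setCK.
have [A GA PA] := Ploc G GU GP.
have GF : ProperFilter G := @ultra_proper _ _ GU.
apply: (@filter_not_empty _ G _).
by rewrite -[set0](setICr A); exact: (@filterI _ G _ _ _ GA (GP A PA)).
Qed.

(** Once the initial segments satisfy [P], the ultrafilters to be examined contain all their
    complements, so that every limit along [\oo] is also a limit along them. *)
Lemma ultra_induction_nat (P : set nat -> Prop) :
  (forall A B, A `<=` B -> P B -> P A) ->
  (forall A B, P A -> P B -> P (A `|` B)) ->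
  (forall K, P [set k | (k < K)%N]) ->
  (forall F : set_system nat, UltraFilter F -> \oo `<=` F ->
     exists2 A, F A & P A) ->
  P setT.
Proof.
move=> Psub PU PK Ploc; apply: ultra_induction => //.
  by apply: Psub (PK 0%N).
move=> F FU FP; apply: Ploc => // A [K _ KA].
have FF : ProperFilter F := @ultra_proper _ _ FU.
apply: filterS (FP _ (PK K)) => k /= /negP; rewrite -leqNgt; exact: KA.
Qed.

Lemma ultra_cvg_real (R : realType) (T : Type) (F : set_system T)
    (f : T -> R) (M : R) :
  UltraFilter F -> F [set t | `|f t| <= M] -> exists p : R, f @ F --> p.
Proof.
move=> FU FM.
have FF : ProperFilter F := @ultra_proper _ _ FU.
have [||p _ fp] := @ultra_cvg_compact _ F R f `[- M, M]%classic FU.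
- exact: segment_compact.
- by apply: filterS FM => t /=; rewrite in_itv /= ler_norml.
- by exists p.
Qed.

End Ultrafilters.

(** * Euclidean structure *)

Section Matrices.
Variable R : realType.

Lemma mx_norm_entry m n (A : 'M[R]_(m, n)) i j : `|A i j| <= `|A|.
Proof.
rewrite [X in _ <= X]mx_normrE.
exact: (le_bigmax _ (fun ij : 'I_m * 'I_n => `|A ij.1 ij.2|) (i, j)).
Qed.

Lemma mx_norm_le m n (A : 'M[R]_(m, n)) (a : R) :
  0 <= a -> (forall i j, `|A i j| <= a) -> `|A| <= a.
Proof.
move=> a0 Aa; rewrite [X in X <= _]mx_normrE.
by apply: bigmax_le => // -[i j] _; exact: Aa.
Qed.

Lemma cvg_mx (T : Type) (F : set_system T) {FF : Filter F} m n
    (A : T -> 'M[R]_(m, n)) (B : 'M[R]_(m, n)) :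
  (forall i j, (fun t => A t i j) @ F --> B i j) -> A @ F --> B.
Proof.
move=> AB; apply/cvgrPdist_le => e e0.
have H : \forall t \near F, forall ij : 'I_m * 'I_n, `|B ij.1 ij.2 - A t ij.1 ij.2| <= e.
  apply: filter_forall => -[i j] /=; have /cvgrPdist_le := AB i j; exact.
near=> t; apply: mx_norm_le; first exact: ltW.
move=> i j; rewrite !mxE.
have := near H t _ => /(_ _ (i, j)); exact.
Unshelve. all: by end_near. Qed.

Lemma ultra_cvg_mx (T : Type) (F : set_system T) m n
    (A : T -> 'M[R]_(m, n)) (M : R) :
  UltraFilter F -> F [set t | forall i j, `|A t i j| <= M] ->
  exists B : 'M[R]_(m, n), A @ F --> B.
Proof.
move=> FU FM.
have FF : ProperFilter F := @ultra_proper _ _ FU.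
have H ij : exists b : R, (fun t => A t ij.1 ij.2) @ F --> b.
  apply: (@ultra_cvg_real _ _ _ _ M) => //.
  by apply: filterS FM => t; exact.
have [b bP] := choice H.
exists (\matrix_(i, j) b (i, j)).
apply: cvg_mx => i j; rewrite mxE; exact: (bP (i, j)).
Qed.

Lemma cvg_entry (T : Type) (F : set_system T) {FF : Filter F} m n
    (A : T -> 'M[R]_(m, n)) (B : 'M[R]_(m, n)) i j :
  A @ F --> B -> (fun t => A t i j) @ F --> B i j.
Proof.
move=> AB; apply: (@cvg_comp _ _ _ A (fun M : 'M[R]_(m, n) => M i j) F _ _ AB).
exact: coord_continuous.
Qed.

End Matrices.

(** Stated for semidefinite forms because it serves both for scalar products and for the forms
    defined by the matrices G_k. The quadratic in t given by [x + t *: y] is nonnegative; it is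
    evaluated at its minimizer. *)
Lemma psd_cauchy_schwarz (R : realType) (V : lmodType R) (B : V -> V -> R) :
  (forall x y, B x y = B y x) ->
  (forall x y z, B (x + y) z = B x z + B y z) ->
  (forall a x y, B (a *: x) y = a * B x y) ->
  (forall x, 0 <= B x x) ->
  forall x y, B x y ^+ 2 <= B x x * B y y.
Proof.
move=> Bsym Badd Bscale Bge0 x y.
have expand t : B (x + t *: y) (x + t *: y) =
    B x x + 2 * t * B x y + t ^+ 2 * B y y.
  rewrite Badd ![B _ (x + _)]Bsym !Badd !Bscale ![B _ (t *: y)]Bsym !Bscale.
  rewrite (Bsym y x); ring.
have [By0|By0] := eqVneq (B y y) 0.
  have [->|Bxy] := eqVneq (B x y) 0; first by rewrite By0 mulr0 expr0n.
  (* When B y y vanishes the expression is affine in t, and this t gives it the value -1. *)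
  have := Bge0 (x + (- (B x x + 1) / (2 * B x y)) *: y).
  rewrite expand By0 mulr0 addr0.
  have -> : B x x + 2 * (- (B x x + 1) / (2 * B x y)) * B x y = -1.
    by field.
  by rewrite oppr_ge0 ler10.
have By1 : 0 < B y y by rewrite lt_def By0 Bge0.
have := Bge0 (x + (- B x y / B y y) *: y).
rewrite expand.
have -> : B x x + 2 * (- B x y / B y y) * B x y + (- B x y / B y y) ^+ 2 * B y y
   = (B x x * B y y - B x y ^+ 2) / B y y by field.
by rewrite pmulr_lge0 ?invr_gt0 // subr_ge0.
Qed.

(** The field [sp_equiv] makes the Euclidean norm of [ip] induce the ambient topology; it also
    supplies definiteness, so that semidefiniteness is enough in [sp_ge0]. *)
Record scalar_product (R : realType) (V : normedModType R) (ip : V -> V -> R)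
    : Prop := {
  sp_sym : forall x y, ip x y = ip y x;
  sp_Dl : forall x y z, ip (x + y) z = ip x z + ip y z;
  sp_Zl : forall a x y, ip (a *: x) y = a * ip x y;
  sp_ge0 : forall x, 0 <= ip x x;
  sp_equiv : exists2 C : R, 0 < C &
    forall x, `|x| <= C * enorm ip x /\ enorm ip x <= C * `|x|
}.

Section ScalarProduct.
Variables (R : realType) (V : normedModType R) (ip : V -> V -> R).
Hypothesis sp : scalar_product ip.
Local Notation norm := (enorm ip).

Lemma sp_Dr x y z : ip x (y + z) = ip x y + ip x z.
Proof. by rewrite !(sp_sym sp x) sp_Dl. Qed.
Lemma sp_Zr a x y : ip x (a *: y) = a * ip x y.
Proof. by rewrite !(sp_sym sp x) sp_Zl. Qed.
Lemma sp_Nl x y : ip (- x) y = - ip x y.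
Proof. by rewrite -scaleN1r sp_Zl // mulN1r. Qed.
Lemma sp_Nr x y : ip x (- y) = - ip x y.
Proof. by rewrite -scaleN1r sp_Zr mulN1r. Qed.
Lemma sp_Bl x y z : ip (x - y) z = ip x z - ip y z.
Proof. by rewrite sp_Dl // sp_Nl. Qed.
Lemma sp_Br x y z : ip x (y - z) = ip x y - ip x z.
Proof. by rewrite sp_Dr sp_Nr. Qed.
Lemma sp_0l x : ip 0 x = 0.
Proof. by rewrite -(scale0r 0) sp_Zl // mul0r. Qed.
Lemma sp_0r x : ip x 0 = 0.
Proof. by rewrite sp_sym // sp_0l. Qed.

Lemma enorm_ge0 x : 0 <= norm x.
Proof. exact: sqrtr_ge0. Qed.
Lemma enorm_sqr x : norm x ^+ 2 = ip x x.
Proof. by rewrite sqr_sqrtr // sp_ge0. Qed.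
Lemma enorm0 : norm 0 = 0.
Proof. by rewrite /enorm sp_0l sqrtr0. Qed.
Lemma enormZ a x : norm (a *: x) = `|a| * norm x.
Proof.
by rewrite /enorm sp_Zl // sp_Zr mulrA -expr2 sqrtrM ?sqr_ge0 // sqrtr_sqr.
Qed.
Lemma enormN x : norm (- x) = norm x.
Proof. by rewrite -scaleN1r enormZ normrN1 mul1r. Qed.
Lemma enorm_subC x y : norm (x - y) = norm (y - x).
Proof. by rewrite -enormN opprB. Qed.

Lemma enorm_eq0 x : norm x = 0 -> x = 0.
Proof.
move=> x0; have [C C0 /(_ x) []] := sp_equiv sp.
by rewrite x0 mulr0 normr_le0 => /eqP.
Qed.

Lemma enorm_gt0 x : x != 0 -> 0 < norm x.
Proof.
move=> x0; rewrite lt_def enorm_ge0 andbT; apply/eqP => /enorm_eq0 xE.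
by rewrite xE eqxx in x0.
Qed.

Lemma cauchy_schwarz x y : `|ip x y| <= norm x * norm y.
Proof.
rewrite -(@ler_pXn2r _ 2) ?nnegrE ?mulr_ge0 ?enorm_ge0 //.
rewrite exprMn !enorm_sqr real_normK ?num_real //.
by apply: psd_cauchy_schwarz; case: sp.
Qed.

Lemma ip_le x y : ip x y <= norm x * norm y.
Proof. exact: le_trans (ler_norm _) (cauchy_schwarz x y). Qed.

Lemma enormD x y : norm (x + y) <= norm x + norm y.
Proof.
rewrite -(@ler_pXn2r _ 2) ?nnegrE ?addr_ge0 ?enorm_ge0 //.
rewrite enorm_sqr sp_Dl // !sp_Dr (sp_sym sp y x) -!enorm_sqr.
have := ip_le x y; set a := norm x; set b := norm y; set c := ip x y.
by move=> H; nra.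
Qed.

Lemma near_enorm_lt (x : V) (e : R) :
  0 < e -> \forall u \near x, norm (u - x) < e.
Proof.
move=> e0; have [C C0 HC] := sp_equiv sp.
have eC : 0 < e / C by rewrite divr_gt0.
have := nbhsx_ballx x _ eC; rewrite -ball_normE /=.
apply: filterS => u /=; rewrite distrC ltr_pdivlMr // mulrC => H.
exact: le_lt_trans (proj2 (HC _)) H.
Qed.

Lemma nbhs_enorm (x : V) (U : set V) :
  nbhs x U -> exists2 e : R, 0 < e & forall u, norm (u - x) < e -> U u.
Proof.
move=> /nbhs_ballP [e /= e0 eU]; have [C C0 HC] := sp_equiv sp.
exists (e / C); first by rewrite divr_gt0.
move=> u ux; apply: eU; rewrite -ball_normE /= distrC.
apply: le_lt_trans (proj1 (HC _)) _.
by rewrite mulrC -ltr_pdivlMr.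
Qed.

Lemma cvg_enorm (T : Type) (F : set_system T) {FF : Filter F} (f : T -> V) (y : V) :
  f @ F --> y <-> forall e : R, 0 < e -> \forall t \near F, norm (f t - y) < e.
Proof.
split=> [fy e e0|H U /nbhs_enorm[e e0 eU]].
  exact: (fy _ (near_enorm_lt y e0)).
by apply: filterS (H e e0) => t; exact: eU.
Qed.

Lemma cvg_ip (T : Type) (F : set_system T) {FF : Filter F} (f g : T -> V) (a b : V) :
  f @ F --> a -> g @ F --> b -> (fun t => ip (f t) (g t)) @ F --> ip a b.
Proof.
move=> fa gb; apply/cvgrPdist_le => e e0.
pose M := norm a + norm b + 1.
have M1 : 1 <= M.
  by rewrite /M lerDr addr_ge0 ?enorm_ge0.
have M0 : 0 < M by apply: lt_le_trans M1.
pose e' := Num.min 1 (e / (2 * M)).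
have e'0 : 0 < e' by rewrite lt_min ltr01 divr_gt0 // mulr_gt0.
near=> t.
have Hf : norm (f t - a) < e' by near: t; exact: (proj1 (cvg_enorm _ _) fa _ e'0).
have Hg : norm (g t - b) < e' by near: t; exact: (proj1 (cvg_enorm _ _) gb _ e'0).
have -> : ip a b - ip (f t) (g t) =
  - (ip (f t - a) (g t - b) + ip (f t - a) b + ip a (g t - b)).
  by rewrite !sp_Bl !sp_Br; ring.
rewrite normrN.
apply: le_trans (ler_normD _ _) _.
apply: (@le_trans _ _ (norm (f t - a) * norm (g t - b) + norm (f t - a) * norm b
   + norm a * norm (g t - b))).
  apply: lerD; last exact: cauchy_schwarz.
  apply: le_trans (ler_normD _ _) _.
  by apply: lerD; exact: cauchy_schwarz.
have e'1 : e' <= 1 by rewrite ge_min lexx.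
have e'2 : e' * (2 * M) <= e.
  by rewrite -ler_pdivlMr ?mulr_gt0 // ge_min lexx orbT.
have := enorm_ge0 (f t - a); have := enorm_ge0 (g t - b).
have := enorm_ge0 a; have := enorm_ge0 b.
move: M1 e'2; rewrite /M.
move: (norm (f t - a)) (norm (g t - b)) Hf Hg => u w Hf Hg.
move: (norm a) (norm b) => a' b' M1 e'2 b0 a0 w0 u0.
have h1 : u * w <= e' by nra.
have h2 : u * b' <= e' * b' by rewrite ler_wpM2r // ltW.
have h3 : a' * w <= a' * e' by rewrite ler_wpM2l // ltW.
nra.
Unshelve. all: by end_near. Qed.

End ScalarProduct.

Section MatrixDot.
Variable R : realType.
Local Notation fnorm := (enorm (@mxdot R _ _)).

Lemma mxdot_scalar_product m n : scalar_product (@mxdot R m n).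
Proof.
split.
- by move=> x y; apply: eq_bigr => i _; apply: eq_bigr => j _; rewrite mulrC.
- move=> x y z; rewrite /mxdot -big_split /=; apply: eq_bigr => i _.
  by rewrite -big_split /=; apply: eq_bigr => j _; rewrite mxE mulrDl.
- move=> a x y; rewrite /mxdot mulr_sumr; apply: eq_bigr => i _.
  by rewrite mulr_sumr; apply: eq_bigr => j _; rewrite mxE mulrA.
- move=> x; apply: sumr_ge0 => i _; apply: sumr_ge0 => j _.
  by rewrite -expr2 sqr_ge0.
(* The sharp factor for the second inequality is the square root of mn; [mn + 1] dominates it and
   stays positive for empty matrices. *)
exists ((m * n)%:R + 1); first by rewrite ltr_pwDr.
move=> A; split.
  apply: (@le_trans _ _ (fnorm A)); last first.
    by rewrite ler_peMl ?sqrtr_ge0 // lerDr.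
  apply: mx_norm_le; first exact: sqrtr_ge0.
  move=> i j; rewrite -sqrtr_sqr; apply: ler_wsqrtr.
  rewrite /mxdot (bigD1 i) //= (bigD1 j) //= -expr2 -addrA lerDl.
  apply: addr_ge0; apply: sumr_ge0 => k _; first by rewrite -expr2 sqr_ge0.
  by apply: sumr_ge0 => l _; rewrite -expr2 sqr_ge0.
have AA : mxdot A A <= ((m * n)%:R + 1) ^+ 2 * `|A| ^+ 2.
  apply: (@le_trans _ _ (\sum_(i < m) \sum_(j < n) `|A| ^+ 2)).
    apply: ler_sum => i _; apply: ler_sum => j _.
    rewrite -expr2 -real_normK ?num_real // ler_pXn2r ?nnegrE //.
    exact: mx_norm_entry.
  rewrite !sumr_const !card_ord -mulrnA mulnC -[leLHS]mulr_natl.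
  rewrite ler_wpM2r ?sqr_ge0 //.
  have : 0 <= (m * n)%:R :> R by [].
  move: (_%:R) => a a0; nra.
rewrite -[leRHS]ger0_norm; last by rewrite mulr_ge0 // addr_ge0.
by rewrite -sqrtr_sqr exprMn; exact: ler_wsqrtr.
Qed.

Lemma enorm_mulmx m n (A : 'M[R]_(m, n)) (x : 'cV[R]_n) :
  fnorm (A *m x) <= fnorm A * fnorm x.
Proof.
rewrite -(@ler_pXn2r _ 2) ?nnegrE ?mulr_ge0 ?enorm_ge0 //.
rewrite exprMn !(enorm_sqr (mxdot_scalar_product _ _)).
rewrite {1 2}/mxdot mulr_suml; apply: ler_sum => i _; rewrite big_ord1.
have -> : (A *m x) i 0 = mxdot (row i A)^T x.
  rewrite mxE /mxdot; apply: eq_bigr => j _.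
  by rewrite big_ord1 !mxE.
rewrite -expr2.
have -> : \sum_(j < n) A i j * A i j = mxdot (row i A)^T (row i A)^T.
  by rewrite /mxdot; apply: eq_bigr => j _; rewrite big_ord1 !mxE.
by apply: psd_cauchy_schwarz; case: (mxdot_scalar_product n 1).
Qed.

Lemma mxdot_mulmx_le m n (A : 'M[R]_(m, n)) (x : 'cV[R]_n) (y : 'cV[R]_m) :
  `|mxdot (A *m x) y| <= fnorm A * fnorm x * fnorm y.
Proof.
apply: le_trans (cauchy_schwarz (mxdot_scalar_product _ _) _ _) _.
by rewrite ler_wpM2r ?enorm_ge0 // enorm_mulmx.
Qed.

Lemma entry_le_enorm m n (A : 'M[R]_(m, n)) i j : `|A i j| <= fnorm A.
Proof.
rewrite -sqrtr_sqr; apply: ler_wsqrtr.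
rewrite /mxdot (bigD1 i) //= (bigD1 j) //= -expr2 -addrA lerDl.
apply: addr_ge0; apply: sumr_ge0 => k _; first by rewrite -expr2 sqr_ge0.
by apply: sumr_ge0 => l _; rewrite -expr2 sqr_ge0.
Qed.

Lemma mxdot_mulmx_tr m n (A : 'M[R]_(m, n)) (x : 'cV[R]_n) (y : 'cV[R]_m) :
  mxdot (A *m x) y = mxdot x (A^T *m y).
Proof.
rewrite /mxdot.
under eq_bigr => i _ do rewrite big_ord1 mxE mulr_suml.
under [RHS]eq_bigr => i _ do rewrite big_ord1 mxE mulr_sumr.
rewrite exchange_big /=; apply: eq_bigr => i _; apply: eq_bigr => j _.
by rewrite mxE; ring.
Qed.

End MatrixDot.

(** * Multipliers of the convex subproblem *)

Section Multipliers.
Variables (R : realType) (V : lmodType R) (C : set V).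

(** Convexity with a plain real weight, so that weights can be computed with directly;
    [convex_set_mix] translates from the interval-typed notion. *)
Definition mix_closed : Prop :=
  forall x y (t : R), C x -> C y -> 0 <= t <= 1 -> C (t *: x + (1 - t) *: y).
Definition mix_convex (f : V -> R) : Prop :=
  forall x y (t : R), C x -> C y -> 0 <= t <= 1 ->
    f (t *: x + (1 - t) *: y) <= t * f x + (1 - t) * f y.
Definition mix_affine (f : V -> R) : Prop :=
  forall x y (t : R), f (t *: x + (1 - t) *: y) = t * f x + (1 - t) * f y.

Lemma mix_affine_convex f : mix_affine f -> mix_convex f.
Proof. by move=> Hf x y t _ _ _; rewrite Hf. Qed.

Lemma mix_convexD f g : mix_convex f -> mix_convex g ->
  mix_convex (fun x => f x + g x).
Proof.
move=> Hf Hg x y t Cx Cy t01; have := Hf x y t Cx Cy t01.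
have := Hg x y t Cx Cy t01; lra.
Qed.

Lemma mix_convexZ a f : 0 <= a -> mix_convex f -> mix_convex (fun x => a * f x).
Proof.
move=> a0 Hf x y t Cx Cy t01.
have := ler_wpM2l a0 (Hf x y t Cx Cy t01); lra.
Qed.

Lemma mix_convex_sum (I : Type) (s : seq I) (f : I -> V -> R) :
  (forall i, mix_convex (f i)) -> mix_convex (fun x => \sum_(i <- s) f i x).
Proof.
move=> Hf; elim: s => [|i s IH] x y t Cx Cy t01.
  by rewrite !big_nil !mulr0 addr0.
rewrite !big_cons; have := Hf i x y t Cx Cy t01.
by have := IH x y t Cx Cy t01; lra.
Qed.

Lemma mix_convex_pos f : mix_affine f -> mix_convex (fun x => Num.max (f x) 0).
Proof.
move=> Hf x y t Cx Cy /andP[t0 t1]; rewrite Hf ge_max.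
have h1 : f x <= Num.max (f x) 0 by rewrite le_max lexx.
have h2 : f y <= Num.max (f y) 0 by rewrite le_max lexx.
have h3 : 0 <= Num.max (f x) 0 by rewrite le_max lexx orbT.
have h4 : 0 <= Num.max (f y) 0 by rewrite le_max lexx orbT.
have t1' : 0 <= 1 - t by rewrite subr_ge0.
by rewrite lerD ?ler_wpM2l //= addr_ge0 ?mulr_ge0.
Qed.

Hypothesis Ccvx : mix_closed.

(* A one-dimensional minimax: the points with [a > 0] bound the multiplier
   from below and those with [a < 0] from above; the bounds are compatible
   because a segment joining two such points meets [a = 0]. *)
Lemma multiplier_exists (f a : V -> R) (m : R) :
  mix_convex f -> mix_affine a ->
  (forall x, C x -> m <= f x + Num.max (a x) 0) ->
  exists2 l : R, 0 <= l <= 1 & forall x, C x -> m <= f x + l * a x.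
Proof.
move=> fcvx aaff H.
have H1 x : C x -> a x <= 0 -> m <= f x.
  by move=> Cx ax; have := H x Cx; rewrite max_r // addr0.
have H2 x : C x -> 0 <= a x -> m <= f x + a x.
  by move=> Cx ax; have := H x Cx; rewrite max_l.
(* The element 0 makes [S] nonempty and its supremum nonnegative even when [a] is nowhere
   positive. *)
pose S : set R := [set s | s = 0 \/ exists x, [/\ C x, 0 < a x & s = (m - f x) / a x]].
have S0 : S 0 by left.
have Sub u : ubound S u -> sup S <= u by apply: ge_sup; exists 0.
have S1 : ubound S 1.
  move=> s [->//|[x [Cx ax ->]]]; rewrite ler_pdivrMr // mul1r.
  by have := H2 x Cx (ltW ax); lra.
have Sle s : S s -> s <= sup S.
  by move=> Ss; apply: ub_le_sup => //; exists 1.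
exists (sup S); first by rewrite Sle //= Sub.
move=> x Cx; have [ax|ax|ax] := ltrgt0P (a x).
- have : (m - f x) / a x <= sup S by apply: Sle; right; exists x.
  by rewrite ler_pdivrMr //; lra.
- have : sup S <= (f x - m) / (- a x); last first.
    by rewrite ler_pdivlMr ?oppr_gt0 //; lra.
  have fx := H1 x Cx (ltW ax).
  apply: Sub => s [->|[y [Cy ay ->]]].
    by rewrite divr_ge0 ?oppr_ge0 ?subr_ge0 // ltW.
  rewrite ler_pdivrMr // mulrAC ler_pdivlMr ?oppr_gt0 //.
  have D0 : 0 < a y - a x by lra.
  pose t := - a x / (a y - a x).
  have t01 : 0 <= t <= 1.
    apply/andP; split; last by rewrite ler_pdivrMr // mul1r; lra.
    by apply: divr_ge0; [rewrite oppr_ge0 ltW | exact: ltW].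
  have tE : t * (a y - a x) = - a x by rewrite /t mulfVK // gt_eqF.
  have az : a (t *: y + (1 - t) *: x) = 0 by rewrite aaff; lra.
  have := H1 _ (Ccvx Cy Cx t01); rewrite az lexx => /(_ isT).
  have := fcvx y x t Cy Cx t01 => h1 h2.
  have h3 : m <= t * f y + (1 - t) * f x by lra.
  have := ler_wpM2r (ltW D0) h3.
  have -> : (t * f y + (1 - t) * f x) * (a y - a x) =
     (t * (a y - a x)) * f y + (a y - a x - t * (a y - a x)) * f x by ring.
  rewrite tE; lra.
- by rewrite ax mulr0 addr0; apply: H1; rewrite ?ax.
Qed.

(** Induction on the constraints. While one multiplier is chosen, the remaining positive parts
    belong to the convex function; afterwards the linear term just obtained is absorbed into [f]. *)
Lemma multipliers_exist (I : eqType) (s : seq I) (a : I -> V -> R) (f : V -> R)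
    (m : R) : uniq s ->
  mix_convex f -> (forall i, mix_affine (a i)) ->
  (forall x, C x -> m <= f x + \sum_(i <- s) Num.max (a i x) 0) ->
  exists2 l : I -> R, (forall i, 0 <= l i <= 1) &
    forall x, C x -> m <= f x + \sum_(i <- s) l i * a i x.
Proof.
move=> us fcvx aaff; elim: s us f fcvx => [_ f _ H|j s IH /= /andP[js us] f fcvx H].
  exists (fun=> 0) => [i|x Cx]; first by rewrite lexx ler01.
  by have := H x Cx; rewrite !big_nil.
have [||x Cx|l l01 Hl] := @multiplier_exists
    (fun x => f x + \sum_(i <- s) Num.max (a i x) 0) (a j) m.
- apply: mix_convexD => //; apply: mix_convex_sum => i; exact: mix_convex_pos.
- exact: aaff.
- by have := H x Cx; rewrite big_cons addrAC addrA.
have [||l' l'01 Hl'] := IH us (fun x => f x + l * a j x).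
- apply: mix_convexD => //; apply: mix_convexZ; first by case/andP: l01.
  exact: mix_affine_convex.
- by move=> x Cx; have := Hl x Cx; rewrite addrAC.
exists (fun i => if i == j then l else l' i) => [i|x Cx]; first by case: eqP.
rewrite big_cons eqxx addrA.
rewrite (eq_big_seq (fun i => l' i * a i x)); first exact: Hl'.
by move=> i si; case: eqP => // ij; rewrite -ij si in js.
Qed.

(** Minimality is tested at [d + t *: (e - d)]. After division by t the quadratic part leaves the
    term [B d (e - d)] and a remainder proportional to t, which disappears as t tends to 0. *)
Lemma quadratic_first_order (M : V -> R) (B : V -> V -> R) (d e : V) :
  (forall x y z, B (x + y) z = B x z + B y z) ->
  (forall t x y, B (t *: x) y = t * B x y) ->
  (forall x y, B x y = B y x) ->
  mix_convex M -> C d -> C e ->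
  (forall x, C x -> M d + 2^-1 * B d d <= M x + 2^-1 * B x x) ->
  M d <= M e + B d (e - d).
Proof.
move=> Badd Bscale Bsym Mcvx Cd Ce Hmin.
have key t : 0 < t -> t <= 1 ->
    0 <= M e + B d (e - d) - M d + t * (2^-1 * B (e - d) (e - d)).
  move=> t0 t1; have t01 : 0 <= t <= 1 by rewrite ltW.
  have := Hmin _ (Ccvx Ce Cd t01); have := Mcvx e d t Ce Cd t01.
  have -> : t *: e + (1 - t) *: d = d + t *: (e - d).
    by rewrite scalerBr scalerBl scale1r addrCA.
  have -> : B (d + t *: (e - d)) (d + t *: (e - d)) =
    B d d + 2 * t * B d (e - d) + t ^+ 2 * B (e - d) (e - d).
    move: (e - d) => u.
    by rewrite Badd !Bscale ![B _ (d + _)]Bsym !Badd !Bscale (Bsym u d); ring.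
  move=> h1 h2; rewrite -(pmulr_rge0 _ t0).
  move: h1 h2; rewrite expr2; lra.
rewrite -subr_ge0; move: (_ - M d) (2^-1 * _) key => A q key.
have [//|A0] := leP 0 A.
have [q0|q0] := leP q 0.
  by have := key 1 ltr01 (lexx _); lra.
(* With this t the remainder is at most -A/2, so [A + t * q] is still negative, against [key]. *)
pose t := Num.min 1 (- A / (2 * q)).
have t0 : 0 < t.
  by rewrite /t lt_min ltr01 divr_gt0 ?oppr_gt0 ?mulr_gt0.
have t1 : t <= 1 by rewrite /t ge_min lexx.
have : t * (2 * q) <= - A.
  by rewrite -ler_pdivlMr ?mulr_gt0 // /t ge_min lexx orbT.
have := key t t0 t1; lra.
Qed.

End Multipliers.

Section SubproblemKKT.
Variables (R : realType) (n : nat) (I : finType) (C : set 'cV[R]_n).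
Local Notation dot := (@mxdot R n 1).

Definition affine_model (w : R) (a : option I -> R) (s : option I -> 'cV[R]_n)
    (e : 'cV[R]_n) : R :=
  w * (a None + dot (s None) e) +
  \sum_(i : I) Num.max (a (Some i) + dot (s (Some i)) e) 0.

Lemma affine_dot (b : R) (s : 'cV[R]_n) : mix_affine (fun e => b + dot s e).
Proof.
move=> x y t; have sp := mxdot_scalar_product R n 1.
rewrite (sp_Dr sp) !(sp_Zr sp); ring.
Qed.

Lemma affine_model_convex w a s : 0 <= w -> mix_convex C (affine_model w a s).
Proof.
move=> w0; apply: mix_convexD.
  apply: mix_convexZ => //; apply: mix_affine_convex; exact: affine_dot.
by apply: mix_convex_sum => i; apply: mix_convex_pos; exact: affine_dot.
Qed.

Lemma subproblem_first_order w a s (G : 'M[R]_n) (d e : 'cV[R]_n) :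
  mix_closed C -> 0 <= w -> G^T = G -> C d -> C e ->
  (forall x, C x -> affine_model w a s d + 2^-1 * dot (G *m d) d <=
                    affine_model w a s x + 2^-1 * dot (G *m x) x) ->
  affine_model w a s d <= affine_model w a s e + dot (G *m d) (e - d).
Proof.
move=> Ccvx w0 Gs Cd Ce H; have sp := mxdot_scalar_product R n 1.
apply: (@quadratic_first_order _ _ C Ccvx _ (fun x y => dot (G *m x) y)) => //.
- by move=> x y z; rewrite mulmxDr (sp_Dl sp).
- by move=> t x y; rewrite -scalemxAr (sp_Zl sp).
- by move=> x y; rewrite mxdot_mulmx_tr Gs (sp_sym sp).
- exact: affine_model_convex.
Qed.

(** The first-order inequality says that d minimizes a sum of affine functions and positive parts.
    [multipliers_exist] linearizes the positive parts, and comparison at e = d yields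
    complementarity. *)
Lemma subproblem_kkt w a s (G : 'M[R]_n) (d : 'cV[R]_n) :
  mix_closed C -> 0 <= w -> C d ->
  (forall e, C e ->
     affine_model w a s d <= affine_model w a s e + dot (G *m d) (e - d)) ->
  exists l : I -> R,
    [/\ forall i, 0 <= l i <= 1,
        forall i, l i * (a (Some i) + dot (s (Some i)) d) =
                  Num.max (a (Some i) + dot (s (Some i)) d) 0 &
        forall e, C e ->
          0 <= dot (w *: s None + \sum_(i : I) l i *: s (Some i) + G *m d)
                   (e - d)].
Proof.
move=> Ccvx w0 Cd H; have sp := mxdot_scalar_product R n 1.
pose f e := w * (a None + dot (s None) e) + dot (G *m d) (e - d).
pose A i e := a (Some i) + dot (s (Some i)) e.
have [|i|e Ce|l l01 Hl] := @multipliers_exist R _ C Ccvx I (index_enum I) A f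
  (affine_model w a s d) (index_enum_uniq I).
- apply: mix_convexD.
    apply: mix_convexZ => //; apply: mix_affine_convex; exact: affine_dot.
  apply: mix_affine_convex => x y t.
  have := affine_dot (- dot (G *m d) d) (G *m d) x y t.
  rewrite !(sp_Br sp); lra.
- exact: affine_dot.
- by have := H e Ce; rewrite /affine_model /f /A -!addrA [dot _ _ + _]addrC.
have le_max i : l i * A i d <= Num.max (A i d) 0.
  have /andP[l0 l1] := l01 i; have [Ad|Ad] := leP (A i d) 0.
    by rewrite mulr_ge0_le0.
  by rewrite ler_piMl // ltW.
(* At e = d the linearized sum is at least the sum of positive parts, while each of its terms is at
   most the corresponding positive part; hence all terms agree. *)
have lmax i : l i * A i d = Num.max (A i d) 0.
  have := Hl d Cd; rewrite /f subrr (sp_0r sp) addr0 /affine_model lerD2l => h.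
  apply/eqP; rewrite eq_le le_max /=.
  move: h; rewrite (bigD1 i) //= [X in _ <= X](bigD1 i) //= => h.
  have : \sum_(j | j != i) l j * A j d <= \sum_(j | j != i) Num.max (A j d) 0.
    by apply: ler_sum => j _; exact: le_max.
  by move: h; rewrite -/(A i d); lra.
exists l; split => // e Ce.
have := Hl e Ce; rewrite /f /affine_model.
under eq_bigr do rewrite -/(A _ d) -lmax.
have dsum (F : I -> 'cV[R]_n) y : dot (\sum_i F i) y = \sum_i dot (F i) y.
  elim/big_ind2 : _ => [|x1 x2 y1 y2 <- <-|//]; first exact: (sp_0l sp).
  exact: (sp_Dl sp).
rewrite !(sp_Dl sp) dsum (sp_Zl sp).
have -> : \sum_i dot (l i *: s (Some i)) (e - d) =
   \sum_i l i * A i e - \sum_i l i * A i d.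
  rewrite -sumrB; apply: eq_bigr => i _.
  rewrite (sp_Zl sp) (sp_Br sp) /A; ring.
rewrite !(sp_Br sp); lra.
Qed.

End SubproblemKKT.

(** * Desingularizing functions *)

Lemma differentiable_near (R : realType) (V W : normedModType R) (f : V -> W)
    (x : V) (e : R) :
  differentiable f x -> 0 < e ->
  \forall u \near x, `|f u - f x - 'd f x (u - x)| <= e * `|u - x|.
Proof.
move=> /diff_locallyP [_ /eqaddoP H] e0.
have H' : \forall h \near (0 : V), `|(f \o shift x - (cst (f x) + 'd f x)) h| <= e * `|h|.
  exact: H.
rewrite -(subrr x) in H'.
have : \forall u \near x, `|(f \o shift x) (u - x) - (cst (f x) + 'd f x) (u - x)|
   <= e * `|u - x|.
  have cv : (fun u => u - x) @ x --> x - x by apply: cvgB => //; exact: cvg_cst.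
  exact: cv _ H'.
by apply: filterS => u /=; rewrite subrK opprD addrA.
Qed.

Lemma concave_tangent (R : realType) (eta : R) (psi : R -> R) :
  desingularizing eta psi ->
  forall a b : R, 0 < a < eta -> 0 <= b < eta ->
    psi b <= psi a + derive1 psi a * (b - a).
Proof.
move=> [_ cvx _ _ dpsi] a b /andP[a0 ae] /andP[b0 be].
have [|ad _ _] := dpsi a; first by rewrite a0 ae.
rewrite leNgt; apply/negP => gap.
pose gam := psi b - psi a - derive1 psi a * (b - a).
have gam0 : 0 < gam by rewrite /gam; lra.
have D0 : 0 < 2 * (`|b - a| + 1) by rewrite mulr_gt0 // ltr_wpDl.
have e0 : 0 < gam / (2 * (`|b - a| + 1)) by rewrite divr_gt0.
have /derivable1_diffP ad' := ad.
have /nbhs_ballP[del /= del0 Hd] := differentiable_near ad' e0.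
pose t := Num.min 1 (del / (2 * (`|b - a| + 1))).
have t0 : 0 < t by rewrite lt_min ltr01 divr_gt0.
have t1 : t <= 1 by rewrite ge_min lexx.
have tde : t * (2 * (`|b - a| + 1)) <= del.
  by rewrite -ler_pdivlMr // ge_min lexx orbT.
have tba : `|a + t * (b - a) - a| = t * `|b - a|.
  by rewrite addrAC subrr add0r normrM (gtr0_norm t0).
have inb : ball a del (a + t * (b - a)).
  rewrite -ball_normE /= distrC tba.
  apply: lt_le_trans tde; rewrite ltr_pM2l //.
  by have := normr_ge0 (b - a); lra.
have dE (r : R) : 'd psi a r = derive1 psi a * r.
  rewrite derive1E' // mulrC.
  by have := linearZ_LR ('d psi a) r 1; rewrite /GRing.scale /= mulr1.
have := Hd _ inb; rewrite tba dE.
have -> : a + t * (b - a) - a = t * (b - a) by ring.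
move=> Hup.
have t01 : 0 <= t <= 1 by rewrite ltW.
have bI : b \in (`[0, eta[%classic : set R) by rewrite inE /= in_itv /= b0 be.
have aI : a \in (`[0, eta[%classic : set R) by rewrite inE /= in_itv /= (ltW a0) ae.
have Hlow : - psi (t * b + (1 - t) * a) <= t * - psi b + (1 - t) * - psi a.
  exact: (cvx (Itv01 (ltW t0) t1) b a bI aI).
have tE : t * b + (1 - t) * a = a + t * (b - a) by ring.
rewrite tE in Hlow.
have Hu : psi (a + t * (b - a)) - psi a - derive1 psi a * (t * (b - a)) <=
    gam / (2 * (`|b - a| + 1)) * (t * `|b - a|).
  exact: le_trans (ler_norm _) Hup.
have Hg : t * gam <= t * (gam / (2 * (`|b - a| + 1)) * `|b - a|).
  have -> : t * gam = t * (psi b - psi a - derive1 psi a * (b - a)) by [].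
  by move: Hlow Hu; move: (psi (_ + _)) => u Hlow Hu; lra.
move: Hg; rewrite ler_pM2l // mulrAC ler_pdivlMr // leNgt => /negP; apply.
rewrite ltr_pM2l // mulrDr mulr1 mulr_natl mulr2n -addrA ltrDl.
by rewrite ltr_wpDl.
Qed.

(** The tangent is taken at the right endpoint because a may be 0, where no derivative is
    available. *)
Lemma desingularizing_nondecreasing (R : realType) (eta : R) (psi : R -> R) :
  desingularizing eta psi ->
  forall a b : R, 0 <= a -> a <= b -> b < eta -> psi a <= psi b.
Proof.
move=> H a b a0; rewrite le_eqVlt => /predU1P[->//|ab] be.
have b0 : 0 < b < eta by rewrite (le_lt_trans a0 ab).
have [_ _ _ _ /(_ b b0)[_ _ dpos]] := H.
have := concave_tangent H b0 (b := a).
rewrite a0 (lt_trans ab be) => /(_ isT); nra.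
Qed.

(** Adding the tangent inequalities at a and at b cancels the values of psi. *)
Lemma desingularizing_derive_le (R : realType) (eta : R) (psi : R -> R) :
  desingularizing eta psi ->
  forall a b : R, 0 < a -> a <= b -> b < eta -> derive1 psi b <= derive1 psi a.
Proof.
move=> H a b a0; rewrite le_eqVlt => /predU1P[->//|ab] be.
have hb : 0 < b < eta by rewrite (lt_trans a0 ab).
have ha : 0 < a < eta by rewrite a0 (lt_trans ab be).
have := concave_tangent H hb (b := a).
have := concave_tangent H ha (b := b).
rewrite (ltW a0) (lt_trans ab be) be (ltW (lt_trans a0 ab)) => /(_ isT) h1 /(_ isT) h2.
have : (derive1 psi b - derive1 psi a) * (b - a) <= 0 by lra.
by rewrite pmulr_lle0 ?subr_gt0 // subr_le0.
Qed.

(** Here r and r' are consecutive penalty gaps, e is the merit gap and D the step length. Put m =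
    min(1/2, ka). Since e <= r/2, the decrease is at least th m (r + D^2) >= 2 th m sqrt(r) D, while
    r - r' <= 2 sqrt(r) (sqrt(r) - sqrt(r')). Dividing by 2 sqrt(r) gives the bound. *)
Lemma sqrt_step (R : realType) (th ka r r' e D : R) :
  0 < th -> 0 < ka -> 0 <= D -> 0 <= r' -> r' <= r -> e <= r / 2 ->
  th * (r - e + ka * D ^+ 2) <= r - r' ->
  D <= (th * Num.min 2^-1 ka)^-1 * (Num.sqrt r - Num.sqrt r').
Proof.
move=> th0 ka0 D0 r'0 r'r er H.
have r0 : 0 <= r by lra.
have m0 : 0 < Num.min 2^-1 ka by rewrite lt_min invr_gt0 ltr0n.
have m1 : Num.min 2^-1 ka <= 2^-1 by rewrite ge_min lexx.
have m2 : Num.min 2^-1 ka <= ka by rewrite ge_min lexx orbT.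
move: (Num.min 2^-1 ka) m0 m1 m2 => m m0 m1 m2.
rewrite mulrC ler_pdivlMr ?mulr_gt0 //.
have s0 := sqrtr_ge0 r; have s'0 := sqrtr_ge0 r'.
have ss : Num.sqrt r' <= Num.sqrt r by apply: ler_wsqrtr.
have sE := sqr_sqrtr r0; have s'E := sqr_sqrtr r'0.
move: (Num.sqrt r) (Num.sqrt r') s0 s'0 ss sE s'E => s s' s0 s'0 ss sE s'E.
have h1 : th * m * (2 * s * D) <= s ^+ 2 - s' ^+ 2.
  apply: (@le_trans _ _ (th * (r - e + ka * D ^+ 2))); last by rewrite sE s'E.
  rewrite -mulrA ler_pM2l //.
  have h2 : m * (2 * s * D) <= m * (s ^+ 2 + D ^+ 2).
    by rewrite ler_pM2l //; have := sqr_ge0 (s - D); rewrite !expr2; lra.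
  have h3 : m * s ^+ 2 <= 2^-1 * s ^+ 2 by rewrite ler_wpM2r // sqr_ge0.
  have h4 : m * D ^+ 2 <= ka * D ^+ 2 by rewrite ler_wpM2r // sqr_ge0.
  by move: h2 h3 h4; rewrite sE; lra.
(* The division by sqrt(r) fails only for r = 0; then r' = 0 and e <= 0, and the decrease inequality
   leaves D = 0. *)
have [s_0|s_n0] := eqVneq s 0.
  have s'_0 : s' = 0 by lra.
  have r_0 : r = 0 by rewrite -sE s_0 expr0n.
  have r'_0 : r' = 0 by rewrite -s'E s'_0 expr0n.
  have DD : D ^+ 2 <= 0.
    move: H er; rewrite r_0 r'_0 => H er.
    have : th * (ka * D ^+ 2) <= 0.
      apply: le_trans (_ : th * (0 - e + ka * D ^+ 2) <= _); last by lra.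
      by rewrite ler_pM2l //; lra.
    by rewrite pmulr_rle0 // pmulr_rle0.
  have : D = 0 by apply/eqP; rewrite -sqrf_eq0 eq_le DD sqr_ge0.
  by move=> ->; rewrite mul0r s_0 s'_0 subrr.
have sp : 0 < s by rewrite lt_def s_n0.
have : 2 * s * (D * (th * m)) <= 2 * s * (s - s').
  apply: (@le_trans _ _ (s ^+ 2 - s' ^+ 2)); first by move: h1; lra.
  have := mulr_ge0 s'0 (_ : 0 <= s - s'); rewrite subr_ge0 => /(_ ss).
  have := mulr_ge0 s0 (_ : 0 <= s - s'); rewrite subr_ge0 => /(_ ss).
  rewrite !expr2; nra.
by rewrite ler_pM2l // mulr_gt0.
Qed.

(** The slope inequality at e is moved to r/2, where psi' is at least as large. The tangent at r/2
    bounds psi'(r/2) (r - r')/2 by the drop of psi from r/2 to r'/2; multiplying by 2CD and using ka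
    D^2 <= r - r' cancels one factor D. Working at r/2 instead of e makes the right-hand side
    telescope, since merit gaps need not be monotone. *)
Lemma desingularizing_step (R : realType) (eta : R) (psi : R -> R)
    (ka C r r' e D : R) :
  desingularizing eta psi -> 0 < ka -> 0 < C -> 0 <= D ->
  0 <= r' -> r' <= r -> r < eta -> r / 2 < e -> e <= r ->
  1 <= derive1 psi e * (C * D) -> ka * D ^+ 2 <= r - r' ->
  D <= (2 * C / ka) * (psi (r / 2) - psi (r' / 2)).
Proof.
move=> H ka0 C0 D0 r'0 r'r reta re er Hkl Hdec.
have r0 : 0 < r by lra.
have Dp : 0 < D.
  rewrite lt_def D0 andbT; apply/eqP => DE.
  by move: Hkl; rewrite DE !mulr0 ler10.
have hr2 : 0 < r / 2 < eta by apply/andP; split; lra.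
have Hd : 1 <= derive1 psi (r / 2) * (C * D).
  apply: le_trans Hkl _; rewrite ler_pM2r ?mulr_gt0 //.
  by apply: (desingularizing_derive_le H); lra.
have := concave_tangent H hr2 (b := r' / 2).
have -> : 0 <= r' / 2 < eta by apply/andP; split; lra.
move=> /(_ isT) Ht.
have := ler_wpM2r (_ : 0 <= (r - r')) Hd.
rewrite subr_ge0 => /(_ r'r) Hm.
rewrite mulrAC ler_pdivlMr //.
rewrite -(ler_pM2r Dp).
have : (r - r') / 2 * derive1 psi (r / 2) <= psi (r / 2) - psi (r' / 2) by lra.
move: (derive1 psi (r / 2)) (psi (r / 2) - psi (r' / 2)) Hm => g' Delta Hm HD.
have := ler_wpM2r (_ : 0 <= 2 * C * D) HD.
rewrite !mulr_ge0 //; last exact: ltW.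
by move=> /(_ isT); move: Hdec; rewrite expr2; nra.
Qed.

(** * Gradients and subdifferentials *)

Lemma lipschitz_bound (R : realType) (V W : normedModType R) (f : V -> W) (A : set V) :
  [lipschitz f x | x in A] ->
  exists2 k : R, 0 < k & forall x y, A x -> A y -> `|f x - f y| <= k * `|x - y|.
Proof.
move=> /pinfty_ex_gt0[k k0 H]; exists k => // x y Ax Ay.
exact: (H (x, y) (conj Ax Ay)).
Qed.

Section Gradient.
Variables (R : realType) (n : nat).
Local Notation V := 'cV[R]_n.
Local Notation dot := (@mxdot R n 1).
Local Notation norm := (enorm dot).
Let sp := mxdot_scalar_product R n 1.

Lemma diff_grad (f : V -> R) (x e : V) :
  differentiable f x -> 'd f x e = dot (grad f x) e.
Proof.
move=> df; rewrite {1}(matrix_sum_delta e).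
rewrite linear_sum /=; apply: eq_bigr => i _.
rewrite linear_sum /=; apply: eq_bigr => j _.
by rewrite linearZ /= ord1 /grad mxE mulrC.
Qed.

Lemma grad_near (f : V -> R) (x : V) (e : R) :
  differentiable f x -> 0 < e ->
  \forall u \near x, `|f u - f x - dot (grad f x) (u - x)| <= e * norm (u - x).
Proof.
move=> df e0; have [C C0 HC] := sp_equiv sp.
have eC : 0 < e / C by rewrite divr_gt0.
apply: filterS (differentiable_near df eC) => u.
rewrite diff_grad // => /le_trans; apply.
rewrite -mulrA ler_pM2l // mulrC ler_pdivrMr // mulrC.
exact: (proj1 (HC _)).
Qed.

Lemma line_derive (f : V -> R) (x e : V) (t : R) :
  (forall y, differentiable f y) ->
  is_derive t (1 : R) (fun s : R => f (x + s *: e)) (dot (grad f (x + t *: e)) e).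
Proof.
move=> df; pose l (s : R) : V := x + s *: e.
have lineD : is_diff t l ( *:%R^~ e).
    have := is_diffD (is_diff_cst x t) (is_diff_scalel t e).
  by rewrite add0r.
have dl : differentiable l t by case: lineD.
have dfl : differentiable (f \o l) t.
apply: differentiable_comp.
exact: dl.
exact: df.
have d1 : derivable (f \o l) t 1.
  apply/derivable1_diffP.
  exact: dfl.
have d2 : 'D_1 (f \o l) t = dot (grad f (x + t *: e)) e.
  rewrite (deriveE _ dfl).
  rewrite (diff_comp dl (df _)) /=.
  rewrite (diff_grad _ (df _)).
  congr (dot _ _).
  rewrite diff_val scale1r.
  by [].
exact: (DeriveDef d1 d2).
Qed.

Lemma mean_value (f : V -> R) (x e : V) :
  (forall y, differentiable f y) ->
  exists2 t : R, 0 <= t <= 1 & f (x + e) - f x = dot (grad f (x + t *: e)) e.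
Proof.
move=> df; pose l (s : R) : R := f (x + s *: e).
have [|t t01|t t01] := @MVT_segment R l (fun t => dot (grad f (x + t *: e)) e) 0 1 ler01.
- by move=> t _; exact: line_derive.
- apply: continuous_subspaceT => s.
  apply: differentiable_continuous.
  apply/derivable1_diffP.
  by have [] := line_derive x e s df.
rewrite /l /= scale1r scale0r addr0 subr0 mulr1 => H.
by exists t.
Qed.

(** The mean value theorem replaces an integral, at the price of a constant without the factor 1/2.
    The gradient is Lipschitz only along X near x0, so the intermediate point must be kept there:
    convexity of X and of the ball does this. The two factors C convert between the norms. *)
Lemma gradient_descent_inequality (X : set V) (f : V -> R) (x0 : V) :
  mix_closed X -> (forall y, differentiable f y) -> loc_lipschitz_grad_on f X ->
  X x0 ->
  exists del L : R, [/\ 0 < del, 0 <= L & forall x y, X x -> X y ->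
    norm (x - x0) < del -> norm (y - x0) < del ->
    f y <= f x + dot (grad f x) (y - x) + L * norm (y - x) ^+ 2].
Proof.
move=> Xcvx df flip Xx0; have [U Ux0 /lipschitz_bound[k k0 Hk]] := flip x0 Xx0.
have [C C0 HC] := sp_equiv sp.
have [del del0 Hdel] := nbhs_enorm sp Ux0.
exists del, (C * (k * C)); split => //; first by rewrite !mulr_ge0 ?ltW.
move=> x y Xx Xy xd yd; have [t t01 Ht] := mean_value x (y - x) df.
rewrite [x + (y - x)]addrC subrK in Ht.
set z : V := x + t *: (y - x) in Ht.
have zE : z = t *: y + (1 - t) *: x.
  by rewrite /z scalerBr scalerBl scale1r addrCA.
have Xz : X z by rewrite zE; apply: Xcvx.
have Uz : U z.
  apply: Hdel; have -> : z - x0 = t *: (y - x0) + (1 - t) *: (x - x0).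
    by rewrite zE !scalerBr addrACA -opprD -scalerDl subrKC scale1r.
  have /andP[t0 t1] := t01.
  apply: le_lt_trans (enormD sp _ _) _; rewrite !(enormZ sp) !ger0_norm ?subr_ge0 //.
  move: (norm (y - x0)) (norm (x - x0)) xd yd => a b xd yd.
  have [->|tp] := eqVneq t 0; first by rewrite mul0r add0r subr0 mul1r.
  have tp' : 0 < t by rewrite lt_def tp.
  have h1 : t * a < t * del by rewrite ltr_pM2l.
  have h2 : (1 - t) * b <= (1 - t) * del by rewrite ler_wpM2l ?subr_ge0 // ltW.
  by move: h1 h2; lra.
have Ux : U x by apply: Hdel.
pose a : V := grad f z - grad f x; pose b : V := y - x.
suff : dot a b <= C * (k * C) * norm b ^+ 2.
  have -> : dot a b = f y - f x - dot (grad f x) b by rewrite Ht (sp_Bl sp).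
  rewrite -/b; move: (f y) (f x) (dot _ b) (_ * norm b ^+ 2) => u1 u2 u3 u4; lra.
have h0 := ip_le sp a b.
apply: (le_trans h0); rewrite expr2 mulrA.
apply: ler_wpM2r; first exact: enorm_ge0.
have zx : norm (z - x) <= norm (y - x).
  have -> : z - x = t *: (y - x) by rewrite /z [x + _]addrC addrK.
  have /andP[t0 t1] := t01.
  by rewrite (enormZ sp) ger0_norm // ler_piMl // enorm_ge0.
have h1 : norm a <= C * `|a| := proj2 (HC a).
have h2 : `|a| <= k * `|z - x| := Hk z x (conj Uz Xz) (conj Ux Xx).
have h3 : `|z - x| <= C * norm (z - x) := proj1 (HC (z - x)).
apply: (le_trans h1); rewrite -mulrA ler_pM2l //.
apply: (le_trans h2); rewrite -mulrA ler_pM2l //.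
by apply: (le_trans h3); rewrite ler_pM2l.
Qed.

End Gradient.

Section RegularSubdifferential.
Variables (R : realType) (V : normedModType R) (ip : V -> V -> R).
Hypothesis sp : scalar_product ip.
Local Notation norm := (enorm ip).
Local Open Scope ereal_scope.

(** Together with [regular_subdiff_intro] this trades the lower limit of difference quotients for
    inequalities without division, which hold on full rather than punctured neighbourhoods. *)
Lemma regular_subdiff_near (f : V -> \bar R) (x v : V) (e : R) :
  regular_subdiff ip f x v -> (0 < e)%R ->
  \forall u \near x, f x + (ip v (u - x)%R - e * norm (u - x)%R)%:E <= f u.
Proof.
move=> [fx]; rewrite limf_einfE => H e0.
have : - e%:E < ereal_sup [set ereal_inf ((fun u => (f u - f x - (ip v (u - x)%R)%:E)
                              * ((norm (u - x)%R)^-1)%:E) @` A) | A in x^'].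
  by apply: lt_le_trans H; rewrite oppe_lt0 lte_fin.
move=> /ereal_sup_gt[_ [A Ax <-]] HA.
rewrite /dnbhs /within /= in Ax.
move: Ax; rewrite /dnbhs /within /=; apply: filterS => u Au.
have [->|ux] := eqVneq u x.
  by rewrite subrr (sp_0r sp) (enorm0 sp) mulr0 subr0 adde0.
have N0 : (0 < norm (u - x)%R)%R by apply: (enorm_gt0 sp); rewrite subr_eq0.
have := lt_le_trans HA (ereal_inf_lbound (ex_intro2 _ _ u (Au ux) erefl)).
rewrite lte_pdivlMr // -(fineK fx); case: (f u) => [r||] //=.
  by rewrite -!EFinD -?EFinM -?EFinN !lte_fin lee_fin => h; lra.
by move=> _; rewrite leey.
Qed.

Lemma regular_subdiff_intro (f : V -> \bar R) (x v : V) :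
  f x \is a fin_num ->
  (forall e : R, (0 < e)%R ->
    \forall u \near x, f x + (ip v (u - x)%R - e * norm (u - x)%R)%:E <= f u) ->
  regular_subdiff ip f x v.
Proof.
move=> fx H; split => //; rewrite limf_einfE.
apply/lee_addgt0Pr => e e0.
rewrite -leeBlDr // sub0e.
pose A := [set u | u != x /\ f x + (ip v (u - x)%R - e * norm (u - x)%R)%:E <= f u].
apply: le_trans (ereal_sup_ubound _); last first.
  exists A => //=; rewrite /dnbhs /within /=.
  by apply: filterS (H e e0) => u Hu ux.
apply: le_ereal_inf_tmp => _ [u [ux Hu] <-].
have N0 : (0 < norm (u - x)%R)%R by apply: (enorm_gt0 sp); rewrite subr_eq0.
rewrite lee_pdivlMr //; move: Hu; rewrite -(fineK fx); case: (f u) => [r||] //=.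
  by rewrite -!EFinD -?EFinM -?EFinN !lee_fin => h; lra.
by move=> _; rewrite leey.
Qed.

Lemma regular_limiting (f : V -> \bar R) (x v : V) :
  regular_subdiff ip f x v -> limiting_subdiff ip f x v.
Proof.
move=> H; split; first by case: H.
by exists (fun=> x), (fun=> v); split => //; exact: cvg_cst.
Qed.

Lemma limiting_approx (f : V -> \bar R) (x v : V) (e : R) :
  limiting_subdiff ip f x v -> (0 < e)%R ->
  exists y w, [/\ (norm (y - x) < e)%R, (norm (w - v) < e)%R & regular_subdiff ip f y w].
Proof.
move=> [_ [xs [vs [xsx _ reg vsv]]]] e0.
have Hx : \forall t \near \oo, (norm (xs t - x)%R < e)%R.
  exact: (proj1 (cvg_enorm sp _ _) xsx _ e0).
have Hv : \forall t \near \oo, (norm (vs t - v)%R < e)%R.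
  exact: (proj1 (cvg_enorm sp _ _) vsv _ e0).
have [k [kx kv]] := filter_ex (filterI Hx Hv).
by exists (xs k), (vs k).
Qed.

End RegularSubdifferential.

Section LocallyLipschitz.
Variables (R : realType) (n : nat).
Local Notation V := 'cV[R]_n.
Local Notation dot := (@mxdot R n 1).
Local Notation norm := (enorm dot).
Local Notation subdiff := (limiting_subdiff dot).
Let sp := mxdot_scalar_product R n 1.
Implicit Types (f : V -> \bar R) (x y v w : V).

Lemma loc_lipschitz_bound f x0 : loc_lipschitz_at f x0 ->
  exists del k : R, [/\ 0 < del, 0 < k,
    forall y, norm (y - x0) < del -> f y \is a fin_num &
    forall y z, norm (y - x0) < del -> norm (z - x0) < del ->
      `|fine (f y) - fine (f z)| <= k * norm (y - z)].
Proof.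
move=> [U Ux0 [fU /lipschitz_bound[k k0 Hk]]].
have [C C0 HC] := sp_equiv sp.
have [del del0 Hdel] := nbhs_enorm sp Ux0.
exists del, (k * C); split => //.
- by rewrite mulr_gt0.
- by move=> y yd; apply: fU; apply: Hdel.
- move=> y z yd zd; apply: le_trans (Hk y z (Hdel _ yd) (Hdel _ zd)) _.
  by rewrite -mulrA ler_pM2l //; exact: (proj1 (HC _)).
Qed.

(** A regular subgradient v is tested in its own direction against the Lipschitz bound, which gives
    norm v <= k + 1; the 1 is the tolerance used in [regular_subdiff_near]. Limiting subgradients
    inherit the bound by approximation. *)
Lemma subdiff_bounded f x0 : loc_lipschitz_at f x0 ->
  exists del L : R, [/\ 0 < del, 0 <= L & forall x v,
    norm (x - x0) < del -> subdiff f x v -> norm v <= L].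
Proof.
move=> /loc_lipschitz_bound[del [k [del0 k0 ffin Hk]]].
have reg x v : norm (x - x0) < del -> regular_subdiff dot f x v -> norm v <= k + 1.
  move=> xd Hreg.
  have H1 := regular_subdiff_near sp Hreg ltr01.
  have rho0 : 0 < del - norm (x - x0) by rewrite subr_gt0.
  have [eta eta0 Heta] := nbhs_enorm sp (filterI H1 (near_enorm_lt sp x rho0)).
  have [->|v0] := eqVneq v 0; first by rewrite (enorm0 sp); lra.
  have Nv : 0 < norm v by exact: enorm_gt0.
  (* This gives [t *: v] the length eta/2, inside the neighbourhood where the estimates hold. *)
  pose t := eta / (2 * norm v).
  have t0 : 0 < t by rewrite divr_gt0 // mulr_gt0.
  have tv : norm (t *: v) < eta.
    rewrite (enormZ sp) gtr0_norm // /t invfM mulrA mulfVK ?gt_eqF //.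
    by lra.
  have [] := Heta (x + t *: v); first by rewrite [x + _]addrC addrK.
  rewrite [x + _]addrC addrK => Hlow Hin.
  have ud : norm (t *: v + x - x0) < del.
    rewrite -addrA; apply: le_lt_trans (enormD sp _ _) _.
    by move: Hin; lra.
  have := Hk _ _ ud xd; rewrite addrK => Hup.
  have fu := ffin _ ud; have fx := ffin _ xd.
  move: Hlow; rewrite -(fineK fu) -(fineK fx) -EFinD lee_fin.
  rewrite (sp_Zr sp) -(enorm_sqr sp) mul1r.
  have := le_trans (ler_norm _) Hup; rewrite (enormZ sp) gtr0_norm // expr2.
  move=> h1 h2; have : t * norm v * norm v <= t * norm v * (k + 1) by lra.
  by rewrite ler_pM2l // mulr_gt0.
exists del, (k + 1); split => //; first by lra.
move=> x v xd Hlim; apply/ler_addgt0Pr => e e0.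
have rho0 : 0 < Num.min e (del - norm (x - x0)) by rewrite lt_min e0 subr_gt0.
have [y [w [yx wv Hreg]]] := limiting_approx sp Hlim rho0.
move: yx wv; rewrite !lt_min => /andP[_ yx] /andP[wv _].
have yd : norm (y - x0) < del.
  rewrite -(subrK x y) -addrA; apply: le_lt_trans (enormD sp _ _) _; lra.
have := reg y w yd Hreg.
have : norm v <= norm w + norm (w - v).
  by rewrite (enorm_subC sp w) -{1}(subrK w v) addrC; exact: enormD.
by move: wv; lra.
Qed.

(** A diagonal choice of regular subgradients. The convergence of function values that the limiting
    subdifferential demands follows from local Lipschitz continuity. *)
Lemma subdiff_closed f x0 v0 : loc_lipschitz_at f x0 ->
  (forall e : R, 0 < e -> exists x v,
     [/\ norm (x - x0) < e, norm (v - v0) < e & subdiff f x v]) ->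
  subdiff f x0 v0.
Proof.
move=> /loc_lipschitz_bound[del [k [del0 k0 ffin Hk]]] H.
have H' (m : nat) : exists yw : V * V,
    [/\ norm (yw.1 - x0) < m.+1%:R^-1, norm (yw.2 - v0) < m.+1%:R^-1 &
        regular_subdiff dot f yw.1 yw.2].
  have : 0 < m.+1%:R^-1 :> R by rewrite invr_gt0.
  move: (m.+1%:R^-1) => i i0.
  have m0 : 0 < i / 2 by rewrite divr_gt0.
  have [x [v [xx0 vv0 Hl]]] := H _ m0.
  have [y [w [yx wv Hr]]] := limiting_approx sp Hl m0.
  exists (y, w); split => //=.
    by rewrite -(subrK x y) -addrA; apply: le_lt_trans (enormD sp _ _) _; lra.
  by rewrite -(subrK v w) -addrA; apply: le_lt_trans (enormD sp _ _) _; lra.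
have [yw Hyw] := choice H'.
have inv_small (e : R) : 0 < e -> \forall m \near \oo, m.+1%:R^-1 < e :> R.
  move=> e0; have := near_infty_natSinv_lt (PosNum e0); exact.
have cx : (fun m => (yw m).1) @ \oo --> x0.
  apply/(cvg_enorm sp) => e e0; apply: filterS (inv_small e e0) => m.
  by apply: lt_trans; case: (Hyw m).
have fx0 : f x0 \is a fin_num by apply: ffin; rewrite subrr (enorm0 sp).
split => //; exists (fun m => (yw m).1), (fun m => (yw m).2); split => //.
- rewrite -[X in _ --> X](fineK fx0); apply/fine_cvgP; split.
    apply: filterS (proj1 (cvg_enorm sp _ _) cx _ del0) => m; exact: ffin.
  apply/cvgrPdist_lt => e e0.
  have ek0 : 0 < Num.min del (e / k) by rewrite lt_min del0 divr_gt0.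
  apply: filterS (proj1 (cvg_enorm sp _ _) cx _ ek0) => m.
  rewrite lt_min ltr_pdivlMr // => /andP[md mk].
  apply: le_lt_trans (Hk _ _ _ md) _; first by rewrite subrr (enorm0 sp).
  by rewrite (enorm_subC sp) mulrC.
- by move=> m; case: (Hyw m).
- apply/(cvg_enorm sp) => e e0; apply: filterS (inv_small e e0) => m.
  by apply: lt_trans; case: (Hyw m).
Qed.

(** On a ball of radius at most e/k the Lipschitz bound already implies f(x) <= f(x0) + e, so this
    localization disappears from the inequality. *)
Lemma prox_regular_bound f x0 v0 : loc_lipschitz_at f x0 ->
  prox_regular dot f x0 -> subdiff f x0 v0 ->
  exists del r : R, [/\ 0 < del, 0 <= r & forall x y v,
    norm (x - x0) < del -> norm (y - x0) < del -> norm (v - v0) < del ->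
    subdiff f x v ->
    fine (f x) + dot v (y - x) - r * norm (y - x) ^+ 2 <= fine (f y)].
Proof.
move=> /loc_lipschitz_bound[del [k [del0 k0 ffin Hk]]] [fx0 _ Hprox] /Hprox[e [r [e0 r0 H]]].
have ek0 : 0 < Num.min (Num.min del (e / k)) e.
  by rewrite !lt_min del0 e0 divr_gt0.
exists (Num.min (Num.min del (e / k)) e), (r / 2); split => //.
  by rewrite divr_ge0.
move=> x y v; rewrite !lt_min ltr_pdivlMr // => /andP[/andP[xd xk] xe].
move=> /andP[/andP[yd _] ye] /andP[_ ve] Hv.
have fx := ffin _ xd; have fy := ffin _ yd.
have : (f x <= f x0 + e%:E)%E.
  rewrite -(fineK fx) -(fineK fx0) -EFinD lee_fin.
  have := Hk x x0 xd _; rewrite subrr (enorm0 sp) => /(_ del0).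
  by move/(le_trans (ler_norm _)); lra.
move=> Hfx.
have := H x y v (ltW xe) (ltW ye) Hfx Hv (ltW ve).
rewrite -(fineK fx) -(fineK fy) -EFinD lee_fin /=.
by rewrite addrA.
Qed.

End LocallyLipschitz.

(** * Runs of the algorithm *)

Lemma convex_set_mix (R : realType) (V : lmodType R) (A : set V) :
  convex_set A -> mix_closed A.
Proof.
move=> cA x y t Ax Ay /andP[t0 t1]; have := cA x y (Itv01 t0 t1).
by rewrite !inE; exact.
Qed.

Section RealValued.
Variables (R : realType) (n : nat) (I : finType).
Local Notation V := 'cV[R]_n.
Local Notation dot := (@mxdot R n 1).
Local Notation norm := (enorm dot).
Variables (X : set V) (g : option I -> V -> R) (h : option I -> V -> \bar R).
Hypothesis hP : standing_assumptions X g h.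
Let sp := mxdot_scalar_product R n 1.

(** Real-valued copies of the problem functions. They agree with the extended ones on X, where h is
    finite; an infinite value of h would be read as 0. The copy [modelr] takes the displacement as
    its argument, not the point. *)
Definition phir (i : option I) (x : V) : R := g i x - fine (h i x).
Definition penr (p : R) (x : V) : R :=
  p^-1 * phir None x + \sum_(i : I) Num.max (phir (Some i) x) 0.
Definition slope (x : V) (v : option I -> V) (i : option I) : V :=
  grad (g i) x - v i.
Definition modelr (p : R) (x : V) (v : option I -> V) : V -> R :=
  affine_model p^-1 (phir^~ x) (slope x v).

Lemma feasible_mix : mix_closed X.
Proof. exact: convex_set_mix (X_convex hP). Qed.

Lemma h_fin i x : X x -> h i x \is a fin_num.
Proof. by move=> Xx; case: (h_prox_regular hP i Xx). Qed.

Lemma phiE i x : X x -> phi g h i x = (phir i x)%:E.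
Proof. by move=> Xx; rewrite /phi -(fineK (h_fin i Xx)). Qed.

Lemma sum_maxe (a : I -> R) :
  (\sum_(i : I) maxe (a i)%:E 0 = (\sum_(i : I) Num.max (a i) 0)%:E)%E.
Proof. by rewrite -sumEFin; apply: eq_bigr => i _; rewrite EFin_max. Qed.

Lemma penaltyE p x : X x -> penalty g h p x = (penr p x)%:E.
Proof.
move=> Xx; rewrite /penalty phiE //.
under eq_bigr do rewrite phiE //.
by rewrite sum_maxe.
Qed.

Lemma linearizedE x v i e : X x ->
  linearized g h x v i e = (phir i x + dot (slope x v i) e)%:E.
Proof. by move=> Xx; rewrite /linearized phiE. Qed.

Lemma penalty_modelE p x v e : X x ->
  penalty_model g h p x v (x + e) = (modelr p x v e)%:E.
Proof.
move=> Xx; rewrite /penalty_model [x + e]addrC addrK linearizedE //.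
under eq_bigr do rewrite linearizedE //.
by rewrite sum_maxe.
Qed.

Lemma model_infeasibilityE x v e : X x ->
  model_infeasibility g h x v e =
  (\sum_(i : I) Num.max (phir (Some i) x + dot (slope x v (Some i)) e) 0)%:E.
Proof.
move=> Xx; rewrite /model_infeasibility.
under eq_bigr do rewrite linearizedE //.
by rewrite sum_maxe.
Qed.

Lemma subproblem_objE p x v G e : X x -> X (x + e) ->
  subproblem_obj X g h p x v G e =
  (modelr p x v e + 2^-1 * dot (G *m e) e)%:E.
Proof.
move=> Xx Xe; rewrite /subproblem_obj penalty_modelE // /indicator.
by case: asboolP => // _; rewrite adde0.
Qed.

Lemma subproblem_obj_out p x v G e : X x -> ~ X (x + e) ->
  subproblem_obj X g h p x v G e = +oo%E.
Proof.
move=> Xx Xe; rewrite /subproblem_obj penalty_modelE // /indicator.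
by case: asboolP => // _; rewrite -EFinD addey.
Qed.

Lemma modelr0 p x v : modelr p x v 0 = penr p x.
Proof.
rewrite /modelr /affine_model /penr (sp_0r sp) addr0; congr (_ + _).
by apply: eq_bigr => i _; rewrite (sp_0r sp) addr0.
Qed.

Lemma translate_mix x : mix_closed [set e | X (x + e)].
Proof.
move=> e1 e2 t X1 X2 t01 /=.
have -> : x + (t *: e1 + (1 - t) *: e2) = t *: (x + e1) + (1 - t) *: (x + e2).
  by rewrite !scalerDr addrACA -scalerDl subrKC scale1r.
exact: feasible_mix.
Qed.

Lemma minimizer_feasible p x v G d : X x ->
  unique_minimizer (subproblem_obj X g h p x v G) d -> X (x + d).
Proof.
move=> Xx [dmin _]; apply: contrapT => Xd; have := dmin 0.
rewrite (subproblem_obj_out _ _ _ Xx Xd).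
by rewrite subproblem_objE // addr0.
Qed.

Lemma minimizer_first_order p x v G d e : 0 < p -> X x -> G^T = G ->
  unique_minimizer (subproblem_obj X g h p x v G) d -> X (x + e) ->
  modelr p x v d <= modelr p x v e + dot (G *m d) (e - d).
Proof.
move=> p0 Xx Gs dm Xe; have Xd := minimizer_feasible Xx dm.
apply: (@subproblem_first_order _ _ _ [set e | X (x + e)]) => //.
- exact: translate_mix.
- by rewrite invr_ge0 ltW.
- move=> y Xy; have [dmin _] := dm; have := dmin y.
  by rewrite !subproblem_objE // lee_fin.
Qed.

End RealValued.

(** * ** Feasibility, decrease and the penalty parameter along a run *)

Section Run.
Variables (R : realType) (n : nat) (I : finType).
Local Notation V := 'cV[R]_n.
Local Notation dot := (@mxdot R n 1).
Local Notation norm := (enorm dot).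
Variables (X : set V) (g : option I -> V -> R) (h : option I -> V -> \bar R).
Variables (beta sigma varrho c alpha M_G : R) (x : nat -> V) (p : nat -> R)
  (v : nat -> option I -> V) (G : nat -> 'M[R]_n) (d : nat -> V) (q : nat -> nat).
Hypothesis hP : standing_assumptions X g h.
Hypothesis hrun : CDP_ESQM_run X g h beta sigma varrho c alpha M_G x p v G d q.
Let sp := mxdot_scalar_product R n 1.

Definition tau k := beta ^+ q k.
Definition quad k := dot (G k *m d k) (d k).
(** The full quadratic term appears here, twice that of the subproblem: the first-order condition
    tested at displacement 0 bounds exactly this quantity by the penalty value, and it is also the
    value of the merit function at z^k. *)
Definition opt_value k := modelr g h (p k) (x k) (v k) (d k) + quad k.

Lemma tau_gt0 k : 0 < tau k.
Proof. by rewrite exprn_gt0 //; case/andP: (beta_itv hrun). Qed.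

Lemma tau_le1 k : tau k <= 1.
Proof. by case/andP: (beta_itv hrun) => b0 b1; rewrite exprn_ile1 // ltW. Qed.

Lemma step_in k t : X (x k) -> X (x k + d k) -> 0 <= t <= 1 -> X (x k + t *: d k).
Proof.
move=> Xx Xd t01.
have -> : x k + t *: d k = t *: (x k + d k) + (1 - t) *: x k.
  by rewrite scalerDr addrAC -scalerDl subrKC scale1r.
exact: (feasible_mix hP).
Qed.

Lemma x_in k : X (x k).
Proof.
elim: k => [|k IH]; first exact: (x0_in hrun).
rewrite (x_update hrun); apply: step_in => //.
- exact: minimizer_feasible (d_minimizer hrun k).
- by rewrite (ltW (tau_gt0 k)) (tau_le1 k).
Qed.

Lemma xd_in k : X (x k + d k).
Proof. exact: minimizer_feasible (x_in k) (d_minimizer hrun k). Qed.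

Lemma p_gt0 k : 0 < p k.
Proof.
elim: k => [|k IH]; first exact: (p0_gt0 hrun).
rewrite (p_update hrun); case: ifP => // _.
by rewrite addr_gt0 // (varrho_gt0 hrun).
Qed.

Lemma first_order k e : X (x k + e) ->
  modelr g h (p k) (x k) (v k) (d k) <=
  modelr g h (p k) (x k) (v k) e + dot (G k *m d k) (e - d k).
Proof.
move=> Xe; apply: (minimizer_first_order hP (p_gt0 k) (x_in k) (G_sym hrun k)) => //.
exact: (d_minimizer hrun k).
Qed.

Lemma quad_ge k : alpha * norm (d k) ^+ 2 <= quad k.
Proof. by have /andP[] := G_bounds hrun k (d k). Qed.

Lemma opt_value_le k : opt_value k <= penr g h (p k) (x k).
Proof.
have := @first_order k 0; rewrite addr0 modelr0 sub0r (sp_Nr sp) => /(_ (x_in k)).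
rewrite /opt_value /quad.
by move: (modelr _ _ _ _ _ _) (penr _ _ _ _) (dot _ _) => a1 a2 a3; lra.
Qed.

(** Convexity of the model bounds its value at tau d by the mixture of its values at d and 0. The
    model value at d is [opt_value] minus a term at least alpha |d|^2, of which the line search
    gives back the fraction 1 - sigma. *)
Lemma decrease k :
  penr g h (p k) (x k.+1) <= (1 - tau k) * penr g h (p k) (x k) +
    tau k * (opt_value k - sigma * alpha * norm (d k) ^+ 2).
Proof.
have t01 : 0 <= tau k <= 1 by rewrite (ltW (tau_gt0 k)) (tau_le1 k).
have := q_accepted hrun k; rewrite /line_search_test -/(tau k).
rewrite (penalty_modelE hP _ _ _ (x_in k)).
rewrite (penaltyE hP _ (step_in (x_in k) (xd_in k) t01)).
rewrite -EFinD lee_fin (x_update hrun) -/(tau k).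
have w0 : 0 <= (p k)^-1 by rewrite invr_ge0 ltW // p_gt0.
have := @affine_model_convex _ _ _ [set: V] _ ((phir g h)^~ (x k)) (slope g (x k) (v k)) w0
  (d k) 0 (tau k) Logic.I Logic.I t01.
rewrite scaler0 addr0 -/(modelr g h (p k) (x k) (v k)) modelr0 /opt_value.
have := quad_ge k.
have := tau_gt0 k.
move: (modelr _ _ _ _ _ (tau k *: d k)) => m1.
move: (penr _ _ _ (x k + _)) => f1.
move: (modelr _ _ _ _ _ (d k)) => m2.
move: (penr _ _ _ (x k)) (quad k) (norm (d k) ^+ 2) (tau k) => f2 Q D t t0 hQ h1 h2.
have := ler_wpM2l (ltW t0) hQ; lra.
Qed.

Lemma p_nondecreasing k m : (k <= m)%N -> p k <= p m.
Proof.
move=> /subnKC <-; elim: (m - k)%N => [|j IH]; first by rewrite addn0.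
rewrite addnS (p_update hrun); case: ifP => // _.
by rewrite (le_trans IH) // lerDl ltW // (varrho_gt0 hrun).
Qed.

(** The second conclusion records that the increase test fails from K on; it later gives feasibility
    and complementarity of the limit. *)
Lemma penalty_parameter_stable : [bounded (p k : R^o) | k in [set: nat]] ->
  exists K, forall k, (K <= k)%N -> p k = p K /\
    (model_infeasibility g h (x k) (v k) (d k) < (c * norm (d k))%:E)%E.
Proof.
move=> /pinfty_ex_gt0[M M0 HM].
have pM k : p k <= M by apply: le_trans (ler_norm _) _; exact: HM.
pose inc k := ((c * norm (d k))%:E <= model_infeasibility g h (x k) (v k) (d k))%E.
have [[K HK]|nK] := pselect (exists K, forall k, (K <= k)%N -> ~~ inc k).
  exists K => k Kk; split; last by rewrite ltNge; exact: HK.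
  rewrite -(subnKC Kk); elim: (k - K)%N => [|j IH]; first by rewrite addn0.
  rewrite addnS (p_update hrun) -/(inc (K + j)%N) ifN //.
  by apply: HK; rewrite leq_addr.
have grow m : exists k, p 0%N + varrho *+ m <= p k.
  elim: m => [|m [k Hk]]; first by exists 0%N; rewrite mulr0n addr0.
  have [j kj incj] : exists2 j, (k <= j)%N & inc j.
    apply: contrapT => nj; apply: nK; exists k => j kj; apply/negP => incj.
    by apply: nj; exists j.
  exists j.+1; rewrite (p_update hrun) -/(inc j) incj mulrSr addrA lerD2r.
  exact: le_trans Hk (p_nondecreasing kj).
have v0 := varrho_gt0 hrun.
have [k Hk] := grow (Num.bound (M / varrho)).
have MB := archi_boundP (_ : 0 <= M / varrho).
have := MB; rewrite divr_ge0 ?ltW // => /(_ isT).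
rewrite ltr_pdivrMr // mulr_natl => hM.
have := pM k; have := p_gt0 0%N; lra.
Qed.

End Run.

Lemma max0_lipschitz (R : realType) (a b : R) :
  Num.max (a + b) 0 <= Num.max a 0 + `|b|.
Proof.
have h1 : a <= Num.max a 0 by rewrite le_max lexx.
have h2 : 0 <= Num.max a 0 by rewrite le_max lexx orbT.
by rewrite ge_max addr_ge0 // lerD //= ler_norm.
Qed.

(** * ** Uniform estimates along a bounded run *)

Section BoundedRun.
Variables (R : realType) (n : nat) (I : finType).
Local Notation V := 'cV[R]_n.
Local Notation dot := (@mxdot R n 1).
Local Notation norm := (enorm dot).
Local Notation subdiff := (limiting_subdiff dot).
Variables (X : set V) (g : option I -> V -> R) (h : option I -> V -> \bar R).
Variables (beta sigma varrho c alpha M_G : R) (x : nat -> V) (p : nat -> R)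
  (v : nat -> option I -> V) (G : nat -> 'M[R]_n) (d : nat -> V) (q : nat -> nat).
Hypothesis hP : standing_assumptions X g h.
Hypothesis hrun : CDP_ESQM_run X g h beta sigma varrho c alpha M_G x p v G d q.
Variable D : set V.
Hypotheses (D_compact : compact D) (DX : D `<=` X) (xD : forall k, D (x k)).
Let sp := mxdot_scalar_product R n 1.
Local Notation step k := (tau beta q k).
Local Notation slp k := (slope g (x k) (v k)).
Local Notation mdl k := (modelr g h (p k) (x k) (v k)).

Lemma x_ultra_cvg (F : set_system nat) : UltraFilter F ->
  exists2 xb, D xb & x @ F --> xb.
Proof.
move=> FU; have FF : ProperFilter F := @ultra_proper _ _ FU.
by apply: ultra_cvg_compact D_compact _; apply: filterE => k; exact: xD.
Qed.

(** Subgradients are bounded near the limit of x along each ultrafilter, and [ultra_induction] makes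
    the bound global. Summing the local bounds over the finitely many indices gives one bound for
    all of them. *)
Lemma v_bounded : exists L : R, forall k i, norm (v k i) <= L.
Proof.
pose P (S : set nat) := exists L : R, forall k i, S k -> norm (v k i) <= L.
suff [L HL] : P setT by exists L => k i; apply: HL.
apply: ultra_induction.
- by move=> A B AB [L HL]; exists L => k i /AB; exact: HL.
- move=> A B [L1 H1] [L2 H2]; exists (Num.max L1 L2) => k i [Ak|Bk]; rewrite le_max.
    by rewrite H1.
  by rewrite H2 ?orbT.
- by exists 0.
move=> F FU _; have FF : ProperFilter F := @ultra_proper _ _ FU.
have [xb Dxb xxb] := x_ultra_cvg FU.
have HI (i : option I) : exists e : R * R, [/\ 0 < e.1, 0 <= e.2 & forall y w,
    norm (y - xb) < e.1 -> subdiff (h i) y w -> norm w <= e.2].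
  have [del [L [d0 L0 H]]] := subdiff_bounded (h_lipschitz hP i (DX Dxb)).
  by exists (del, L).
have [e He] := choice HI.
have Hnear : F [set k | forall i, norm (x k - xb) < (e i).1].
  apply: filter_forall => i; have [e0 _ _] := He i.
  exact: (proj1 (cvg_enorm sp _ _) xxb _ e0).
exists [set k | forall i, norm (x k - xb) < (e i).1] => //.
exists (\sum_i (e i).2) => k i Hk.
have [_ _ Hi] := He i.
apply: (@le_trans _ _ (e i).2).
  by apply: Hi (Hk i) _; exact: (v_subdiff hrun).
rewrite (bigD1 i) //= lerDl; apply: sumr_ge0 => j _; by case: (He j).
Qed.

Lemma grad_bounded : exists L : R, forall k i, norm (grad (g i) (x k)) <= L.
Proof.
pose P (S : set nat) := exists L : R, forall k i, S k -> norm (grad (g i) (x k)) <= L.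
suff [L HL] : P setT by exists L => k i; apply: HL.
apply: ultra_induction.
- by move=> A B AB [L HL]; exists L => k i /AB; exact: HL.
- move=> A B [L1 H1] [L2 H2]; exists (Num.max L1 L2) => k i [Ak|Bk]; rewrite le_max.
    by rewrite H1.
  by rewrite H2 ?orbT.
- by exists 0.
move=> F FU _; have FF : ProperFilter F := @ultra_proper _ _ FU.
have [xb Dxb xxb] := x_ultra_cvg FU.
pose A := [set k | forall i, norm (grad (g i) (x k) - grad (g i) xb) < 1].
have FA : F A.
  apply: filter_forall => i; have [_ gc] := g_C1 hP i.
  have cv : (fun k => grad (g i) (x k)) @ F --> grad (g i) xb.
    exact: (cvg_comp _ _ xxb (gc xb)).
  exact: (proj1 (cvg_enorm sp _ _) cv _ ltr01).
exists A => //; exists (\sum_i (norm (grad (g i) xb) + 1)) => k i /(_ i) Ak.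
apply: (@le_trans _ _ (norm (grad (g i) xb) + 1)); last first.
  rewrite (bigD1 i) //= lerDl; apply: sumr_ge0 => j _.
  by rewrite addr_ge0 // enorm_ge0.
rewrite -{1}(subrK (grad (g i) xb) (grad (g i) (x k))).
by apply: le_trans (enormD sp _ _) _; rewrite addrC lerD2l ltW.
Qed.

Lemma slope_bounded : exists2 L : R, 0 <= L & forall k i, norm (slp k i) <= L.
Proof.
have [L1 H1] := v_bounded; have [L2 H2] := grad_bounded.
have L10 : 0 <= L1 := le_trans (enorm_ge0 _ _) (H1 0%N None).
have L20 : 0 <= L2 := le_trans (enorm_ge0 _ _) (H2 0%N None).
exists (L2 + L1) => [|k i]; first exact: addr_ge0.
apply: le_trans (enormD sp _ _) _; rewrite (enormN sp).
by apply: lerD.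
Qed.

Lemma p_inv_le k : 0 <= (p k)^-1 <= (p 0%N)^-1.
Proof.
have pk := p_gt0 hrun k; have p0 := p_gt0 hrun 0%N.
rewrite invr_ge0 (ltW pk) /= lef_pV2 ?posrE //.
exact: (p_nondecreasing hrun).
Qed.

Lemma modelr_lipschitz : exists2 B : R, 0 <= B & forall k e1 e2,
  mdl k e1 <= mdl k e2 + B * norm (e1 - e2).
Proof.
have [L L0 HL] := slope_bounded.
have p00 : 0 <= (p 0%N)^-1 by case/andP: (p_inv_le 0) => /le_trans; apply.
pose N : R := \sum_(i : I) L.
have N0 : 0 <= N by apply: sumr_ge0.
exists ((p 0%N)^-1 * L + N) => [|k e1 e2]; first by rewrite addr_ge0 // mulr_ge0.
have sle i : `|dot (slp k i) (e1 - e2)| <= L * norm (e1 - e2).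
  apply: le_trans (cauchy_schwarz sp _ _) _.
  by apply: ler_wpM2r; [exact: enorm_ge0 | exact: HL].
have aff i : phir g h i (x k) + dot (slp k i) e1 =
   phir g h i (x k) + dot (slp k i) e2 + dot (slp k i) (e1 - e2).
  rewrite (sp_Br sp).
  move: (dot _ e1) (dot _ e2) (phir _ _ _ _) => r1 r2 r3; ring.
rewrite /modelr /affine_model aff mulrDl.
have /andP[w0 w1] := p_inv_le k.
have h1 : (p k)^-1 * dot (slp k None) (e1 - e2) <= (p 0%N)^-1 * L * norm (e1 - e2).
  apply: (@le_trans _ _ ((p k)^-1 * (L * norm (e1 - e2)))).
    by apply: ler_wpM2l => //; apply: le_trans (ler_norm _) (sle None).
  by rewrite mulrA ler_wpM2r ?enorm_ge0 // ler_wpM2r.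
have h2 : \sum_(i : I) Num.max (phir g h (Some i) (x k) + dot (slp k (Some i)) e1) 0 <=
  \sum_(i : I) Num.max (phir g h (Some i) (x k) + dot (slp k (Some i)) e2) 0 +
  N * norm (e1 - e2).
  rewrite /N mulr_suml -big_split /=; apply: ler_sum => i _.
  rewrite aff; apply: le_trans (max0_lipschitz _ _) _.
  by rewrite lerD2l.
rewrite mulrDr addrACA; apply: lerD => //.
by rewrite mulrDr lerD2l.
Qed.

(** The model at 0 is the penalty value, so [opt_value_le] and the Lipschitz bound on the model give
    alpha |d|^2 <= L |d|. *)
Lemma d_bounded : exists2 B : R, 0 <= B & forall k, norm (d k) <= B.
Proof.
have [L L0 HL] := modelr_lipschitz.
have al := alpha_gt0 hrun.
exists (L / alpha) => [|k]; first by rewrite divr_ge0 // ltW.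
rewrite ler_pdivlMr //.
have := opt_value_le hP hrun k; have := HL k 0 (d k); have := quad_ge hrun k.
rewrite -(modelr0 g h _ _ (v k)) sub0r (enormN sp) /opt_value.
have := enorm_ge0 dot (d k).
move: (modelr g h _ _ _ 0) (modelr g h _ _ _ (d k)) (quad _ _ _) (norm (d k)).
move=> m0 m1 Q D0 D00 hQ hL hE.
have [->|Dn0] := eqVneq D0 0; first by rewrite mul0r.
have Dp : 0 < D0 by rewrite lt_def Dn0.
by rewrite -(ler_pM2l Dp); move: hQ; rewrite expr2; lra.
Qed.

Lemma v_ultra_cvg (F : set_system nat) xb : UltraFilter F -> D xb -> x @ F --> xb ->
  exists vb : option I -> V, forall i,
    (fun k => v k i) @ F --> vb i /\ subdiff (h i) xb (vb i).
Proof.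
move=> FU Dxb xxb; have FF : ProperFilter F := @ultra_proper _ _ FU.
have [L HL] := v_bounded.
suff H i : exists w : V, (fun k => v k i) @ F --> w /\ subdiff (h i) xb w.
  by have [vb Hvb] := choice H; exists vb.
have [|vb vvb] := @ultra_cvg_mx R nat F n 1 (v^~ i) L FU.
  apply: filterE => k a b; exact: le_trans (entry_le_enorm _ _ _) (HL k i).
exists vb; split => //.
apply: subdiff_closed; first exact: (h_lipschitz hP i (DX Dxb)).
move=> e e0.
have h1 : F [set k | norm (x k - xb) < e].
  exact: (proj1 (cvg_enorm sp _ _) xxb _ e0).
have h2 : F [set k | norm (v k i - vb) < e].
  exact: (proj1 (cvg_enorm sp _ _) vvb _ e0).
have [k [k1 k2]] := filter_ex (filterI h1 h2).
by exists (x k), (v k i); split => //; exact: (v_subdiff hrun).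
Qed.

(** The descent inequality for g and prox-regularity of h add their curvature constants.
    Prox-regularity is local in the subgradient as well, hence the condition that the chosen
    subgradient be near [vb i]. *)
Lemma phir_upper_local xb vb i : D xb -> subdiff (h i) xb vb ->
  exists del K : R, [/\ 0 < del, 0 <= K & forall k y,
    norm (x k - xb) < del -> norm (y - xb) < del -> norm (v k i - vb) < del ->
    X y -> phir g h i y <= phir g h i (x k) + dot (slp k i) (y - x k) +
                           K * norm (y - x k) ^+ 2].
Proof.
move=> Dxb vbi; have Xxb := DX Dxb.
have [d1 [L [d10 L0 H1]]] := gradient_descent_inequality (feasible_mix hP)
  (proj1 (g_C1 hP i)) (g_grad_lipschitz hP i) Xxb.
have [d2 [r [d20 r0 H2]]] := prox_regular_bound (h_lipschitz hP i Xxb)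
  (h_prox_regular hP i Xxb) vbi.
exists (Num.min d1 d2), (L + r); split; first by rewrite lt_min d10.
  exact: addr_ge0.
move=> k y; rewrite !lt_min => /andP[x1 x2] /andP[y1 y2] /andP[v1 v2] Xy.
have h1 := H1 _ _ (x_in hP hrun k) Xy x1 y1.
have h2 := H2 _ _ _ x2 y2 v2 (v_subdiff hrun k i).
have -> : dot (slp k i) (y - x k) =
  dot (grad (g i) (x k)) (y - x k) - dot (v k i) (y - x k) by exact: (sp_Bl sp).
rewrite /phir; move: h1 h2.
move: (fine (h i y)) (fine (h i (x k))) (g i y) (g i (x k)).
move: (dot (v k i) _) (dot (grad (g i) _) _) (norm (y - x k) ^+ 2).
by move=> *; lra.
Qed.

(** The reciprocal of 1 plus the sum of the reciprocals plays the role of a minimum and is also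
    defined for an empty index type. *)
Lemma finite_lower_bound (J : finType) (e : J -> R) : (forall j, 0 < e j) ->
  exists2 del : R, 0 < del & forall j, del <= e j.
Proof.
move=> e0; have S0 (j0 : J) : 0 <= \sum_(j | j != j0) (e j)^-1.
  by apply: sumr_ge0 => j _; rewrite invr_ge0 ltW.
have S1 : 0 < 1 + \sum_j (e j)^-1.
  by rewrite ltr_pwDl //; apply: sumr_ge0 => j _; rewrite invr_ge0 ltW.
exists (1 + \sum_j (e j)^-1)^-1 => [|j]; first by rewrite invr_gt0.
rewrite invf_ple ?posrE // (bigD1 j) //= addrCA lerDl; apply: addr_ge0 => //; exact: S0.
Qed.

Lemma penalty_upper_local (F : set_system nat) : UltraFilter F ->
  exists (A : set nat) (t1 K : R), [/\ F A, 0 < t1, 0 <= K & forall k t,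
    A k -> 0 <= t <= 1 -> t <= t1 ->
    penr g h (p k) (x k + t *: d k) <=
      mdl k (t *: d k) + K * norm (t *: d k) ^+ 2].
Proof.
move=> FU; have FF : ProperFilter F := @ultra_proper _ _ FU.
have [xb Dxb xxb] := x_ultra_cvg FU.
have [vb Hvb] := v_ultra_cvg FU Dxb xxb.
have HI i : exists e : R * R, [/\ 0 < e.1, 0 <= e.2 & forall k y,
    norm (x k - xb) < e.1 -> norm (y - xb) < e.1 -> norm (v k i - vb i) < e.1 ->
    X y -> phir g h i y <= phir g h i (x k) + dot (slp k i) (y - x k) +
                           e.2 * norm (y - x k) ^+ 2].
  have [del [K H]] := phir_upper_local Dxb (proj2 (Hvb i)).
  by exists (del, K).
have [e He] := choice HI.
have [del del0 Hdel] : exists2 del : R, 0 < del & forall j, del <= (e j).1.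
  by apply: finite_lower_bound => j; case: (He j).
have [B B0 HB] := d_bounded.
have del2 : 0 < del / 2 by rewrite divr_gt0.
have B1 : 0 < B + 1 by rewrite ltr_wpDl.
pose A := [set k | norm (x k - xb) < del / 2] `&`
          [set k | forall i, norm (v k i - vb i) < del].
have FA : F A.
  apply: filterI; first exact: (proj1 (cvg_enorm sp _ _) xxb _ del2).
  apply: filter_forall => i.
  exact: (proj1 (cvg_enorm sp _ _) (proj1 (Hvb i)) _ del0).
pose K := \sum_i (e i).2.
have K0 i : (e i).2 <= K.
  rewrite /K (bigD1 i) //= lerDl; apply: sumr_ge0 => j _; by case: (He j).
have Kge : 0 <= K by apply: sumr_ge0 => j _; case: (He j).
have [w0 w1] : 0 <= (p 0%N)^-1 /\ true by case/andP: (p_inv_le 0) => w _; split.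
pose N : R := \sum_(i : I) K.
have N0 : 0 <= N by apply: sumr_ge0.
(* The step bound keeps |t d| below del/2, hence the trial point within del of xb. In the constant,
   the objective carries the weight 1/p_0, the largest of the 1/p_k, and each constraint contributes
   one K. *)
exists A, (del / 2 / (B + 1)), ((p 0%N)^-1 * K + N); split => //.
  by rewrite divr_gt0.
  by rewrite addr_ge0 // mulr_ge0.
move=> k t [xk vk] t01 tt1; have /andP[t0 tle] := t01.
set u : V := t *: d k.
have Xu : X (x k + u) := step_in hP (x_in hP hrun k) (xd_in hP hrun k) t01.
have xu : norm (x k + u - xb) < del.
  have -> : x k + u - xb = (x k - xb) + u by rewrite addrAC.
  apply: le_lt_trans (enormD sp _ _) _.
  have : norm u <= del / 2.
    rewrite /u (enormZ sp) ger0_norm //.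
    apply: (@le_trans _ _ (t * (B + 1))); last by rewrite -ler_pdivlMr.
    by apply: ler_wpM2l => //; apply: le_trans (HB k) _; rewrite lerDl.
  by move: xk => /=; move: (norm u) (norm (x k - xb)) => a b; lra.
have xk' : norm (x k - xb) < del.
  by move: xk => /=; move: (norm (x k - xb)) => b; lra.
have up i : phir g h i (x k + u) <=
    (phir g h i (x k) + dot (slp k i) u) + K * norm u ^+ 2.
  have [_ _ Hi] := He i.
  have := Hi k (x k + u) (lt_le_trans xk' (Hdel i)) (lt_le_trans xu (Hdel i))
    (lt_le_trans (vk i) (Hdel i)) Xu.
  rewrite [x k + u - x k]addrAC subrr add0r => /le_trans; apply.
  by rewrite lerD2l ler_wpM2r ?sqr_ge0.
have Ku0 : 0 <= K * norm u ^+ 2 by rewrite mulr_ge0 ?sqr_ge0.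
rewrite /penr /modelr /affine_model mulrDl addrACA; apply: lerD.
  apply: (@le_trans _ _ ((p k)^-1 * (phir g h None (x k) + dot (slp k None) u +
    K * norm u ^+ 2))).
    by apply: ler_wpM2l => //; case/andP: (p_inv_le k).
  rewrite mulrDr lerD2l -mulrA; apply: ler_wpM2r => //.
  by case/andP: (p_inv_le k).
rewrite /N mulr_suml -big_split /=; apply: ler_sum => i _.
rewrite ge_max addr_ge0 ?le_max ?lexx ?orbT // andbT.
by apply: le_trans (up (Some i)) _; rewrite lerD2r le_max lexx.
Qed.

Lemma penalty_upper : exists t1 K : R, [/\ 0 < t1, 0 <= K & forall k t,
    0 <= t <= 1 -> t <= t1 ->
    penr g h (p k) (x k + t *: d k) <=
      mdl k (t *: d k) + K * norm (t *: d k) ^+ 2].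
Proof.
pose P (A : set nat) := exists t1 K : R, [/\ 0 < t1, 0 <= K & forall k t,
    A k -> 0 <= t <= 1 -> t <= t1 ->
    penr g h (p k) (x k + t *: d k) <=
      mdl k (t *: d k) + K * norm (t *: d k) ^+ 2].
suff [t1 [K [t10 K0 H]]] : P setT by exists t1, K; split => // k t; exact: H.
apply: ultra_induction.
- move=> A B AB [t1 [K [t10 K0 H]]]; exists t1, K; split => // k t /AB; exact: H.
- move=> A B [t1 [K1 [t10 K10 H1]]] [t2 [K2 [t20 K20 H2]]].
  exists (Num.min t1 t2), (K1 + K2); split; first by rewrite lt_min t10.
    exact: addr_ge0.
  move=> k t ABk t01; rewrite le_min => /andP[tt1 tt2].
  have s0 : 0 <= norm (t *: d k) ^+ 2 by rewrite sqr_ge0.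
  case: ABk => Hk.
    apply: le_trans (H1 k t Hk t01 tt1) _.
    by rewrite lerD2l ler_wpM2r // lerDl.
  apply: le_trans (H2 k t Hk t01 tt2) _.
  by rewrite lerD2l ler_wpM2r // lerDr.
- by exists 1, 0; split.
move=> F FU _; have [A [t1 [K [FA t10 K0 H]]]] := penalty_upper_local FU.
by exists A => //; exists t1, K.
Qed.

(** If q_k = m + 1, the trial step beta^m was rejected. Every step t below [t2] satisfies K t <= (1
    - sigma) alpha, so the quadratic upper model makes it acceptable; therefore beta^m >= t2. The
    denominator K + 1 avoids a division by zero. *)
Lemma tau_lower : exists2 tm : R, 0 < tm & forall k, tm <= step k.
Proof.
have [t1 [K [t10 K0 H]]] := penalty_upper.
have /andP[b0 b1] := beta_itv hrun; have /andP[s0 s1] := sigma_itv hrun.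
have al := alpha_gt0 hrun.
have sa : 0 < (1 - sigma) * alpha by rewrite mulr_gt0 // subr_gt0.
have K1 : 0 < K + 1 by rewrite ltr_wpDl.
pose t2 := Num.min t1 ((1 - sigma) * alpha / (K + 1)).
have t20 : 0 < t2 by rewrite lt_min t10 divr_gt0.
exists (Num.min 1 (beta * t2)); first by rewrite lt_min ltr01 mulr_gt0.
move=> k; rewrite ge_min; case qk : (q k) => [|m].
  by rewrite /tau qk expr0 lexx.
apply/orP; right; rewrite /tau qk exprS ler_pM2l // leNgt; apply/negP => mt.
have := q_smallest hrun (m := m) (k := k); rewrite qk ltnSn => /(_ isT); apply.
have t0 : 0 < beta ^+ m by rewrite exprn_gt0.
have t01 : 0 <= beta ^+ m <= 1 by rewrite (ltW t0) exprn_ile1 // ltW.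
move: mt; rewrite lt_min ltr_pdivlMr // => /andP[tt1 tt2].
rewrite /line_search_test (penalty_modelE hP _ _ _ (x_in hP hrun k)).
rewrite (penaltyE hP _ (step_in hP (x_in hP hrun k) (xd_in hP hrun k) t01)).
rewrite -EFinD lee_fin; apply: le_trans (H k _ t01 (ltW tt1)) _.
rewrite lerD2l (enormZ sp) exprMn mulrA ger0_norm ?(ltW t0) //.
apply: ler_wpM2r; first exact: sqr_ge0.
move: (beta ^+ m) t0 tt2 => t t0 tt2; rewrite expr2; nra.
Qed.

Lemma values_converge (pb : R) (K : nat) : (forall k, (K <= k)%N -> p k = pb) ->
  exists om th : R, [/\ 0 < th,
    forall k, (K <= k)%N -> om <= penr g h pb (x k),
    (fun k => penr g h pb (x k)) @ \oo --> om &
    forall k, (K <= k)%N ->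
      th * (penr g h pb (x k) - opt_value g h x p v G d k
            + sigma * alpha * norm (d k) ^+ 2)
      <= penr g h pb (x k) - penr g h pb (x k.+1)].
Proof.
move=> pK; have [tm tm0 Htm] := tau_lower.
have pb0 : 0 < pb by rewrite -(pK K (leqnn _)) (p_gt0 hrun).
have sa0 : 0 <= sigma * alpha.
  by rewrite mulr_ge0 // ltW ?(alpha_gt0 hrun) //; case/andP: (sigma_itv hrun).
pose f k := penr g h pb (x k).
have dec k : (K <= k)%N ->
    tm * (f k - opt_value g h x p v G d k + sigma * alpha * norm (d k) ^+ 2)
    <= f k - f k.+1.
  move=> Kk; have := decrease hP hrun k; have := opt_value_le hP hrun k.
  rewrite (pK k Kk) -/(f k) -/(f k.+1).
  have := Htm k; move: (tau _ _ _) (opt_value _ _ _ _ _ _ _ _) => t E tt.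
  have D0 : 0 <= sigma * alpha * norm (d k) ^+ 2 by rewrite mulr_ge0 // sqr_ge0.
  move: (sigma * alpha * _) D0 => D0 D00 Ef hdec.
  (* Nonnegativity of the bracket allows the step size to be replaced by its lower bound. *)
  have hb : 0 <= f k - E + D0 by lra.
  have := ler_wpM2r hb tt; lra.
have fdec k : (K <= k)%N -> f k.+1 <= f k.
  move=> Kk; have := dec k Kk; have := opt_value_le hP hrun k.
  rewrite (pK k Kk) -/(f k).
  have D0 : 0 <= sigma * alpha * norm (d k) ^+ 2 by rewrite mulr_ge0 // sqr_ge0.
  move: (sigma * alpha * _) (opt_value _ _ _ _ _ _ _ _) D0 => D0 E D00 Ef hd.
  have : 0 <= tm * (f k - E + D0) by rewrite mulr_ge0 ?(ltW tm0) //; lra.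
  by lra.
have fmono j k : (K <= j)%N -> (j <= k)%N -> f k <= f j.
  move=> Kj /subnKC <-; elim: (k - j)%N => [|l IH]; first by rewrite addn0.
  rewrite addnS; apply: le_trans IH; apply: fdec.
  by apply: (leq_trans Kj); rewrite leq_addr.
have [m Hm] := phi0_bounded_below hP.
have flow k : pb^-1 * m <= f k.
  have := Hm (x k) (x_in hP hrun k); rewrite (phiE hP _ (x_in hP hrun k)) lee_fin => h1.
  rewrite /f /penr -[leLHS]addr0; apply: lerD; first by rewrite ler_pM2l ?invr_gt0.
  by apply: sumr_ge0 => i _; rewrite le_max lexx orbT.
pose S := [set f k | k in [set k | (K <= k)%N]].
have Sinf : has_inf S.
  split; first by exists (f K), K => //=.
  by exists (pb^-1 * m) => _ [k _ <-].
exists (inf S), tm; split => //.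
- by move=> k Kk; apply: ge_inf; [case: Sinf | exists k].
- apply/cvgrPdist_le => e e0.
  have [_ [j /= Kj <-] Hj] := inf_adherent e0 Sinf.
  exists j => // k /= jk.
  have h1 : inf S <= f k.
    by apply: ge_inf; [case: Sinf | exists k => //=; exact: leq_trans jk].
  rewrite -/(f k) ler0_norm ?subr_le0 // opprB; have := fmono j k Kj jk.
  by move: (f k) (f j) Hj => a b; lra.
Qed.

End BoundedRun.

(** * The merit function *)

Section ProductScalarProduct.
Variables (R : realType) (V W : normedModType R).
Variables (ip1 : V -> V -> R) (ip2 : W -> W -> R).
Hypotheses (sp1 : scalar_product ip1) (sp2 : scalar_product ip2).

Definition prod_ip (z z' : V * W) : R := ip1 z.1 z'.1 + ip2 z.2 z'.2.

Lemma enorm_prod_fst z : enorm ip1 z.1 <= enorm prod_ip z.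
Proof. by apply: ler_wsqrtr; rewrite /prod_ip lerDl (sp_ge0 sp2). Qed.

Lemma enorm_prod_snd z : enorm ip2 z.2 <= enorm prod_ip z.
Proof. by apply: ler_wsqrtr; rewrite /prod_ip lerDr (sp_ge0 sp1). Qed.

Lemma enorm_prod_le z : enorm prod_ip z <= enorm ip1 z.1 + enorm ip2 z.2.
Proof.
have a0 := enorm_ge0 ip1 z.1; have b0 := enorm_ge0 ip2 z.2.
rewrite -(@ler_pXn2r _ 2) ?nnegrE ?addr_ge0 ?enorm_ge0 //.
have -> : enorm prod_ip z ^+ 2 = enorm ip1 z.1 ^+ 2 + enorm ip2 z.2 ^+ 2.
  rewrite (enorm_sqr sp1) (enorm_sqr sp2) sqr_sqrtr //.
  by rewrite /prod_ip addr_ge0 ?(sp_ge0 sp1) ?(sp_ge0 sp2).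
move: (enorm ip1 z.1) (enorm ip2 z.2) a0 b0 => a b a0 b0.
by rewrite sqrrD [leRHS]addrAC lerDl mulrn_wge0 // mulr_ge0.
Qed.

Lemma prod_scalar_product : @scalar_product R (V * W)%type prod_ip.
Proof.
split.
- by move=> x y; rewrite /prod_ip (sp_sym sp1) (sp_sym sp2).
- by move=> x y z; rewrite /prod_ip /= (sp_Dl sp1) (sp_Dl sp2) addrACA.
- by move=> a x y; rewrite /prod_ip /= (sp_Zl sp1) (sp_Zl sp2) mulrDr.
- by move=> x; rewrite /prod_ip addr_ge0 ?(sp_ge0 sp1) ?(sp_ge0 sp2).
have [C1 C10 H1] := sp_equiv sp1; have [C2 C20 H2] := sp_equiv sp2.
exists (C1 + C2) => [|z]; first exact: addr_gt0.
have [a1 a2] := H1 z.1; have [b1 b2] := H2 z.2.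
have n1 : `|z.1| <= `|z| by rewrite [leRHS]prod_normE le_max lexx.
have n2 : `|z.2| <= `|z| by rewrite [leRHS]prod_normE le_max lexx orbT.
split.
  rewrite [leLHS]prod_normE ge_max mulrDl; apply/andP; split.
    apply: (le_trans a1); apply: ler_wpDr.
      by rewrite mulr_ge0 ?enorm_ge0 // ltW.
    by rewrite ler_pM2l // enorm_prod_fst.
  apply: (le_trans b1); apply: ler_wpDl.
    by rewrite mulr_ge0 ?enorm_ge0 // ltW.
  by rewrite ler_pM2l // enorm_prod_snd.
apply: le_trans (enorm_prod_le z) _; rewrite mulrDl; apply: lerD.
  by apply: (le_trans a2); rewrite ler_pM2l.
by apply: (le_trans b2); rewrite ler_pM2l.
Qed.

End ProductScalarProduct.

Lemma real_scalar_product (R : realType) :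
  @scalar_product R R^o (fun a b : R => a * b).
Proof.
split.
- by move=> x y; rewrite mulrC.
- by move=> x y z; rewrite mulrDl.
- by move=> a x y; rewrite /GRing.scale /= mulrA.
- by move=> x; rewrite -expr2 sqr_ge0.
by exists 1 => // x; rewrite mul1r mul1r /enorm -expr2 sqrtr_sqr.
Qed.

Section MeritSpace.
Variables (R : realType) (n : nat) (I : finType).
Local Notation V := 'cV[R]_n.
Local Notation dot := (@mxdot R n 1).
Local Notation norm := (enorm dot).
Local Notation mdot := (@merit_dot R n I).
Local Notation vfam := (vfamily R n I).
Local Notation P2 := (V * R^o)%type.
Local Notation P3 := (V * R^o * V)%type.
Local Notation P4 := (V * R^o * V * 'M[R]_n)%type.
Local Notation P5 := (V * R^o * V * 'M[R]_n * vfam)%type.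
Local Notation P6 := (V * R^o * V * 'M[R]_n * vfam * vfam)%type.
(** The scalar product of the merit space is built by adding one factor at a time, so that each
    stage is an instance of [prod_scalar_product]. *)
Definition merit_ip2 (z z' : P2) : R := dot z.1 z'.1 + z.2 * z'.2.
Definition merit_ip3 (z z' : P3) : R := merit_ip2 z.1 z'.1 + dot z.2 z'.2.
Definition merit_ip4 (z z' : P4) : R := merit_ip3 z.1 z'.1 + mxdot z.2 z'.2.
Definition merit_ip5 (z z' : P5) : R := merit_ip4 z.1 z'.1 + mxdot z.2 z'.2.
Definition merit_ip6 (z z' : P6) : R := merit_ip5 z.1 z'.1 + mxdot z.2 z'.2.
Let sp1 := mxdot_scalar_product R n 1.
Let spM := mxdot_scalar_product R n n.
Let spF : @scalar_product R vfam (@mxdot R n _) := mxdot_scalar_product R n _.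
Let sp2 : @scalar_product R P2 merit_ip2.
Proof. exact: (prod_scalar_product sp1 (real_scalar_product R)). Qed.
Let sp3 : @scalar_product R P3 merit_ip3.
Proof. exact: (prod_scalar_product sp2 sp1). Qed.
Let sp4 : @scalar_product R P4 merit_ip4.
Proof. exact: (prod_scalar_product sp3 spM). Qed.
Let sp5 : @scalar_product R P5 merit_ip5.
Proof. exact: (prod_scalar_product sp4 spF). Qed.
Let sp6 : @scalar_product R P6 merit_ip6.
Proof. exact: (prod_scalar_product sp5 spF). Qed.
Lemma merit_dotE : mdot = merit_ip6.
Proof. by apply/funext => -[[[[[? ?] ?] ?] ?] ?]; apply/funext => -[[[[[? ?] ?] ?] ?] ?]. Qed.

Lemma merit_scalar_product : scalar_product mdot.
Proof. rewrite merit_dotE. exact: sp6. Qed.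

Lemma merit_norm_le (x d : V) (t : R) (G : 'M[R]_n) (w u : vfam) :
  enorm mdot (x, t, d, G, w, u) <=
  norm x + `|t| + norm d + enorm (@mxdot R n n) G + enorm (@mxdot R n _) w
  + enorm (@mxdot R n _) u.
Proof.
have := enorm_ge0 dot x; have := normr_ge0 t; have := enorm_ge0 dot d.
have := enorm_ge0 (@mxdot R n n) G; have := enorm_ge0 (@mxdot R n _) w.
have := enorm_ge0 (@mxdot R n _) u.
rewrite /enorm /merit_dot -(enorm_sqr sp1 x) -(enorm_sqr sp1 d) -(enorm_sqr spM G).
rewrite -(enorm_sqr spF w) -(enorm_sqr spF u) -expr2 -(real_normK (num_real t)).
rewrite !sqrtr_sqr !(ger0_norm (enorm_ge0 _ _)).
move: (enorm _ x) `|t| (enorm _ d) (enorm _ G) (enorm _ w) (enorm _ u).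
move=> a1 a2 a3 a4 a5 a6 h6 h5 h4 h3 h2 h1.
rewrite -[leRHS]ger0_norm ?addr_ge0 // -sqrtr_sqr; apply: ler_wsqrtr.
have sqD (a b : R) : 0 <= a -> 0 <= b -> a ^+ 2 + b ^+ 2 <= (a + b) ^+ 2.
  by move=> a0 b0; rewrite sqrrD [leRHS]addrAC lerDl mulrn_wge0 // mulr_ge0.
apply: le_trans (sqD _ _ _ h6); last by rewrite !addr_ge0.
rewrite lerD2r; apply: le_trans (sqD _ _ _ h5); last by rewrite !addr_ge0.
rewrite lerD2r; apply: le_trans (sqD _ _ _ h4); last by rewrite !addr_ge0.
rewrite lerD2r; apply: le_trans (sqD _ _ _ h3); last by rewrite !addr_ge0.
by rewrite lerD2r; exact: sqD.
Qed.

Lemma merit_norm_components (x d : V) (t : R) (G : 'M[R]_n) (w u : vfam) N :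
  enorm mdot (x, t, d, G, w, u) <= N ->
  [/\ norm x <= N, `|t| <= N, norm d <= N, enorm (@mxdot R n n) G <= N &
      enorm (@mxdot R n _) w <= N /\ enorm (@mxdot R n _) u <= N].
Proof.
move=> H; have h1 := sp_ge0 sp1 x; have h3 := sp_ge0 sp1 d.
have h2 : 0 <= t * t by rewrite -expr2 sqr_ge0.
have h4 := sp_ge0 spM G; have h5 := sp_ge0 spF w; have h6 := sp_ge0 spF u.
have tE : `|t| = Num.sqrt (t * t) by rewrite -expr2 sqrtr_sqr.
have le a : a <= merit_dot (x, t, d, G, w, u) (x, t, d, G, w, u) -> Num.sqrt a <= N.
  by move=> ha; apply: le_trans H; apply: ler_wsqrtr.
move: le; rewrite /merit_dot tE /enorm.
move: (dot x x) (t * t) (dot d d) (mxdot G G) (mxdot w w) (mxdot u u) h1 h2 h3 h4 h5 h6.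
move=> a1 a2 a3 a4 a5 a6 h1 h2 h3 h4 h5 h6 le.
by split; [| | | | split]; apply: le; lra.
Qed.

Definition fam (f : option I -> V) : vfam := \matrix_(a, j) f (enum_val j) a 0.

Lemma vmember_fam f i : vmember (fam f) i = f i.
Proof. by apply/colP => a; rewrite !mxE enum_rankK. Qed.

Lemma mxdot_fam (f : option I -> V) (w : vfam) :
  mxdot (fam f) w = \sum_i dot (f i) (vmember w i).
Proof.
rewrite {1}/mxdot exchange_big /=.
rewrite (reindex_onto (@enum_rank (option I)) (@enum_val _ _)) /=; last first.
  by move=> j _; rewrite enum_valK.
apply: eq_big => [i|i _]; first by rewrite enum_rankK eqxx.
by apply: eq_bigr => a _; rewrite big_ord1 !mxE enum_rankK.
Qed.

Lemma vmemberD (w u : vfam) i : vmember (w + u) i = vmember w i + vmember u i.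
Proof. by apply/colP => a; rewrite !mxE. Qed.

Lemma vmember_norm (w : vfam) i : norm (vmember w i) <= enorm (@mxdot R n _) w.
Proof.
apply: ler_wsqrtr; rewrite /mxdot [leRHS]exchange_big /=.
rewrite (bigD1 (enum_rank i)) //= -[leLHS]addr0; apply: lerD; last first.
  by apply: sumr_ge0 => j _; apply: sumr_ge0 => a _; rewrite -expr2 sqr_ge0.
by apply: ler_sum => a _; rewrite big_ord1 !mxE.
Qed.

Lemma fam_norm (f : option I -> V) : enorm (@mxdot R n _) (fam f) <= \sum_i norm (f i).
Proof.
have S0 : 0 <= \sum_i norm (f i) by apply: sumr_ge0 => i _; exact: enorm_ge0.
rewrite -(@ler_pXn2r _ 2) ?nnegrE ?enorm_ge0 // (enorm_sqr spF) mxdot_fam.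
under eq_bigr do rewrite vmember_fam.
rewrite expr2 mulr_suml; apply: ler_sum => i _.
rewrite -(enorm_sqr sp1) expr2; apply: ler_wpM2l; first exact: enorm_ge0.
by rewrite (bigD1 i) //= lerDl; apply: sumr_ge0 => j _; exact: enorm_ge0.
Qed.

Lemma sum_option (M : nmodType) (F : option I -> M) :
  \sum_(j : option I) F j = F None + \sum_(i : I) F (Some i).
Proof.
rewrite (bigD1 None) //=; congr (_ + _).
rewrite (reindex_omap Some id) /=; last by case.
by apply: eq_bigl => i; rewrite eqxx.
Qed.

Lemma outer_norm (d : V) : enorm (@mxdot R n n) (d *m d^T) = norm d ^+ 2.
Proof.
rewrite /enorm; have -> : mxdot (d *m d^T) (d *m d^T) = dot d d ^+ 2.
  rewrite expr2 /mxdot mulr_suml; apply: eq_bigr => i _.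
  rewrite !big_ord1 mulr_sumr; apply: eq_bigr => j _.
  by rewrite !big_ord1 !mxE !big_ord1 !mxE; ring.
by rewrite sqrtr_sqr sqr_sqrtr ?ger0_norm // (sp_ge0 sp1).
Qed.

(** The matrix d d^T represents the linear form sending G to the quadratic value at d, so it is the
    G-component of the gradient of the quadratic term. *)
Lemma mxdot_outer (d : V) (G : 'M[R]_n) : mxdot (d *m d^T) G = dot (G *m d) d.
Proof.
rewrite /mxdot; apply: eq_bigr => i _; rewrite big_ord1 mxE mulr_suml.
by apply: eq_bigr => j _; rewrite !mxE big_ord1 !mxE; ring.
Qed.

End MeritSpace.

Lemma le_of_small (R : realType) (a b c t0 : R) : 0 < t0 -> 0 <= b ->
  (forall t, 0 < t -> t <= t0 -> a - t * b <= c) -> a <= c.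
Proof.
move=> t00 b0 H; apply/ler_addgt0Pr => e e0.
have b1 : 0 < b + 1 by rewrite ltr_wpDl.
pose t := Num.min t0 (e / (b + 1)).
have t1 : 0 < t by rewrite lt_min t00 divr_gt0.
have t2 : t <= t0 by rewrite ge_min lexx.
have : t * (b + 1) <= e by rewrite -ler_pdivlMr // ge_min lexx orbT.
have := H t t1 t2; lra.
Qed.

(** * ** Fenchel duality and expansions of the merit function *)

Section MeritFunction.
Variables (R : realType) (n : nat) (I : finType).
Local Notation V := 'cV[R]_n.
Local Notation dot := (@mxdot R n 1).
Local Notation norm := (enorm dot).
Local Notation fnorm := (enorm (@mxdot R n n)).
Local Notation subdiff := (limiting_subdiff dot).
Variables (X : set V) (g : option I -> V -> R) (h : option I -> V -> \bar R).
Hypothesis hP : standing_assumptions X g h.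
Variables (D : set V) (rho : R).
Hypotheses (DX : D `<=` X) (D_mix : mix_closed D) (rho0 : 0 < rho).
Hypothesis hat_h_convex : forall i, econvex_on D (hat_h h rho i).
Let sp := mxdot_scalar_product R n 1.

Definition hat_hr (i : option I) (x : V) : R :=
  fine (h i x) + rho / 2 * norm x ^+ 2.

Lemma hat_hE i x : D x -> hat_h h rho i x = (hat_hr i x)%:E.
Proof. by move=> Dx; rewrite /hat_h -(fineK (h_fin hP i (DX Dx))). Qed.

Lemma sqnormD (x y : V) : norm (x + y) ^+ 2 = norm x ^+ 2 + 2 * dot x y + norm y ^+ 2.
Proof.
rewrite !(enorm_sqr sp) (sp_Dl sp) !(sp_Dr sp) (sp_sym sp y x).
move: (dot x x) (dot x y) (dot y y) => a b c; ring.
Qed.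

(** Prox-regularity gives the inequality only near x and with a quadratic error. Along the segment
    from x to y, convexity of [hat_h] carries it to y: at parameter t the error is of order t^2, and
    it vanishes after division by t. The constant r of prox-regularity is thus unrelated to rho. *)
Lemma hat_h_subgradient i x y v : D x -> D y -> subdiff (h i) x v ->
  hat_hr i x + dot (v + rho *: x) (y - x) <= hat_hr i y.
Proof.
move=> Dx Dy vx; have Xx := DX Dx.
have [del [r [del0 r0 Hprox]]] := prox_regular_bound (h_lipschitz hP i Xx)
  (h_prox_regular hP i Xx) vx.
have N1 : 0 < norm (y - x) + 1 by rewrite ltr_wpDl // enorm_ge0.
rewrite -lerBrDl.
apply: (@le_of_small _ _ (r * norm (y - x) ^+ 2) _ (Num.min 1 (del / 2 / (norm (y - x) + 1)))).
- by rewrite lt_min ltr01 !divr_gt0.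
- by rewrite mulr_ge0 // sqr_ge0.
move=> t t0; rewrite le_min ler_pdivlMr // => /andP[t1 t2].
have t01 : 0 <= t <= 1 by rewrite ltW.
have zE : t *: y + (1 - t) *: x = x + t *: (y - x).
  by rewrite scalerBr scalerBl scale1r addrCA.
have Dz : D (x + t *: (y - x)) by rewrite -zE; exact: D_mix.
have := hat_h_convex i Dy Dx t01; rewrite zE !hat_hE // -!EFinM -EFinD lee_fin.
have xx : norm (x - x) < del by rewrite subrr (enorm0 sp).
have zx : norm (x + t *: (y - x) - x) < del.
  rewrite [x + _]addrC addrK (enormZ sp) gtr0_norm //.
  by move: t2; move: (norm (y - x)) => a; lra.
have vv : norm (v - v) < del by rewrite subrr (enorm0 sp).
have := Hprox _ _ _ xx zx vv vx.
rewrite [x + _ - x]addrAC subrr add0r (sp_Zr sp) (enormZ sp) gtr0_norm // exprMn.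
rewrite /hat_hr sqnormD (sp_Zr sp) (sp_Dl sp) (sp_Zl sp) (enormZ sp) gtr0_norm // exprMn.
have nn0 : 0 <= norm (y - x) ^+ 2 by rewrite sqr_ge0.
move: (fine _) (fine (h i x)) (fine (h i y)) (dot v _) (dot x _).
move: (norm (y - x) ^+ 2) nn0 (norm x ^+ 2) (norm y ^+ 2).
move=> n1 n10 n2 n3 f1 f2 f3 d1 d2 h1 h2.
rewrite -(ler_pM2l t0).
have h3 : 0 <= rho / 2 * (t ^+ 2 * n1) by rewrite !mulr_ge0 // ?divr_ge0 // ?sqr_ge0 // ltW.
move: h1 h2 h3; rewrite !expr2; lra.
Qed.

Lemma hat_h_conj_ge i x u : D x ->
  ((dot u x - hat_hr i x)%:E <= hat_h_conj h D rho i u)%E.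
Proof.
by move=> Dx; apply: ereal_sup_ubound; exists x => //; rewrite hat_hE.
Qed.

Lemma fenchel_equality i x v : D x -> subdiff (h i) x v ->
  hat_h_conj h D rho i (v + rho *: x) =
  (dot (v + rho *: x) x - hat_hr i x)%:E.
Proof.
move=> Dx vx; apply/eqP; rewrite eq_le hat_h_conj_ge // andbT.
apply: ge_ereal_sup => _ [y Dy <-]; rewrite hat_hE // -EFinB lee_fin.
have := hat_h_subgradient Dx Dy vx; rewrite (sp_Br sp).
move: (dot _ x) (dot _ y) (hat_hr i x) (hat_hr i y) => a b c e; lra.
Qed.

(** The Fenchel-Young inequality at a fixed x bounds the term from below by a differentiable
    function of the remaining variables, also where the conjugate is infinite. At the base point the
    bound is attained, so its gradient yields subgradients. *)
Lemma merit_term_ge i x x' tau d' w u : D x ->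
  ((hat_g g rho i x' + dot (vmember w i) (tau *: d')
    + dot (vmember u i) x - hat_hr i x - dot (vmember u i) x')%:E <=
  merit_term g h D rho i x' tau d' w u)%E.
Proof.
move=> Dx; rewrite /merit_term.
have := hat_h_conj_ge i (vmember u i) Dx.
case: (hat_h_conj _ _ _ _ _) => [r||] //=.
- rewrite -!EFinD !lee_fin.
  move: (dot _ x) (dot _ x') (dot _ (_ *: _)) (hat_hr i x) (hat_g _ _ _ _).
  by move=> a1 a2 a3 a4 a5; lra.
- by move=> _; rewrite addey // addye // leey.
Qed.

(* The merit function is evaluated at tau = 1, not at the step size: there its
   value is the optimal value of the subproblem plus half the quadratic term. *)
Definition base_point (x d : V) (G : 'M[R]_n) (v : option I -> V) : merit_space R n I :=
  (x, 1, d, G, fam (slope g x v), fam (fun j => v j + rho *: x)).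

Lemma merit_term_base i x d v : D x -> subdiff (h i) x (v i) ->
  merit_term g h D rho i x 1 d (fam (slope g x v)) (fam (fun j => v j + rho *: x)) =
  (phir g h i x + dot (slope g x v i) d)%:E.
Proof.
move=> Dx vx; rewrite /merit_term !vmember_fam scale1r fenchel_equality //.
rewrite -EFinN -!EFinD /hat_g /hat_hr /phir; congr (_%:E).
move: (dot _ d) (dot _ x) (norm x ^+ 2) (g i x) (fine _) => a b c e f; ring.
Qed.

Lemma merit_base p x d G v : D x -> X (x + d) -> (forall i, subdiff (h i) x (v i)) ->
  merit X g h D rho p (base_point x d G v) =
  (modelr g h p x v d + dot (G *m d) d)%:E.
Proof.
move=> Dx Xd vx; rewrite /merit /base_point merit_term_base // /indicator.
under eq_bigr do rewrite merit_term_base //.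
by case: asboolP => // _; rewrite adde0 sum_maxe mul1r.
Qed.

(** The number N bounds all increments. The definition of u makes the parts linear in rho cancel,
    and the square of dx has a favourable sign. The increment mu enters only through its product
    with dx, which is why the subgradient has zero component in the last variable. The constant 3
    counts the products of om with e, of mu with dx, and of t, om and e. *)
Lemma merit_term_expansion i x dx e t d v (om mu w u : V) N e1 :
  w = slope g x v i -> u = v i + rho *: x ->
  0 <= N -> N <= 1 -> 0 <= e1 ->
  norm dx <= N -> `|t| <= N -> norm e <= N -> norm om <= N -> norm mu <= N ->
  `|g i (x + dx) - g i x - dot (grad (g i) x) dx| <= e1 * norm dx ->
  phir g h i x + dot w d
  + (dot w dx + dot w e + dot om d + t * dot w d)
  - e1 * N - (3 + norm w + norm d) * N ^+ 2 <=
  hat_g g rho i (x + dx) + dot (w + om) ((1 + t) *: (d + e))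
    + dot (u + mu) x - hat_hr i x - dot (u + mu) (x + dx).
Proof.
move=> wdef udef N0 N1 e10 hdx ht he hom hmu hg.
rewrite /hat_g /hat_hr /phir sqnormD.
have hwe := le_trans (cauchy_schwarz sp w e) (ler_wpM2l (enorm_ge0 _ w) he).
have hod := le_trans (cauchy_schwarz sp om d) (ler_wpM2r (enorm_ge0 _ d) hom).
have hoe := le_trans (cauchy_schwarz sp om e) (ler_pM (enorm_ge0 _ _) (enorm_ge0 _ _) hom he).
have hmx := le_trans (cauchy_schwarz sp mu dx) (ler_pM (enorm_ge0 _ _) (enorm_ge0 _ _) hmu hdx).
have hg' := le_trans hg (ler_wpM2l e10 hdx).
have rr : 0 <= rho / 2 * norm dx ^+ 2 by rewrite mulr_ge0 ?divr_ge0 ?sqr_ge0 // ltW.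
have wE : dot w dx = dot (grad (g i) x) dx - dot (v i) dx.
  by rewrite wdef; exact: (sp_Bl sp).
have uE : dot u dx = dot (v i) dx + rho * dot x dx.
  by rewrite udef (sp_Dl sp) (sp_Zl sp).
rewrite (sp_Zr sp) (sp_Dl sp w om) !(sp_Dr sp _ d e) (sp_Dl sp u mu x).
rewrite (sp_Dl sp u mu (x + dx)) !(sp_Dr sp _ x dx) uE wE.
have w0 := enorm_ge0 dot w; have d0 := enorm_ge0 dot d.
move: hwe hod hoe hmx hg' rr w0 d0.
move: (norm w) (norm d) (dot w e) (dot om d) (dot om e) (dot mu dx).
move: (dot w d) (dot (grad _ _) dx) (dot (v i) dx) (dot x dx) (dot u x) (dot mu x).
move: (norm x ^+ 2) (norm dx ^+ 2) (g i (x + dx)) (g i x) (fine _).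
move=> X2 Y2 g1 g0 h0 wd gd vd xd ux mx W D0 we od oe md.
move=> hwe hod hoe hmx hg' rr w0 d0.
move: hwe hod hoe hmx hg' ht; rewrite !ler_norml.
move=> /andP[we1 we2] /andP[od1 od2] /andP[oe1 oe2] /andP[md1 md2] /andP[gg1 gg2] /andP[t1 t2].
have NN : N * N <= N by rewrite ler_piMl.
have tb a b : 0 <= a -> - a <= b -> b <= a -> - (N * a) <= t * b.
  move=> a0 ab ba.
  have : `|t * b| <= N * a.
    by rewrite normrM; apply: ler_pM => //; rewrite ler_norml; apply/andP; split.
  by rewrite ler_norml => /andP[].
have h1 := tb _ _ (mulr_ge0 w0 N0) we1 we2.
have h2 := tb _ _ (mulr_ge0 N0 d0) od1 od2.
have h3 := tb _ _ (mulr_ge0 N0 N0) oe1 oe2.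
have h4 : N * (N * N) <= N * N by rewrite ler_wpM2l.
move: h1 h2 h3 h4; rewrite !expr2; lra.
Qed.

(** Symmetry of G merges the two mixed terms in d and e. Every omitted product contains at least two
    increments, so N <= 1 bounds it by a multiple of N^2. *)
Lemma quadratic_expansion (d e : V) (G Ga : 'M[R]_n) t N :
  G^T = G -> 0 <= N -> N <= 1 -> `|t| <= N -> norm e <= N -> fnorm Ga <= N ->
  dot (G *m d) d + 2 * dot (G *m d) e + dot (Ga *m d) d + t * dot (G *m d) d
  - (2 + 2 * fnorm G + 2 * fnorm G * norm d + 4 * norm d + norm d ^+ 2) * N ^+ 2 <=
  (1 + t) * dot ((G + Ga) *m (d + e)) (d + e).
Proof.
move=> Gs N0 N1 ht he hGa.
have D0 := enorm_ge0 dot d; have F0 := enorm_ge0 (@mxdot R n n) G.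
have e0 := enorm_ge0 dot e; have Ga0 := enorm_ge0 (@mxdot R n n) Ga.
have hGee : `|dot (G *m e) e| <= fnorm G * N * N.
  apply: le_trans (mxdot_mulmx_le _ _ _) _; apply: ler_pM => //; last exact: ler_wpM2l.
  by rewrite mulr_ge0.
have hGde : `|dot (G *m d) e| <= fnorm G * norm d * N.
  apply: le_trans (mxdot_mulmx_le _ _ _) _; apply: ler_wpM2l => //.
  by rewrite mulr_ge0.
have hadd : `|dot (Ga *m d) d| <= N * norm d * norm d.
  by apply: le_trans (mxdot_mulmx_le _ _ _) _; rewrite !ler_wpM2r.
have hade : `|dot (Ga *m d) e| <= N * norm d * N.
  apply: le_trans (mxdot_mulmx_le _ _ _) _; apply: ler_pM => //; first by rewrite mulr_ge0.
  by rewrite ler_wpM2r.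
have haed : `|dot (Ga *m e) d| <= N * N * norm d.
  apply: le_trans (mxdot_mulmx_le _ _ _) _; apply: ler_wpM2r => //.
  exact: ler_pM.
have haee : `|dot (Ga *m e) e| <= N * N * N.
  apply: le_trans (mxdot_mulmx_le _ _ _) _; apply: ler_pM => //; first by rewrite mulr_ge0.
  exact: ler_pM.
have Ged : dot (G *m e) d = dot (G *m d) e.
  by rewrite mxdot_mulmx_tr Gs (sp_sym sp).
rewrite mulmxDl !mulmxDr !(sp_Dl sp) !(sp_Dr sp) Ged.
move: hGee hGde hadd hade haed haee ht; rewrite !ler_norml.
move: (dot (G *m d) d) (dot (G *m d) e) (dot (G *m e) e) => Q0 Q1 Q2.
move: (dot (Ga *m d) d) (dot (Ga *m d) e) (dot (Ga *m e) d) (dot (Ga *m e) e) => A0 A1 A2 A3.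
move: (norm d) (fnorm G) D0 F0 => D1 F D0 F0.
move=> /andP[a1 a2] /andP[b1 b2] /andP[c1 c2] /andP[d1 d2] /andP[e1 e2] /andP[f1 f2] ht.
have tb a b : 0 <= a -> - a <= b -> b <= a -> - (N * a) <= t * b.
  move=> aa0 ab ba.
  have : `|t * b| <= N * a.
    rewrite normrM; apply: ler_pM => //; first by rewrite ler_norml.
    by rewrite ler_norml; apply/andP; split.
  by rewrite ler_norml => /andP[].
have NN0 := mulr_ge0 N0 N0.
have g1 := tb _ _ (mulr_ge0 (mulr_ge0 F0 N0) N0) a1 a2.
have g2 := tb _ _ (mulr_ge0 (mulr_ge0 F0 D0) N0) b1 b2.
have g3 := tb _ _ (mulr_ge0 (mulr_ge0 N0 D0) D0) c1 c2.
have g4 := tb _ _ (mulr_ge0 (mulr_ge0 N0 D0) N0) d1 d2.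
have g5 := tb _ _ (mulr_ge0 NN0 D0) e1 e2.
have g6 := tb _ _ (mulr_ge0 NN0 N0) f1 f2.
have k1 : N * (N * N) <= N * N by rewrite ler_piMl.
have k2 : N * (N * (N * N)) <= N * N.
  by apply: (@le_trans _ _ (N * (N * N))) => //; apply: ler_wpM2l.
have m1 := ler_wpM2l F0 k1; have m2 := ler_wpM2l D0 k1.
move: g1 g2 g3 g4 g5 g6 m1 m2; rewrite !expr2; lra.
Qed.

End MeritFunction.

Lemma mul_le_half (R : realFieldType) (a C e : R) :
  0 <= C -> 0 <= a -> a < e / (2 * (C + 1)) -> a * C <= e / 2.
Proof.
by move=> C0 a0; rewrite ltr_pdivlMr ?mulr_gt0 ?ltr_wpDl // => h; lra.
Qed.

(** * ** A small subgradient of the merit function *)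

Section MeritSubgradient.
Variables (R : realType) (n : nat) (I : finType).
Local Notation V := 'cV[R]_n.
Local Notation dot := (@mxdot R n 1).
Local Notation norm := (enorm dot).
Local Notation fnorm := (enorm (@mxdot R n n)).
Local Notation subdiff := (limiting_subdiff dot).
Local Notation mdot := (@merit_dot R n I).
Variables (X : set V) (g : option I -> V -> R) (h : option I -> V -> \bar R).
Hypothesis hP : standing_assumptions X g h.
Variables (D : set V) (rho : R).
Hypotheses (DX : D `<=` X) (D_mix : mix_closed D) (rho0 : 0 < rho).
Hypothesis hat_h_convex : forall i, econvex_on D (hat_h h rho i).
Let sp := mxdot_scalar_product R n 1.

Definition weight (p : R) (l : I -> R) (j : option I) : R :=
  if j is Some i then l i else p^-1.

(** A positive part dominates any multiple of its argument by a factor in [0, 1]. The number c is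
    the contribution of a normal vector; it is required to be nonpositive only where the indicator
    is finite. *)
Lemma merit_ge (p : R) (l : I -> R) (T : option I -> R) (c : R) x' tau d' G' w' u' :
  0 < p -> (forall i, 0 <= l i <= 1) ->
  (forall j, ((T j)%:E <= merit_term g h D rho j x' tau d' w' u')%E) ->
  (X (x' + d') -> c <= 0) ->
  ((\sum_j weight p l j * T j + tau * dot (G' *m d') d' + c)%:E <=
   merit X g h D rho p (x', tau, d', G', w', u'))%E.
Proof.
move=> p0 l01 HT Hc; rewrite /merit sum_option 3!EFinD; apply: leeD; last first.
  rewrite /indicator; case: asboolP => [/Hc|_]; first by rewrite lee_fin.
  by rewrite leey.
apply: leeD => //; apply: leeD.
  by rewrite EFinM; apply: lee_wpmul2l; [rewrite lee_fin invr_ge0; exact: ltW | exact: HT].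
rewrite -sumEFin; apply: lee_sum => i _; have /andP[l0 l1] := l01 i.
apply: (@le_trans _ _ (maxe (T (Some i))%:E 0)); last first.
  by rewrite ge_max !le_max HT lexx orbT.
rewrite -EFin_max lee_fin /=; have [T0|T0] := leP (T (Some i)) 0.
  by rewrite mulr_ge0_le0.
by rewrite ler_piMl // ltW.
Qed.

Lemma dot_sum (J : finType) (a : J -> R) (f : J -> V) y :
  dot (\sum_j a j *: f j) y = \sum_j a j * dot (f j) y.
Proof.
elim/big_ind2 : _ => [|x1 x2 y1 y2 <- <-|j _]; first exact: (sp_0l sp).
  exact: (sp_Dl sp).
exact: (sp_Zl sp).
Qed.

(** Let s be the weighted sum of the slopes. The optimality condition makes -(s + G d) normal to X
    at x + d, and this vector is added to both the x- and the d-component of the gradient of the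
    minorant. These are s and s + 2 G d, so -G d and G d remain. Every component now contains d as a
    factor. *)
Definition base_subgradient (p : R) (l : I -> R) (x d : V) (G : 'M[R]_n)
    (v : option I -> V) : merit_space R n I :=
  (- (G *m d),
   dot (\sum_j weight p l j *: slope g x v j) d + dot (G *m d) d,
   G *m d, d *m d^T, fam (fun j => weight p l j *: d), 0).

(** The minorants of the single terms, weighted by the multipliers and combined with the normal
    vector, lie below the merit function and touch it at the base point; their first-order expansion
    gives a regular subgradient. *)
Lemma merit_subgradient (p : R) (l : I -> R) (x d : V) (G : 'M[R]_n)
    (v : option I -> V) :
  0 < p -> D x -> X (x + d) -> G^T = G ->
  (forall i, subdiff (h i) x (v i)) -> (forall i, 0 <= l i <= 1) ->
  (forall i, l i * (phir g h (Some i) x + dot (slope g x v (Some i)) d) =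
     Num.max (phir g h (Some i) x + dot (slope g x v (Some i)) d) 0) ->
  (forall e, X (x + e) ->
     0 <= dot (\sum_j weight p l j *: slope g x v j + G *m d) (e - d)) ->
  regular_subdiff mdot (merit X g h D rho p) (base_point g rho x d G v)
    (base_subgradient p l x d G v).
Proof.
move=> p0 Dx Xd Gs vx l01 lmax kkt.
have spm := merit_scalar_product R n I.
set lam := weight p l; set w := slope g x v.
pose s : V := \sum_j lam j *: w j; rewrite -/s in kkt.
have lam0 j : 0 <= lam j.
  by case: j => [i|]; [case/andP: (l01 i) | rewrite /lam /= invr_ge0 ltW].
have Ebase := merit_base hP DX D_mix rho0 hat_h_convex p G Dx Xd vx.
(* Complementarity: the weighted minorant attains the value of the model, so nothing is lost at the
   base point. *)
have Elam : modelr g h p x v d = \sum_j lam j * (phir g h j x + dot (w j) d).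
  rewrite sum_option; congr (_ + _); apply: eq_bigr => i _.
  by rewrite -lmax.
apply: (regular_subdiff_intro spm); first by rewrite Ebase.
move=> eps eps0.
pose La := \sum_j lam j.
have La0 : 0 <= La by apply: sumr_ge0 => j _.
(* With this tolerance the linearization errors of all g_j, weighted by the multipliers, use at most
   half of eps. *)
pose e1 := eps / (2 * (La + 1)).
have La1 : 0 < La + 1 by rewrite ltr_wpDl.
have e10 : 0 < e1 by rewrite divr_gt0 // mulr_gt0.
pose c j := 3 + norm (w j) + norm d.
pose cq := 2 + 2 * fnorm G + 2 * fnorm G * norm d + 4 * norm d + norm d ^+ 2.
pose Ct := \sum_j lam j * c j + cq.
have Ct0 : 0 <= Ct.
  have F0 := enorm_ge0 (@mxdot R n n) G; have d0 := enorm_ge0 dot d.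
  apply: addr_ge0; last by rewrite !addr_ge0 ?mulr_ge0 ?sqr_ge0.
  by apply: sumr_ge0 => j _; rewrite mulr_ge0 // !addr_ge0 // enorm_ge0.
have Ct1 : 0 < Ct + 1 by rewrite ltr_wpDl.
have [del del0 Hdel] : exists2 del : R, 0 < del & forall dx, norm dx < del ->
    forall j, `|g j (x + dx) - g j x - dot (grad (g j) x) dx| <= e1 * norm dx.
  have H : \forall u \near x, forall j : option I,
      `|g j u - g j x - dot (grad (g j) x) (u - x)| <= e1 * norm (u - x).
    apply: (@filter_forall V (option I) _ (nbhs x)) => j; apply: grad_near => //.
    by have [dg _] := g_C1 hP j; exact: dg.
  have [del del0 H'] := nbhs_enorm sp H.
  exists del => // dx hdx j; have dxE : x + dx - x = dx by rewrite addrAC subrr add0r.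
  by have := H' (x + dx) _ j; rewrite dxE; exact.
(* The three bounds serve the linearization of the g_j, the reduction of higher powers of N to N^2,
   and the absorption of Ct N into the other half of eps. *)
pose del' := Num.min (Num.min del 1) (eps / (2 * (Ct + 1))).
have del'0 : 0 < del'.
  by rewrite !lt_min del0 ltr01 divr_gt0 // mulr_gt0.
have := near_enorm_lt spm (base_point g rho x d G v) del'0.
apply: filterS => -[[[[[x' tau'] d'] G'] w'] u'].
set z := base_point _ _ _ _ _ _; set z' := (x', _, _, _, _, _).
pose dx : V := x' - x; pose t : R := tau' - 1; pose e : V := d' - d.
pose Ga : 'M[R]_n := G' - G; pose om : vfamily R n I := w' - fam w.
pose mu : vfamily R n I := u' - fam (fun j => v j + rho *: x).
have zE : z' - z = (dx, t, e, Ga, om, mu) :> merit_space R n I by [].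
rewrite zE; set N := enorm mdot _.
rewrite !lt_min => /andP[/andP[Ndel N1] Neps].
have N0 : 0 <= N := enorm_ge0 _ _.
have [hdx ht he hGa [hom hmu]] := merit_norm_components (lexx N).
have x'E : x' = x + dx by rewrite /dx subrKC.
have tau'E : tau' = 1 + t by rewrite /t subrKC.
have d'E : d' = d + e by rewrite /e subrKC.
have G'E : G' = G + Ga by rewrite /Ga subrKC.
have w'E j : vmember w' j = w j + vmember om j.
  by rewrite -(vmember_fam w j) -vmemberD /om subrKC.
have u'E j : vmember u' j = (v j + rho *: x) + vmember mu j.
  by rewrite -(vmember_fam (fun j => v j + rho *: x) j) -vmemberD /mu subrKC.
pose T j := phir g h j x + dot (w j) d
  + (dot (w j) dx + dot (w j) e + dot (vmember om j) d + t * dot (w j) d)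
  - e1 * N - c j * N ^+ 2.
have HT j : ((T j)%:E <= merit_term g h D rho j x' tau' d' w' u')%E.
  have hm := @merit_term_ge _ _ _ X g h hP D rho DX j x x' tau' d' w' u' Dx.
  apply: (le_trans _ hm).
  rewrite lee_fin w'E u'E x'E tau'E d'E.
  apply: (@merit_term_expansion _ _ _ g h rho rho0 j x dx e t d v (vmember om j)
    (vmember mu j) (w j) (v j + rho *: x) N e1) => //.
  - exact: ltW.
  - exact: ltW.
  - exact: le_trans (vmember_norm om j) hom.
  - exact: le_trans (vmember_norm mu j) hmu.
  - by apply: Hdel; exact: le_lt_trans hdx Ndel.
(* The optimality condition is applied to the displacement x' + d' - x, which differs from d by
   exactly dx + e. *)
have Hnu : X (x' + d') -> - dot (s + G *m d) (dx + e) <= 0.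
  move=> Xx'; rewrite oppr_le0.
  have -> : dx + e = (x' + d' - x) - d.
    by rewrite /dx /e addrACA addrA.
  by apply: kkt; rewrite [x + _]addrC subrK.
have Hge := @merit_ge p l T _ x' tau' d' G' w' u' p0 l01 HT Hnu.
apply: le_trans Hge; rewrite Ebase -EFinD lee_fin Elam tau'E d'E G'E.
have Hq := @quadratic_expansion _ _ d e G Ga t N Gs N0 (ltW N1) ht he hGa.
have ipE : mdot (base_subgradient p l x d G v) (dx, t, e, Ga, om, mu) =
   - dot (G *m d) dx + (dot s d + dot (G *m d) d) * t + dot (G *m d) e
   + dot (Ga *m d) d + \sum_j lam j * dot (vmember om j) d.
  rewrite /merit_dot /base_subgradient (sp_Nl sp) mxdot_outer mxdot_fam.
  rewrite (sp_0l (mxdot_scalar_product _ _ _)) addr0; congr (_ + _).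
  by apply: eq_bigr => j _; rewrite (sp_Zl sp) (sp_sym sp d).
rewrite ipE.
have TE : \sum_j lam j * T j = \sum_j lam j * (phir g h j x + dot (w j) d)
   + (dot s dx + dot s e + \sum_j lam j * dot (vmember om j) d + t * dot s d)
   - La * (e1 * N) - (\sum_j lam j * c j) * N ^+ 2.
  rewrite /s !dot_sum /La !mulr_sumr !mulr_suml -!big_split /= -!sumrB.
  by apply: eq_bigr => j _; rewrite /T; ring.
rewrite -/lam TE (sp_Dl sp s) (sp_Dr sp s dx) (sp_Dr sp (G *m d) dx).
have Nb : (La * e1 + Ct * N) * N <= eps * N.
  apply: ler_wpM2r => //.
  have b1 : La * e1 <= eps / 2.
    rewrite /e1 mulrA ler_pdivrMr ?mulr_gt0 //.
    have -> : eps / 2 * (2 * (La + 1)) = eps * (La + 1) by field.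
    by rewrite mulrC ler_pM2l // lerDl.
  have b2 : Ct * N <= eps / 2.
    by rewrite mulrC; exact: mul_le_half.
  by rewrite [leRHS](splitr eps); exact: lerD.
move: Hq Nb; rewrite -/cq.
have -> : Ct = \sum_j lam j * c j + cq by [].
move: (dot (_ *m (d + e)) _) (\sum_j lam j * c j) (\sum_j lam j * dot _ d)
  (\sum_j lam j * _) (dot s dx) (dot s e) (dot s d) (dot (G *m d) dx)
  (dot (G *m d) e) (dot (G *m d) d) (dot (Ga *m d) d) (cq) (La) (e1) (N) (t) (eps).
clear; move=> a1 a2 a3 a4 a5 a6 a7 a8 a9 b1 b2 b3 b4 b5 b6 b7 b8.
by rewrite !expr2; lra.
Qed.

End MeritSubgradient.

Section FilterLimits.
Variables (R : realType) (T : Type) (F : set_system T).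
Context {FF : Filter F}.

Lemma cvg_sum_real (J : finType) (f : J -> T -> R) (a : J -> R) :
  (forall j, f j @ F --> a j) -> (fun t => \sum_j f j t) @ F --> \sum_j a j.
Proof. by move=> H; apply: cvg_big => //; exact: add_continuous. Qed.

Lemma cvg_max0 (f : T -> R) (a : R) :
  f @ F --> a -> (fun t => Num.max (f t) 0) @ F --> Num.max a 0.
Proof.
move=> /cvgrPdist_le H; apply/cvgrPdist_le => e e0; apply: filterS (H e e0) => t.
apply: le_trans.
have h1 := max0_lipschitz (f t) (a - f t); have h2 := max0_lipschitz a (f t - a).
move: h1 h2; rewrite !subrKC (distrC (f t)) => h1 h2.
rewrite ler_norml; apply/andP; split; lra.
Qed.

End FilterLimits.

(** * ** Bounds and limits along the run *)

Section ClusterPoints.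
Variables (R : realType) (n : nat) (I : finType).
Local Notation V := 'cV[R]_n.
Local Notation dot := (@mxdot R n 1).
Local Notation norm := (enorm dot).
Local Notation fnorm := (enorm (@mxdot R n n)).
Local Notation subdiff := (limiting_subdiff dot).
Local Notation mdot := (@merit_dot R n I).
Variables (X : set V) (g : option I -> V -> R) (h : option I -> V -> \bar R).
Variables (beta sigma varrho c alpha M_G : R) (x : nat -> V) (p : nat -> R)
  (v : nat -> option I -> V) (G : nat -> 'M[R]_n) (d : nat -> V) (q : nat -> nat).
Hypothesis hP : standing_assumptions X g h.
Hypothesis hrun : CDP_ESQM_run X g h beta sigma varrho c alpha M_G x p v G d q.
Variables (D : set V) (rho : R).
Hypotheses (D_compact : compact D) (D_mix : mix_closed D) (DX : D `<=` X).
Hypotheses (xD : forall k, D (x k)) (rho0 : 0 < rho).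
Hypothesis hat_h_convex : forall i, econvex_on D (hat_h h rho i).
Let sp := mxdot_scalar_product R n 1.
Local Notation slp k := (slope g (x k) (v k)).

Definition multipliers (k : nat) (l : I -> R) : Prop :=
  [/\ forall i, 0 <= l i <= 1,
      forall i, l i * (phir g h (Some i) (x k) + dot (slp k (Some i)) (d k)) =
        Num.max (phir g h (Some i) (x k) + dot (slp k (Some i)) (d k)) 0 &
      forall e, X (x k + e) ->
        0 <= dot (\sum_j weight (p k) l j *: slp k j + G k *m d k) (e - d k)].

Lemma multipliers_ex k : exists l : I -> R, multipliers k l.
Proof.
have w0 : 0 <= (p k)^-1 by rewrite invr_ge0 ltW // (p_gt0 hrun).
have [||l [l01 lmax H]] := @subproblem_kkt _ _ _ [set e | X (x k + e)] (p k)^-1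
  ((phir g h)^~ (x k)) (slp k) (G k) (d k) (@translate_mix _ _ _ X g h hP (x k)) w0.
- exact: (xd_in hP hrun k).
- move=> e Xe; exact: (first_order hP hrun Xe).
exists l; split => // e Xe; rewrite sum_option; exact: H.
Qed.

(** Cauchy-Schwarz for the form of G_k bounds the square of an entry by the product of two diagonal
    entries, and these are values of the form at unit vectors, hence at most M_G. *)
Lemma G_bounded : exists2 B : R, 0 <= B & forall k, fnorm (G k) <= B.
Proof.
have MG := M_G_gt0 hrun.
have [C C0 HC] := sp_equiv (mxdot_scalar_product R n n).
exists (C * M_G) => [|k]; first by rewrite mulr_ge0 // ltW.
apply: le_trans (proj2 (HC (G k))) _; rewrite ler_pM2l //.
apply: mx_norm_le; first exact: ltW.
move=> i j; pose e (a : 'I_n) : V := delta_mx a 0.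
have ne a : norm (e a) ^+ 2 = 1.
  rewrite (enorm_sqr sp) /mxdot (bigD1 a) //= big_ord1 !mxE !eqxx mulr1.
  by rewrite big1 ?addr0 // => b ba; rewrite big_ord1 !mxE (negbTE ba) mul0r.
have GE : G k i j = dot (G k *m e j) (e i).
  rewrite /e -colE /mxdot (bigD1 i) //= big_ord1 !mxE !eqxx mulr1 big1 ?addr0 //.
  by move=> b bi; rewrite big_ord1 !mxE (negbTE bi) mulr0.
have B0 y : 0 <= dot (G k *m y) y.
  have /andP[+ _] := G_bounds hrun k y; apply: le_trans.
  by rewrite mulr_ge0 ?sqr_ge0 // ltW // (alpha_gt0 hrun).
have Bd a : dot (G k *m e a) (e a) <= M_G.
  by have /andP[_] := G_bounds hrun k (e a); rewrite ne mulr1.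
have := @psd_cauchy_schwarz R V (fun y z => dot (G k *m y) z) _ _ _ B0 (e j) (e i).
rewrite -GE => H; rewrite -(@ler_pXn2r _ 2) ?nnegrE ?(ltW MG) //.
rewrite real_normK ?num_real //; apply: (@le_trans _ _ (dot (G k *m e j) (e j) * dot (G k *m e i) (e i))).
  apply: H.
  - by move=> y z; rewrite mxdot_mulmx_tr (G_sym hrun) (sp_sym sp).
  - by move=> y z w; rewrite mulmxDr (sp_Dl sp).
  - by move=> a y z; rewrite -scalemxAr (sp_Zl sp).
by rewrite expr2; apply: ler_pM.
Qed.

Lemma norm_sum (J : finType) (f : J -> V) : norm (\sum_j f j) <= \sum_j norm (f j).
Proof.
elim/big_ind2 : _ => [|x1 x2 y1 y2 h1 h2|//]; first by rewrite (enorm0 sp).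
by apply: le_trans (enormD sp _ _) _; exact: lerD.
Qed.

(** Each component carries a factor d; the square in the G-component is reduced by the bound B on
    the steps. The constant W bounds the total weight, 1/p_0 plus one for each constraint. *)
Lemma base_subgradient_bounded : exists2 C : R, 0 < C & forall k l, multipliers k l ->
  enorm mdot (base_subgradient g (p k) l (x k) (d k) (G k) (v k)) <= C * norm (d k).
Proof.
have [L L0 HL] := slope_bounded hP hrun D_compact DX xD.
have [B B0 HB] := d_bounded hP hrun D_compact DX xD.
have [F F0 HF] := G_bounded.
pose W : R := (p 0%N)^-1 + \sum_(i : I) 1.
have W0 : 0 <= W.
  by rewrite addr_ge0 ?sumr_ge0 // invr_ge0 ltW // (p_gt0 hrun).
exists (2 * F + W * L + F * B + B + W + 1).
  by have := mulr_ge0 W0 L0; have := mulr_ge0 F0 B0; lra.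
move=> k l [l01 _ _].
have lam0 j : 0 <= weight (p k) l j.
  case: j => [i|] /=; first by case/andP: (l01 i).
  by rewrite invr_ge0 ltW // (p_gt0 hrun).
have lamW : \sum_j weight (p k) l j <= W.
  rewrite sum_option /=; apply: lerD.
    by have /andP[] := p_inv_le hrun k.
  by apply: ler_sum => i _; case/andP: (l01 i).
have D0 := enorm_ge0 dot (d k).
have Gd : norm (G k *m d k) <= F * norm (d k).
  by apply: le_trans (enorm_mulmx _ _) _; apply: ler_wpM2r.
have sb : norm (\sum_j weight (p k) l j *: slp k j) <= W * L.
  apply: le_trans (norm_sum _) _; apply: le_trans (ler_wpM2r L0 lamW).
  rewrite mulr_suml; apply: ler_sum => j _.
  by rewrite (enormZ sp) ger0_norm //; apply: ler_wpM2l.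
rewrite /base_subgradient; apply: le_trans (merit_norm_le _ _ _ _ _ _) _.
have s6 : enorm (@mxdot R n _) (0 : vfamily R n I) = 0.
  exact: (enorm0 (mxdot_scalar_product R n _)).
rewrite (enormN sp) outer_norm s6 addr0.
have s2 : `|dot (\sum_j weight (p k) l j *: slp k j) (d k) + dot (G k *m d k) (d k)|
    <= (W * L + F * B) * norm (d k).
  apply: le_trans (ler_normD _ _) _; rewrite mulrDl; apply: lerD.
    by apply: le_trans (cauchy_schwarz sp _ _) _; apply: ler_wpM2r.
  apply: le_trans (mxdot_mulmx_le _ _ _) _; apply: ler_wpM2r => //.
  exact: ler_pM (enorm_ge0 _ _) _ (HF k) (HB k).
have s5 : enorm (@mxdot R n _) (fam (fun j => weight (p k) l j *: d k)) <= W * norm (d k).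
  apply: le_trans (fam_norm _) _; apply: le_trans (ler_wpM2r D0 lamW).
  rewrite mulr_suml; apply: ler_sum => j _.
  by rewrite (enormZ sp) ger0_norm.
have s4 : norm (d k) ^+ 2 <= B * norm (d k) by rewrite expr2 ler_wpM2r.
move: (norm (d k)) (norm (G k *m d k)) D0 Gd s2 s4 s5 => Dk Gk D0 Gd s2 s4 s5.
by move: s2 s4 s5; move: `|_| (enorm _ (fam _)) (Dk ^+ 2) => a1 a2 a3; lra.
Qed.

Lemma phir_ultra_cvg (F : set_system nat) (FF : Filter F) xb i :
  D xb -> x @ F --> xb -> (fun k => phir g h i (x k)) @ F --> phir g h i xb.
Proof.
move=> Dxb xxb; rewrite /phir; apply: cvgB.
  have [dg _] := g_C1 hP i.
  exact: (cvg_comp _ _ xxb (differentiable_continuous (dg xb))).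
have [del [k0 [del0 k00 _ Hk]]] := loc_lipschitz_bound (h_lipschitz hP i (DX Dxb)).
apply/cvgrPdist_lt => e e0.
have ek0 : 0 < Num.min del (e / k0) by rewrite lt_min del0 divr_gt0.
apply: filterS (proj1 (cvg_enorm sp _ _) xxb _ ek0) => k.
rewrite lt_min ltr_pdivlMr // => /andP[kd ke].
have xx : norm (xb - xb) < del by rewrite subrr (enorm0 sp).
apply: le_lt_trans (Hk _ _ xx kd) _.
by rewrite (enorm_subC sp) mulrC.
Qed.

Lemma penr_ultra_cvg (F : set_system nat) (FF : Filter F) pb xb :
  D xb -> x @ F --> xb -> (fun k => penr g h pb (x k)) @ F --> penr g h pb xb.
Proof.
move=> Dxb xxb; rewrite /penr; apply: cvgD.
  by apply: cvgM; [exact: cvg_cst | exact: phir_ultra_cvg].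
apply: cvg_sum_real => i; apply: cvg_max0; exact: phir_ultra_cvg.
Qed.

Lemma d_cvg0 pb K : (forall k, (K <= k)%N -> p k = pb) ->
  (fun k => norm (d k)) @ \oo --> (0 : R).
Proof.
move=> pK; have [om [th [th0 _ fom dec]]] := values_converge hP hrun D_compact DX xD pK.
have sa0 : 0 < sigma * alpha.
  by rewrite mulr_gt0 // ?(alpha_gt0 hrun) //; case/andP: (sigma_itv hrun).
apply/cvgrPdist_lt => e e0.
(* Two consecutive values within half the threshold of the limit differ by less than the
   threshold. *)
have m0 : 0 < th * (sigma * alpha) * e ^+ 2 / 2 
  by apply: divr_gt0 => //; apply: mulr_gt0; [exact: mulr_gt0 | exact: exprn_gt0].
have fom1 := fom; move/cvgrPdist_lt : fom1 => /(_ _ m0)[N _ HN].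
exists (maxn K N) => // k /=; rewrite geq_max => /andP[Kk Nk].
rewrite sub0r normrN ger0_norm ?enorm_ge0 //.
rewrite -(@ltr_pXn2r _ 2) ?nnegrE ?enorm_ge0 ?(ltW e0) //.
have := dec k Kk; have := opt_value_le hP hrun k; rewrite (pK k Kk).
have := HN k Nk; have := HN k.+1 (leq_trans Nk (leqnSn k)); rewrite /= !ltr_norml.
move: (penr _ _ _ (x k)) (penr _ _ _ (x k.+1)) (opt_value _ _ _ _ _ _ _ _).
move=> f1 f2 E /andP[a1 a2] /andP[b1 b2] Ef hdec.
have h1 : th * (sigma * alpha * norm (d k) ^+ 2) <= f1 - f2.
  by apply: le_trans hdec; rewrite ler_pM2l //; lra.
have h2 : th * (sigma * alpha) * norm (d k) ^+ 2 < th * (sigma * alpha) * e ^+ 2.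
  by move: h1; lra.
have th1 : 0 < th * (sigma * alpha) by exact: mulr_gt0.
by rewrite (ltr_pM2l th1) in h2.
Qed.

(** The limit is identified by evaluation, not by continuity of the merit function. At the limit d =
    0, and the last component consists of limits of subgradients shifted by rho xb; closedness of
    the subdifferential and Fenchel's equality reduce the value to the penalty at xb. *)
Lemma merit_cluster (F : set_system nat) pb K : UltraFilter F -> \oo `<=` F ->
  (forall k, (K <= k)%N -> p k = pb) ->
  exists zb : merit_space R n I,
    [/\ forall e : R, 0 < e -> F [set k | enorm mdot (base_point g rho (x k) (d k) (G k) (v k) - zb) < e],
        merit X g h D rho pb zb \is a fin_num &
        (fun k => penr g h pb (x k)) @ F --> fine (merit X g h D rho pb zb)].
Proof.
move=> FU ooF pK; have FF : ProperFilter F := @ultra_proper _ _ FU.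
have [xb Dxb xxb] := x_ultra_cvg D_compact xD FU.
have [vb Hvb] := v_ultra_cvg hP hrun D_compact DX xD FU Dxb xxb.
have [BG BG0 HG] := G_bounded.
have [|Gb GGb] := @ultra_cvg_mx R nat F n n G BG FU.
  by apply: filterE => k a b; exact: le_trans (entry_le_enorm _ _ _) (HG k).
have [L L0 HL] := slope_bounded hP hrun D_compact DX xD.
have [|wb wwb] := @ultra_cvg_mx R nat F n _ (fun k => fam (slp k)) (\sum_(j : option I) L) FU.
  apply: filterE => k a b; apply: le_trans (entry_le_enorm _ _ _) _.
  by apply: le_trans (fam_norm _) _; apply: ler_sum => j _.
have spM := mxdot_scalar_product R n n.
have spF := mxdot_scalar_product R n #|{: option I}|.
pose ub : vfamily R n I := fam (fun j => vb j + rho *: xb).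
have uub : (fun k => fam (fun j => v k j + rho *: x k)) @ F --> ub.
  apply: cvg_mx => a j; rewrite mxE.
  have -> : (fun k => fam (fun j => v k j + rho *: x k) a j) =
     (fun k => (v k (enum_val j) + rho *: x k) a 0) by apply/funext => k; rewrite mxE.
  apply: cvg_entry; apply: cvgD; first by case: (Hvb (enum_val j)).
  by apply: cvgZr.
(* The family w is only paired with tau d = 0, so [wb] can be any limit and may be replaced by the
   slopes at xb. *)
have tE i : merit_term g h D rho i xb 1 0 wb ub = (phir g h i xb)%:E.
  have := @merit_term_base _ _ _ X g h hP D rho DX D_mix rho0 hat_h_convex i xb 0 vb Dxb
    (proj2 (Hvb i)).
  by rewrite /merit_term scaler0 !(sp_0r sp) !addr0.
have mE : merit X g h D rho pb (xb, 1, 0, Gb, wb, ub) = (penr g h pb xb)%:E.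
  rewrite /merit tE; under eq_bigr do rewrite tE.
  rewrite /indicator addr0; case: asboolP => [_|]; last by have := DX Dxb.
  by rewrite sum_maxe mulmx0 (sp_0l sp) mulr0 !adde0.
exists (xb, 1, 0, Gb, wb, ub); split.
- move=> e e0; have e6 : 0 < e / 6 by rewrite divr_gt0.
  have h1 := proj1 (cvg_enorm sp _ _) xxb _ e6.
  have h2 : F [set k | norm (d k) < e / 6].
    have /cvgrPdist_lt/(_ _ e6)/ooF := d_cvg0 pK.
    by apply: filterS => k /=; rewrite sub0r normrN ger0_norm ?enorm_ge0.
  have h3 := proj1 (cvg_enorm spM _ _) GGb _ e6.
  have h4 := proj1 (cvg_enorm spF _ _) wwb _ e6.
  have h5 := proj1 (cvg_enorm spF _ _) uub _ e6.
  near=> k => /=.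
  have k1 : norm (x k - xb) < e / 6 by near: k; exact: h1.
  have k2 : norm (d k) < e / 6 by near: k; exact: h2.
  have k3 : fnorm (G k - Gb) < e / 6 by near: k; exact: h3.
  have k4 : enorm (@mxdot R n _) (fam (slp k) - wb) < e / 6 by near: k; exact: h4.
  have k5 : enorm (@mxdot R n _) (fam (fun j => v k j + rho *: x k) - ub) < e / 6.
    by near: k; exact: h5.
  have := @merit_norm_le R n I (x k - xb) (d k - 0) (1 - 1) (G k - Gb)
    (fam (slp k) - wb) (fam (fun j => v k j + rho *: x k) - ub).
  move/le_lt_trans; apply; rewrite subr0 subrr normr0.
  move: k1 k2 k3 k4 k5 e0.
  move: (norm (x k - xb)) (norm (d k)) (fnorm _) (enorm _ (fam (slp k) - wb)).
  move=> a1 a2 a3 a4; move: (enorm _ (_ - ub)) => a5; lra.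
- by rewrite mE.
- by rewrite mE; exact: penr_ultra_cvg.
Unshelve. all: by end_near. Qed.

End ClusterPoints.

(** * Finite length and stationarity *)

Section Convergence.
Variables (R : realType) (n : nat) (I : finType).
Local Notation V := 'cV[R]_n.
Local Notation dot := (@mxdot R n 1).
Local Notation norm := (enorm dot).
Local Notation subdiff := (limiting_subdiff dot).
Local Notation mdot := (@merit_dot R n I).
Variables (X : set V) (g : option I -> V -> R) (h : option I -> V -> \bar R).
Variables (beta sigma varrho c alpha M_G : R) (x : nat -> V) (p : nat -> R)
  (v : nat -> option I -> V) (G : nat -> 'M[R]_n) (d : nat -> V) (q : nat -> nat).
Hypothesis hP : standing_assumptions X g h.
Hypothesis hrun : CDP_ESQM_run X g h beta sigma varrho c alpha M_G x p v G d q.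
Variables (D : set V) (rho : R).
Hypotheses (D_compact : compact D) (D_mix : mix_closed D) (DX : D `<=` X).
Hypotheses (xD : forall k, D (x k)) (rho0 : 0 < rho).
Hypothesis hat_h_convex : forall i, econvex_on D (hat_h h rho i).
Variables (pb : R) (K : nat).
Hypothesis pK : forall k, (K <= k)%N -> p k = pb.
Hypothesis infeasK : forall k, (K <= k)%N ->
  (model_infeasibility g h (x k) (v k) (d k) < (c * norm (d k))%:E)%E.
Hypothesis plk : PLK_function mdot (merit X g h D rho pb).
Let sp := mxdot_scalar_product R n 1.
Local Notation slp k := (slope g (x k) (v k)).
Local Notation zpt k := (base_point g rho (x k) (d k) (G k) (v k)).

Lemma merit_zpt k : (K <= k)%N ->
  merit X g h D rho pb (zpt k) = (opt_value g h x p v G d k)%:E.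
Proof.
move=> Kk; rewrite (merit_base hP DX D_mix rho0 hat_h_convex) //.
- by rewrite /opt_value pK.
- exact: (xd_in hP hrun).
- exact: (v_subdiff hrun).
Qed.

Lemma merit_slope_bound : exists2 C : R, 0 < C & forall k, (K <= k)%N ->
  (dist0 mdot (limiting_subdiff mdot (merit X g h D rho pb) (zpt k)) <=
   (C * norm (d k))%:E)%E.
Proof.
have [C C0 HC] := base_subgradient_bounded hP hrun D_compact DX xD.
exists C => // k Kk; have [l Hl] := multipliers_ex hP hrun k.
have := HC k l Hl; rewrite (pK Kk) => hC.
apply: (@le_trans _ _ (enorm mdot (base_subgradient g pb l (x k) (d k) (G k) (v k)))%:E);
  last by rewrite lee_fin.
apply: ereal_inf_lbound; exists (base_subgradient g pb l (x k) (d k) (G k) (v k)) => //.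
apply: regular_limiting; have [l01 lmax kkt] := Hl; rewrite (pK Kk) in kkt.
apply: (merit_subgradient hP DX D_mix rho0 hat_h_convex) => //.
- by rewrite -(pK Kk) (p_gt0 hrun).
- exact: (xd_in hP hrun).
- exact: (G_sym hrun).
- exact: (v_subdiff hrun).
Qed.

(* Let r_k be the gap of the penalty values to their limit and e_k the gap of
   the merit values, e_k <= r_k. If e_k <= r_k / 2, the decrease is a fixed
   fraction of r_k + |d_k|^2, and the square root of r_k controls |d_k|.
   Otherwise the PLK inequality at e_k and the monotonicity of psi' give it at
   r_k / 2, and psi (r_k / 2) controls |d_k|. The function psi depends on the
   cluster point; [ultra_induction_nat] adds up finitely many of them. *)
Lemma steps_summable : exists (N : nat) (a : nat -> R),
  (forall k, (N <= k)%N -> 0 <= a k /\ a k.+1 <= a k) /\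
  forall k, (N <= k)%N -> norm (d k) <= a k - a k.+1.
Proof.
pose P (S : set nat) := exists (N : nat) (a : nat -> R),
  (forall k, (N <= k)%N -> 0 <= a k /\ a k.+1 <= a k) /\
  forall k, S k -> (N <= k)%N -> norm (d k) <= a k - a k.+1.
suff [N [a [Ha Hd]]] : P setT by exists N, a; split => // k; exact: Hd.
apply: ultra_induction_nat.
- by move=> A B AB [N [a [Ha Hd]]]; exists N, a; split => // k /AB; exact: Hd.
- move=> A B [N1 [a [Ha1 Hd1]]] [N2 [b [Hb1 Hd2]]].
  exists (maxn N1 N2), (fun k => a k + b k); split=> [k|k ABk]; rewrite geq_max => /andP[k1 k2].
    have [a0 a1] := Ha1 k k1; have [b0 b1] := Hb1 k k2.
    by split; [exact: addr_ge0 | exact: lerD].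
  have [a0 a1] := Ha1 k k1; have [b0 b1] := Hb1 k k2.
  by case: ABk => Sk; [have := Hd1 k Sk k1 | have := Hd2 k Sk k2]; lra.
- move=> N; exists N, (fun=> 0); split => // k /= kN Nk.
  by move: (leq_trans kN Nk); rewrite ltnn.
move=> F FU ooF; have FF : ProperFilter F := @ultra_proper _ _ FU.
have [om [th [th0 omle fom dec]]] := values_converge hP hrun D_compact DX xD pK.
have [zb [zcvg zfin zval]] := merit_cluster hP hrun D_compact D_mix DX xD rho0
  hat_h_convex FU ooF pK.
have fomF : (fun k => penr g h pb (x k)) @ F --> om.
  by move=> U /fom; exact: ooF.
(* Both numbers are limits of the penalty values along F, so the PLK inequality at zb measures gaps
   to the same level om. *)
have omE : fine (merit X g h D rho pb zb) = om.
  apply/eqP; rewrite eq_le; apply/andP; split.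
    by apply: (ler_cvg_to zval fomF); exact: filterE.
  by apply: (ler_cvg_to fomF zval); exact: filterE.
have mz : merit X g h D rho pb zb = om%:E by rewrite -omE fineK.
have [_ _ /(_ zb)] := plk; rewrite mz ltry => /(_ isT)[eps [eta [psi [eps0 eta0 des Hplk]]]].
have [C C0 HC] := merit_slope_bound.
have ka0 : 0 < sigma * alpha.
  by rewrite mulr_gt0 ?(alpha_gt0 hrun) //; case/andP: (sigma_itv hrun).
pose r k := penr g h pb (x k) - om.
have [N1 _ HN1] : \forall k \near \oo, r k < eta.
  move/cvgrPdist_lt : fom => /(_ _ eta0); apply: filterS => k.
  by rewrite distrC /r; apply: le_lt_trans; exact: ler_norm.
pose N := maxn K N1.
have r0 k : (N <= k)%N -> 0 <= r k.
  by rewrite geq_max => /andP[Kk _]; rewrite subr_ge0; exact: omle.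
have rlt k : (N <= k)%N -> r k < eta.
  by rewrite geq_max => /andP[_ Nk]; exact: HN1.
have rdec k : (N <= k)%N ->
    th * (r k - (opt_value g h x p v G d k - om) + sigma * alpha * norm (d k) ^+ 2)
    <= r k - r k.+1.
  rewrite geq_max => /andP[Kk _]; have := dec k Kk; rewrite /r.
  move: (penr _ _ _ _) (penr _ _ _ _) (opt_value _ _ _ _ _ _ _ _) => f1 f2 E; lra.
have ele k : (N <= k)%N -> opt_value g h x p v G d k - om <= r k.
  rewrite geq_max => /andP[Kk _]; have := opt_value_le hP hrun k.
  by rewrite (pK Kk) /r lerD2r.
have D2 k : 0 <= norm (d k) ^+ 2 by exact: sqr_ge0.
have rdec2 k : (N <= k)%N -> th * (sigma * alpha) * norm (d k) ^+ 2 <= r k - r k.+1.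
  move=> Nk; apply: le_trans (rdec k Nk); rewrite -mulrA ler_pM2l // lerDr subr_ge0.
  exact: ele.
have rmono k : (N <= k)%N -> r k.+1 <= r k.
  move=> Nk; rewrite -subr_ge0; apply: le_trans (rdec2 k Nk).
  by rewrite mulr_ge0 // ltW // mulr_gt0.
pose C1 := (th * Num.min 2^-1 (sigma * alpha))^-1.
pose C2 := 2 * C / (th * (sigma * alpha)).
have C10 : 0 <= C1.
  by rewrite invr_ge0 mulr_ge0 ?(ltW th0) // le_min invr_ge0 ler0n ltW.
have C20 : 0 <= C2 by apply: divr_ge0; apply: mulr_ge0 => //; exact: ltW.
have [psi0 _ _ _ dpsi] := des.
have half k : (N <= k)%N -> 0 <= r k / 2 < eta.
  move=> Nk; have rk0 := r0 k Nk; rewrite divr_ge0 //=.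
  by apply: le_lt_trans (rlt k Nk); rewrite ler_pdivrMr // ler_peMr // ler1n.
have sq k : (N <= k)%N -> 0 <= Num.sqrt (r k) - Num.sqrt (r k.+1).
  by move=> Nk; rewrite subr_ge0; apply: ler_wsqrtr; exact: rmono.
have ps k : (N <= k)%N -> 0 <= psi (r k / 2) - psi (r k.+1 / 2).
  move=> Nk; rewrite subr_ge0; apply: (desingularizing_nondecreasing des).
  - by case/andP: (half k.+1 (leq_trans Nk (leqnSn k))).
  - by rewrite ler_pM2r ?invr_gt0 //; exact: rmono.
  - by case/andP: (half k Nk).
exists [set k | enorm mdot (zpt k - zb) < eps]; first exact: zcvg.
(* Both summands are nonincreasing in k. In each of the two cases one of them controls the step, and
   the decrease of the other is a nonnegative surplus. *)
pose a k := C1 * Num.sqrt (r k) + C2 * psi (r k / 2).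
have aB k : a k - a k.+1 = C1 * (Num.sqrt (r k) - Num.sqrt (r k.+1))
    + C2 * (psi (r k / 2) - psi (r k.+1 / 2)).
  by rewrite /a opprD addrACA -!mulrBr.
exists N, a; split=> [k Nk|k Ak Nk].
  split; first by rewrite addr_ge0 // mulr_ge0 ?sqrtr_ge0 // psi0 // half.
  by rewrite -subr_ge0 aB addr_ge0 // mulr_ge0 ?sq ?ps.
rewrite aB.
have Nk1 := leq_trans Nk (leqnSn k).
have Kk : (K <= k)%N by move: Nk; rewrite geq_max => /andP[].
have [er|er] := leP (opt_value g h x p v G d k - om) (r k / 2).
  have := sqrt_step th0 ka0 (enorm_ge0 _ _) (r0 _ Nk1) (rmono k Nk) er (rdec k Nk).
  rewrite -/C1 => /le_trans; apply; rewrite lerDl.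
  by rewrite mulr_ge0 ?ps.
have rk0 := r0 k Nk.
have e0 : 0 < opt_value g h x p v G d k - om.
  by apply: le_lt_trans er; rewrite divr_ge0.
have eeta : opt_value g h x p v G d k - om < eta := le_lt_trans (ele k Nk) (rlt k Nk).
have := Hplk (zpt k) Ak; rewrite merit_zpt // mz -EFinD !lte_fin /=.
have -> : om < opt_value g h x p v G d k by rewrite -subr_gt0.
have -> : opt_value g h x p v G d k < om + eta by rewrite addrC -ltrBlDr.
move=> /(_ isT isT) Hk.
have hde : 0 < opt_value g h x p v G d k - om < eta by rewrite e0 eeta.
have [_ _ dpos] := dpsi _ hde.
have H1 : 1 <= derive1 psi (opt_value g h x p v G d k - om) * (C * norm (d k)).
  rewrite -lee_fin EFinM; apply: (le_trans Hk); apply: lee_wpmul2l.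
    by rewrite lee_fin ltW.
  exact: HC.
have ka1 : 0 < th * (sigma * alpha) by exact: mulr_gt0.
have := desingularizing_step des ka1 C0 (enorm_ge0 _ _) (r0 _ Nk1) (rmono k Nk)
  (rlt k Nk) er (ele k Nk) H1 (rdec2 k Nk).
rewrite -/C2 => /le_trans; apply; rewrite lerDr.
by rewrite mulr_ge0 ?sq.
Qed.

(** The path after index J has length at most a_J minus the infimum of a. The limit point itself
    comes from compactness of D along an ultrafilter above [\oo]. *)
Lemma iterates_converge : exists2 xb, D xb & x @ \oo --> xb.
Proof.
have [N [a [Ha Hd]]] := steps_summable.
have [F [FU ooF]] := ultraFilterLemma (@eventually_filter : ProperFilter \oo).
have FF : ProperFilter F := @ultra_proper _ _ FU.
have [xb Dxb xxb] := x_ultra_cvg D_compact xD FU.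
exists xb => //; apply/(cvg_enorm sp) => e e0.
have step k : norm (x k.+1 - x k) <= norm (d k).
  rewrite (x_update hrun) [x k + _]addrC addrK (enormZ sp) ger0_norm.
    by apply: ler_piMl; [exact: enorm_ge0 | exact: (tau_le1 hrun k)].
  exact: ltW (tau_gt0 hrun k).
have amono j k : (N <= j)%N -> (j <= k)%N -> a k <= a j.
  move=> Nj /subnKC <-; elim: (k - j)%N => [|l IH]; first by rewrite addn0.
  rewrite addnS; apply: le_trans IH.
  by have [] := Ha (j + l)%N (leq_trans Nj (leq_addr l j)).
have dist j k : (N <= j)%N -> (j <= k)%N -> norm (x k - x j) <= a j - a k.
  move=> Nj /subnKC <-; elim: (k - j)%N => [|l IH].
    by rewrite addn0 !subrr (enorm0 sp).
  rewrite addnS; have Nl := leq_trans Nj (leq_addr l j).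
  have -> : x (j + l).+1 - x j = (x (j + l).+1 - x (j + l)%N) + (x (j + l)%N - x j).
    by rewrite addrA subrK.
  apply: le_trans (enormD sp _ _) _.
  have := le_trans (step (j + l)%N) (Hd (j + l)%N Nl); move: IH.
  by move: (norm _) (norm _) => b1 b2; lra.
pose S := [set a k | k in [set k | (N <= k)%N]].
have Sinf : has_inf S.
  split; first by exists (a N), N => //=.
  by exists 0 => _ [k Nk <-]; case: (Ha k Nk).
have e2 : 0 < e / 2 by rewrite divr_gt0.
have [_ [J /= NJ <-] HJ] := inf_adherent e2 Sinf.
have dJ k : (J <= k)%N -> norm (x k - x J) < e / 2.
  move=> Jk; apply: le_lt_trans (dist J k NJ Jk) _.
  have : inf S <= a k by apply: ge_inf; [case: Sinf | exists k => //=; exact: leq_trans Jk].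
  by move: HJ; lra.
have dxb : norm (x J - xb) <= e / 2.
  apply/ler_addgt0Pr => s s0.
  have h1 : F [set k | norm (x k - xb) < s] by exact: (proj1 (cvg_enorm sp _ _) xxb _ s0).
  have h2 : F [set k | (J <= k)%N] by apply: ooF; exists J.
  have [k [/= k1 k2]] := filter_ex (filterI h1 h2).
  have -> : x J - xb = (x J - x k) + (x k - xb) by rewrite addrA subrK.
  apply: le_trans (enormD sp _ _) _; rewrite (enorm_subC sp).
  by have := dJ k k2; move: k1; move: (norm _) (norm _) => b1 b2; lra.
exists J => // k /= Jk.
have -> : x k - xb = (x k - x J) + (x J - xb) by rewrite addrA subrK.
apply: le_lt_trans (enormD sp _ _) _.
by have := dJ k Jk; move: dxb; move: (norm _) (norm _) => b1 b2; lra.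
Qed.

Lemma limit_stationary xb : D xb -> x @ \oo --> xb -> stationary X g h xb.
Proof.
move=> Dxb xcv; have Xxb := DX Dxb.
have [F [FU ooF]] := ultraFilterLemma (@eventually_filter : ProperFilter \oo).
have FF : ProperFilter F := @ultra_proper _ _ FU.
have FFil : Filter F by exact: filter_filter.
have xxb : x @ F --> xb by move=> U /xcv; exact: ooF.
have [vb Hvb] := v_ultra_cvg hP hrun D_compact DX xD FU Dxb xxb.
have [l Hl] := choice (multipliers_ex hP hrun).
have [lb Hlb] : exists lb : I -> R, forall i, (fun k => l k i) @ F --> lb i.
  suff H i : exists a : R, (fun k => l k i) @ F --> a.
    by have [b Hb] := choice H; exists b.
  apply: (@ultra_cvg_real _ _ _ _ 1) => //; apply: filterE => k.
  have [/(_ i)/andP[l0 l1] _ _] := Hl k.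
  by rewrite /= ger0_norm.
pose sb j : V := grad (g j) xb - vb j.
have scv j : (fun k => slp k j) @ F --> sb j.
  apply: cvgB; last by case: (Hvb j).
  by have [_ gc] := g_C1 hP j; exact: (cvg_comp _ _ xxb (gc xb)).
have dn : (fun k => norm (d k)) @ F --> (0 : R).
  move=> U /(d_cvg0 hP hrun D_compact DX xD pK); exact: ooF.
have dcv : d @ F --> (0 : V).
  apply/(cvg_enorm sp) => e e0; move/cvgrPdist_lt : dn => /(_ _ e0).
  by apply: filterS => k; rewrite sub0r normrN ger0_norm ?enorm_ge0 // subr0.
have cd : (fun k => c * norm (d k)) @ F --> (0 : R).
  by rewrite -(mulr0 c); apply: cvgM => //; exact: cvg_cst.
pose aff j k := phir g h j (x k) + dot (slp k j) (d k).
have acv j : aff j @ F --> phir g h j xb.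
  rewrite -[X in _ --> X]addr0 -(sp_0r sp (sb j)); apply: cvgD.
    by apply: (phir_ultra_cvg hP DX).
  exact: (@cvg_ip _ _ _ sp _ F FFil (fun k => slp k j) d (sb j) 0 (scv j) dcv).
have FK : F [set k | (K <= k)%N] by apply: ooF; exists K.
(* Failure of the penalty increase bounds each linearized violation by c |d_k|. In the limit this
   yields feasibility, and complementarity through the identity between multiplier terms and
   positive parts. *)
have small i k : (K <= k)%N -> Num.max (aff (Some i) k) 0 <= c * norm (d k).
  move=> Kk; have := infeasK Kk.
  rewrite (model_infeasibilityE hP _ _ (x_in hP hrun k)) lte_fin => /ltW; apply: le_trans.
  rewrite [leRHS](bigD1 i) //= lerDl; apply: sumr_ge0 => j _.
  by rewrite le_max lexx orbT.
have feas i : phir g h (Some i) xb <= 0.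
  apply: (ler_cvg_to (acv (Some i)) cd); apply: filterS FK => k Kk.
  by apply: le_trans (small i k Kk); rewrite le_max lexx.
have compl i : lb i * phir g h (Some i) xb = 0.
  have lcv : (fun k => l k i * aff (Some i) k) @ F --> lb i * phir g h (Some i) xb.
    exact: cvgM.
  have lE k : l k i * aff (Some i) k = Num.max (aff (Some i) k) 0.
    by have [_ /(_ i)] := Hl k.
  apply/eqP; rewrite eq_le; apply/andP; split.
    by apply: (ler_cvg_to lcv cd); apply: filterS FK => k Kk; rewrite lE small.
  apply: (ler_cvg_to (cvg_cst (0 : R)) lcv); apply: filterE => k.
  by rewrite lE le_max lexx orbT.
have lb0 i : 0 <= lb i.
  apply: (ler_cvg_to (cvg_cst (0 : R)) (Hlb i)); apply: filterE => k.
  by have [/(_ i)/andP[]] := Hl k.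
have [BG BG0 HG] := G_bounded hrun.
have Gd : (fun k => G k *m d k) @ F --> (0 : V).
  apply/(cvg_enorm sp) => e e0.
  have eB : 0 < e / (BG + 1) by rewrite divr_gt0 // ltr_wpDl.
  apply: filterS (proj1 (cvg_enorm sp _ _) dcv _ eB) => k.
  rewrite !subr0 ltr_pdivlMr ?ltr_wpDl // => h1; apply: le_lt_trans h1.
  apply: le_trans (enorm_mulmx _ _) _; rewrite mulrC; apply: ler_wpM2l.
    exact: enorm_ge0.
  by apply: le_trans (HG k) _; rewrite lerDl.
have pb0 : 0 < pb by rewrite -(pK (leqnn K)) (p_gt0 hrun).
have wcv j : (fun k => weight pb (l k) j) @ F --> weight pb lb j.
  by case: j => [i|] /=; [exact: Hlb | exact: cvg_cst].
(* The optimality condition at step k is tested with the displacement y - x_k; the term with G_k d_k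
   vanishes in the limit. *)
have cone y : X y -> 0 <= \sum_j weight pb lb j * dot (sb j) (y - xb).
  move=> Xy; have ycv : (fun k => y - x k - d k) @ F --> y - xb.
    have y_cst : (fun=> y) @ F --> y by exact: cvg_cst.
    have yx_cv := @cvgB _ _ _ F FFil _ x _ xb y_cst xxb.
    have := @cvgB _ _ _ F FFil _ d _ 0 yx_cv dcv.
    by rewrite subr0.
  have Scv : (fun k => \sum_j weight pb (l k) j * dot (slp k j) (y - x k - d k)
      + dot (G k *m d k) (y - x k - d k)) @ F -->
      \sum_j weight pb lb j * dot (sb j) (y - xb) + dot 0 (y - xb).
    have sum_cv := @cvg_sum_real _ _ F FFil _ _ _ (fun j => @cvgM _ _ F FFil _ _ _ _ (wcv j)
      (@cvg_ip _ _ _ sp _ F FFil (fun k => slp k j) (fun k => y - x k - d k) _ _ (scv j) ycv)).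
    have G_cv := @cvg_ip _ _ _ sp _ F FFil _ (fun k => y - x k - d k) _ _ Gd ycv.
    exact: (@cvgD _ _ _ F FFil _ _ _ _ sum_cv G_cv).
  rewrite (sp_0l sp) addr0 in Scv.
  apply: (ler_cvg_to (cvg_cst (0 : R)) Scv); apply: filterS FK => k Kk.
  have [_ _ /(_ (y - x k))] := Hl k; rewrite subrKC => /(_ Xy).
  by rewrite (sp_Dl sp) dot_sum (pK Kk).
split.
  by split => // i; rewrite (phiE hP _ Xxb) lee_fin.
(* The subproblems weight the objective by 1/pb, so the stationarity condition is the limit
   condition multiplied by pb, with multipliers [pb * lb i]. *)
pose S : V := sb None + \sum_(i : I) (pb * lb i) *: sb (Some i).
exists (fun i => pb * lb i), vb, (- S); split.
- by move=> i; rewrite mulr_ge0 // ltW.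
- by move=> i; case: (Hvb i).
- split=> // y Xy; rewrite (sp_Nl sp) oppr_le0.
  have := cone y Xy; rewrite sum_option /= => h1.
  have := mulr_ge0 (ltW pb0) h1.
  rewrite mulrDr mulrA divff ?gt_eqF // mul1r /S (sp_Dl sp (sb None)) dot_sum mulr_sumr.
  by under eq_bigr do rewrite mulrA.
- by rewrite subrr.
- by move=> i; rewrite (phiE hP _ Xxb) -EFinM -mulrA compl mulr0.
Qed.

End Convergence.

Theorem theorem4p3 (R : realType) (n : nat) (I : finType)
    (X : set 'cV[R]_n)
    (g : option I -> 'cV[R]_n -> R) (h : option I -> 'cV[R]_n -> \bar R)
    (beta sigma varrho c alpha M_G : R)
    (x : nat -> 'cV[R]_n) (p : nat -> R) (v : nat -> option I -> 'cV[R]_n)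
    (G : nat -> 'M[R]_n) (d : nat -> 'cV[R]_n) (q : nat -> nat)
    (hP : standing_assumptions X g h)
    (hrun : CDP_ESQM_run X g h beta sigma varrho c alpha M_G x p v G d q)
    (hx : [bounded x k | k in [set: nat]])
    (hp : [bounded (p k : R^o) | k in [set: nat]]) :
  exists pbar : R,
    [/\ 0 < pbar,
        \forall k \near \oo, p k = pbar &
        forall (D : set 'cV[R]_n) (rho : R),
          merit_data X h D rho x ->
          PLK_function (@merit_dot R n I) (merit X g h D rho pbar) ->
          exists2 xbar : 'cV[R]_n, x @ \oo --> xbar & stationary X g h xbar].
Proof.
have [K HK] := penalty_parameter_stable hrun hp.
exists (p K); split; first exact: p_gt0 hrun K.
  by exists K => // k Kk; case: (HK k Kk).
move=> D rho [[cD convD DX xD] [rho0 hconv]] plk.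
have pK k : (K <= k)%N -> p k = p K by move=> Kk; case: (HK k Kk).
have infeasK k : (K <= k)%N ->
    (model_infeasibility g h (x k) (v k) (d k) < (c * enorm (@mxdot R n 1) (d k))%:E)%E.
  by move=> Kk; case: (HK k Kk).
have D_mix := convex_set_mix convD.
have [xb Dxb xcv] := iterates_converge hP hrun cD D_mix DX xD rho0 hconv pK plk.
exists xb => //; exact: (limit_stationary hP hrun cD DX xD pK infeasK Dxb xcv).
Qed.
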